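(* Let $J\in(H^1(\mathbb R^3))^3$ have compact support, and let $E_\infty(\hat x,k)$ and $H_\infty(\hat x,k)$, $\hat x\in\mathbb S^2$, $k>0$, be the electric and magnetic far field patterns of $J$. (1) Define $$\mathcal I_H(z):=\frac{\sqrt{\mu}}{2\pi^2}\int_{\mathbb S^2}\int_0^{+\infty}H_{\infty}(\hat x,k)\,e^{ik\hat x\cdot z}\,k^2\,dk\,ds_{\hat x},\quad z\in\mathbb R^3.$$ Then $\mathcal I_H=\operatorname{curl}J$. (2) Let the charge density $\rho:=\frac{1}{i\omega}\operatorname{div}J\in L^2(\mathbb R^3)$ be known, and define $$\mathcal I_{\rho}(z):=\frac{1}{(2\pi)^3}\int_{\mathbb S^2}\int_0^{+\infty}\Big(\omega\,\mathcal F[\rho](k\hat x)\,\hat x-4\pi i\sqrt{\varepsilon}\,E_{\infty}(\hat x,k)\Big)e^{ik\hat x\cdot z}\,k\,dk\,ds_{\hat x},\quad z\in\mathbb R^3.$$ Then $\mathcal I_{\rho}=J$.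
   Context: $\varepsilon>0$ (electric permittivity) and $\mu>0$ (magnetic permeability) are constants; the wave number $k>0$ and frequency $\omega>0$ are related by $k=\omega\sqrt{\mu\varepsilon}$. Thus inside the $k$-integral $\omega=k/\sqrt{\mu\varepsilon}$, and $\rho=\frac{1}{i\omega}\operatorname{div}J$ depends on $k$ through $\omega$. $\mathbb S^2$ is the unit sphere in $\mathbb R^3$ and $ds_{\hat x}$ its surface measure. The Fourier transform is $\mathcal F[U](\xi):=\int_{\mathbb R^3}U(x)e^{-ix\cdot\xi}\,dx$. The far field patterns of $J$ are $$E_{\infty}(\hat x,k)=\frac{ik}{4\pi\sqrt{\varepsilon}}\,\hat x\times\left(\int_{\mathbb R^3}e^{-ik\hat x\cdot y}J(y)\,dy\times\hat x\right),\qquad H_{\infty}(\hat x,k)=\sqrt{\frac{\varepsilon}{\mu}}\;\hat x\times E_{\infty}(\hat x,k).$$ The integrals defining $\mathcal I_H$ and $\mathcal I_\rho$ are understood in the inverse Fourier–Plancherel sense: they are limits in $(L^2(\mathbb R^3))^3$ as $R\to+\infty$ of the integrals with $\int_0^{+\infty}dk$ replaced by $\int_0^{R}dk$; equalities are in $(L^2(\mathbb R^3))^3$. *)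

(* Defs.v *)
From HB Require Import structures.
From mathcomp Require Import all_boot all_order all_algebra.
From mathcomp Require Import complex.
From mathcomp Require Import all_classical all_reals all_analysis.

Set Implicit Arguments.
Unset Strict Implicit.
Unset Printing Implicit Defensive.

Import Order.TTheory GRing.Theory Num.Theory.
Import numFieldNormedType.Exports.

Local Open Scope classical_set_scope.
Local Open Scope ring_scope.
Local Open Scope complex_scope.

(* R^3 is the iterated product R * R * R, which carries both the product
   sigma-algebra (Borel) and the normed-module structure of the library;
   C^3 is the type of row vectors over R[i]. *)
Notation space3 R := (R * R * R)%type.
Notation cvec3 R := 'rV[R[i]]_3.

Section Defs.
Variable R : realType.

Definition leb3 : {measure set (space3 (measurableTypeR R)) -> \bar R} :=
  (@lebesgue_measure R \x @lebesgue_measure R \x @lebesgue_measure R)%E.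

Definition coord3 (x : space3 R) (i : 'I_3) : R :=
  if i == 0 then x.1.1 else if i == 1 then x.1.2 else x.2.

Definition basis3 (i : 'I_3) : space3 R :=
  ((i == 0)%:R, (i == 1)%:R, (i == 2%:R)%:R).

Definition dot (x y : space3 R) : R := \sum_(i < 3) coord3 x i * coord3 y i.

Definition to_cvec (x : space3 R) : cvec3 R := \row_i (coord3 x i)%:C.

(* Indices are taken in Z/3Z, so i + 1 and i + 2 are the cyclic successors. *)
Definition cross (u v : cvec3 R) : cvec3 R :=
  \row_i (u 0 (i + 1) * v 0 (i + 2%:R) - u 0 (i + 2%:R) * v 0 (i + 1)).

Definition cis (t : R) : R[i] := cos t +i* sin t.

Definition cint d (T : measurableType d) (m : {measure set T -> \bar R})
    (D : set T) (f : T -> R[i]) : R[i] :=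
  (\int[m]_(x in D) complex.Re (f x))%R +i* (\int[m]_(x in D) complex.Im (f x))%R.

Definition vint d (T : measurableType d) (m : {measure set T -> \bar R})
    (D : set T) (F : T -> cvec3 R) : cvec3 R :=
  \row_i cint m D (fun x => F x 0 i).

Definition fourier (U : space3 R -> R[i]) (xi : space3 R) : R[i] :=
  cint leb3 setT (fun x => cis (- dot x xi) * U x).

(* Surface integral over the unit sphere in the parametrization below;
   sin theta is the area element, the norm of the cross product of the two
   partial derivatives of the parametrization. *)
Definition sphere_param (t : R * R) : space3 R :=
  (sin t.1 * cos t.2, sin t.1 * sin t.2, cos t.1).

Definition sphere_vint (F : space3 R -> cvec3 R) : cvec3 R :=
  vint (@lebesgue_measure R \x @lebesgue_measure R)%E
    (`[0, pi] `*` `[0, 2 * pi])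
    (fun t => (sin t.1)%:C *: F (sphere_param t)).

Definition L2norm (F : space3 R -> cvec3 R) : \bar R :=
  Lnorm leb3 2%:E (fun x =>
    (Num.sqrt (\sum_(i < 3) Normc.normc (F x 0 i) ^+ 2))%:E).

Definition L2 (f : space3 R -> R[i]) : Prop :=
  [/\ measurable_fun (setT : set (space3 (measurableTypeR R)))
        (fun x => complex.Re (f x)),
      measurable_fun (setT : set (space3 (measurableTypeR R)))
        (fun x => complex.Im (f x))
    & (Lnorm leb3 2%:E (fun x => (Normc.normc (f x))%:E) < +oo)%E].

Definition L2vec (F : space3 R -> cvec3 R) : Prop :=
  forall i, L2 (fun x => F x 0 i).

Definition L2_converges (F : R -> space3 R -> cvec3 R)
    (G : space3 R -> cvec3 R) : Prop :=
  [/\ forall r, 0 < r -> L2vec (F r),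
      L2vec G
    & L2norm (fun z => F r z - G z) @[r --> +oo] --> 0%E].

Definition iter_partial (s : seq 'I_3) (phi : space3 R -> R) : space3 R -> R :=
  foldr (fun i g => 'D_(basis3 i) g) phi s.

Definition smooth (phi : space3 R -> R) : Prop :=
  forall s : seq 'I_3, continuous (iter_partial s phi) /\
    forall i x, derivable (iter_partial s phi) x (basis3 i).

Definition test_function (phi : space3 R -> R) : Prop :=
  smooth phi /\
  exists2 K : set (space3 R), compact K & forall x, ~ K x -> phi x = 0.

Definition is_weak_partial (i : 'I_3) (f g : space3 R -> R[i]) : Prop :=
  forall phi, test_function phi ->
    cint leb3 setT (fun x => f x * ('D_(basis3 i) phi x)%:C) =
    - cint leb3 setT (fun x => g x * (phi x)%:C).

Definition H1 (f : space3 R -> R[i]) : Prop :=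
  L2 f /\ forall i, exists g, L2 g /\ is_weak_partial i f g.

Definition H1vec (F : space3 R -> cvec3 R) : Prop :=
  forall i, H1 (fun x => F x 0 i).

(* A chosen representative of the weak derivative of f in L^2, and 0 when f
   has none. *)
Definition weak_partial (i : 'I_3) (f : space3 R -> R[i]) : space3 R -> R[i] :=
  xget (fun=> 0) [set g | L2 g /\ is_weak_partial i f g].

Definition curl (F : space3 R -> cvec3 R) (x : space3 R) : cvec3 R :=
  \row_i (weak_partial (i + 1) (fun y => F y 0 (i + 2%:R)) x
          - weak_partial (i + 2%:R) (fun y => F y 0 (i + 1)) x).

Definition div (F : space3 R -> cvec3 R) (x : space3 R) : R[i] :=
  \sum_(i < 3) weak_partial i (fun y => F y 0 i) x.

(* Elements of L^2 are represented by functions, so the support is compact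
   when the function vanishes almost everywhere off a compact set. *)
Definition compact_support (F : space3 R -> cvec3 R) : Prop :=
  exists2 K : set (space3 R), compact K &
    {ae leb3, forall x, ~ K x -> F x = 0}.

Definition far_E (eps : R) (J : space3 R -> cvec3 R) (xh : space3 R) (k : R) :
    cvec3 R :=
  ('i * k%:C / (4 * pi * Num.sqrt eps)%:C) *:
  cross (to_cvec xh)
    (cross (vint leb3 setT (fun y => cis (- (k * dot xh y)) *: J y))
       (to_cvec xh)).

Definition far_H (eps mu : R) (J : space3 R -> cvec3 R) (xh : space3 R)
    (k : R) : cvec3 R :=
  (Num.sqrt (eps / mu))%:C *: cross (to_cvec xh) (far_E eps J xh k).

(* k = omega * sqrt (mu * eps) *)
Definition frequency (eps mu k : R) : R := k / Num.sqrt (mu * eps).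

Definition charge_density (eps mu : R) (J : space3 R -> cvec3 R) (k : R)
    (x : space3 R) : R[i] :=
  ('i * (frequency eps mu k)%:C)^-1 * div J x.

Definition I_H (eps mu : R) (J : space3 R -> cvec3 R) (r : R) (z : space3 R) :
    cvec3 R :=
  (Num.sqrt mu / (2 * pi ^+ 2))%:C *:
  sphere_vint (fun xh =>
    vint (@lebesgue_measure R) `]0, r[
      (fun k => (cis (k * dot xh z) * (k ^+ 2)%:C) *: far_H eps mu J xh k)).

Definition I_rho (eps mu : R) (J : space3 R -> cvec3 R) (r : R)
    (z : space3 R) : cvec3 R :=
  (((2 * pi) ^+ 3)^-1)%:C *:
  sphere_vint (fun xh =>
    vint (@lebesgue_measure R) `]0, r[
      (fun k => (cis (k * dot xh z) * k%:C) *: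
         (((frequency eps mu k)%:C *
             fourier (charge_density eps mu J k) (k *: xh)) *: to_cvec xh
          - (4 * pi * Num.sqrt eps)%:C * 'i *: far_E eps J xh k))).

End Defs.

(* Main.v *)
(* Write F for the Fourier transform of J at the point k theta, where theta is a
   unit vector.  Since theta x (theta x (F x theta)) = theta x F, the integrand of
   I_H is, up to constants, e^(i k theta . z) times the Fourier transform of
   curl J at k theta.  That of I_rho involves F itself: theta x (F x theta) is the
   tangential part of F, and the charge density supplies the radial part.  As
   k^2 dk ds is Lebesgue measure in spherical coordinates, the truncated integrals
   are Fourier inversion integrals over balls, which converge by Plancherel.

   Plancherel's identity is needed only for square integrable functions that
   vanish outside a cube.  It is obtained by density from step functions, where
   it follows from the integral of (1 - cos (u x)) / x^2.  The weak derivatives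
   of J are tested against slowly varying cutoffs of cos (x . xi) and
   sin (x . xi), which gives their Fourier transforms. *)
Require Import Defs.
From HB Require Import structures.
From mathcomp Require Import all_boot all_order all_algebra.
From mathcomp Require Import complex finmap.
From mathcomp Require Import all_classical all_reals all_analysis measurable_realfun.
From mathcomp Require Import ring lra.
Set Implicit Arguments.
Unset Strict Implicit.
Unset Printing Implicit Defensive.
Import Order.TTheory GRing.Theory Num.Theory.
Import numFieldNormedType.Exports.
Local Open Scope classical_set_scope.
Local Open Scope ring_scope.
Local Open Scope complex_scope.

(** * Complex-valued integrals *)

(** Every function whose transform is inverted is square integrable and vanishes off a cube. It is
    then integrable, so [fourier] is an honest integral and no extension by continuity is needed.
    The obstacle is that [curl] and [div] use chosen weak derivatives, known only to lie in $L^2$ of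
    the whole space. That they vanish almost everywhere off a slightly larger cube must be proved.
    It follows from the transform itself: cutting the derivative to any larger cube leaves its
    transform unchanged.

    A transform cut to a ball also vanishes off a cube, so the same Parseval identity applies to the
    inverse integral. If $S_r g$ is the truncated inverse, $\|S_r g\|^2$ and $\mathrm{Re}\langle S_r
    g, g\rangle$ both equal $(2\pi)^{-3}$ times the energy of the transform in the ball. The squared
    error is therefore the scaled energy outside the ball, which tends to 0.

    The kernel $(1-\cos(ux))/x^2$ enters because the squared modulus of the transform of an interval
    of length $u$ is twice it. Its integral $\pi|u|$ reduces Parseval for two intervals to a formula
    for the length of their overlap. *)

Section measurability.
Context d (T : measurableType d) (R : realType) (D : set T).
Implicit Types h : T -> R.

Lemma mf_cos h : measurable_fun D h -> measurable_fun D (fun x => cos (h x)).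
Proof.
apply: measurableT_comp => //; apply: continuous_measurable_fun.
exact: continuous_cos.
Qed.

Lemma mf_sin h : measurable_fun D h -> measurable_fun D (fun x => sin (h x)).
Proof.
apply: measurableT_comp => //; apply: continuous_measurable_fun.
exact: continuous_sin.
Qed.

Lemma mf_expR h : measurable_fun D h -> measurable_fun D (fun x => expR (h x)).
Proof. by apply: measurableT_comp => //; exact: measurable_expR. Qed.

Lemma mf_norm h : measurable_fun D h -> measurable_fun D (fun x => `|h x|).
Proof. exact: measurableT_comp. Qed.

Lemma mf_sqrt h : measurable_fun D h -> measurable_fun D (fun x => Num.sqrt (h x)).
Proof.
apply: measurableT_comp => //; apply: continuous_measurable_fun.
exact: sqrt_continuous.
Qed.

(** The inverse is total and discontinuous at 0 only, so the line is split into a point, where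
    everything is measurable, and its open complement, where continuity suffices. *)
Lemma mf_inv h : measurable_fun D h -> measurable_fun D (fun x => (h x)^-1).
Proof.
move=> mh; apply: (@measurableT_comp _ _ _ _ _ _ (@GRing.inv R)) => //.
rewrite -(setvU [set (0 : R)]); apply/measurable_funU.
- exact: measurableC.
- by [].
split; last exact: measurable_fun_set1.
apply: open_continuous_measurable_fun.
  by rewrite openC; exact: closed_eq.
move=> x; rewrite inE/= => /eqP x0.
by apply: (@cvgV _ _ (nbhs x)).
Qed.

Lemma mf_opp h : measurable_fun D h -> measurable_fun D (fun x => - h x).
Proof. exact: measurable_funN. Qed.

Lemma mf_exprn h n : measurable_fun D h -> measurable_fun D (fun x => h x ^+ n).
Proof. exact: measurable_funX. Qed.

Lemma mf_add h1 h2 : measurable_fun D h1 -> measurable_fun D h2 ->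
  measurable_fun D (fun x => h1 x + h2 x).
Proof. exact: measurable_funD. Qed.

Lemma mf_mul h1 h2 : measurable_fun D h1 -> measurable_fun D h2 ->
  measurable_fun D (fun x => h1 x * h2 x).
Proof. exact: measurable_funM. Qed.

Lemma mf_cst (c : R) : measurable_fun D (fun=> c).
Proof. exact: measurable_cst. Qed.

Lemma mf_indic (A : set T) : measurable A -> measurable_fun D (\1_A : T -> R).
Proof. by move=> mA; apply: measurable_funTS; exact: measurable_indic. Qed.

Lemma mf_EFin h : measurable_fun D h -> measurable_fun D (fun x => (h x)%:E).
Proof. by move=> ?; exact/measurable_EFinP. Qed.

End measurability.

Lemma mf_fst d d1 d2 (T : measurableType d) (T1 : measurableType d1)
  (T2 : measurableType d2) (D : set T) (h : T -> T1 * T2) :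
  measurable_fun D h -> measurable_fun D (fun x => (h x).1).
Proof. by apply: measurableT_comp; exact: measurable_fst. Qed.

Lemma mf_snd d d1 d2 (T : measurableType d) (T1 : measurableType d1)
  (T2 : measurableType d2) (D : set T) (h : T -> T1 * T2) :
  measurable_fun D h -> measurable_fun D (fun x => (h x).2).
Proof. by apply: measurableT_comp; exact: measurable_snd. Qed.

Lemma mf_id d (T : measurableType d) (D : set T) : measurable_fun D (fun x : T => x).
Proof. exact: measurable_id. Qed.

Ltac mmeas := repeat first
  [ assumption | exact: mf_cst | exact: mf_id | apply: mf_EFin
  | apply: mf_add | apply: mf_opp | apply: mf_mul | apply: mf_inv | apply: mf_exprn
  | apply: mf_cos | apply: mf_sin | apply: mf_expR | apply: mf_norm | apply: mf_sqrt
  | apply: mf_fst | apply: mf_snd ].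
Notation leb R := (@lebesgue_measure R).
Notation TR R := (measurableTypeR R).
Notation TR2 R := (measurableTypeR R * measurableTypeR R)%type.
Notation TR3 R := (measurableTypeR R * measurableTypeR R * measurableTypeR R)%type.

(** * Sigma-finite product measures *)

Section product_sigma_finite.
Context d1 d2 (T1 : measurableType d1) (T2 : measurableType d2) (R : realType).
Variable m1 : {sigma_finite_measure set T1 -> \bar R}.
Variable m2 : {sigma_finite_measure set T2 -> \bar R}.

(** Both exhaustions are taken increasing, so a point of the product lies in [F n] times [G n] for a
    common index, the maximum of the two. *)
Lemma product_sigma_finite : sigma_finite setT (m1 \x m2)%E.
Proof.
have /sigma_finiteP[F [TF ndF Foo]] := sigma_finiteT m1.
have /sigma_finiteP[G [TG ndG Goo]] := sigma_finiteT m2.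
exists (fun n => F n `*` G n).
  rewrite -setXTT TF TG predeqE => -[x y]; split.
    move=> [/= [n _ Fnx] [k _ Gky]]; exists (maxn n k) => //; split.
    - by move: x Fnx; exact/subsetPset/ndF/leq_maxl.
    - by move: y Gky; exact/subsetPset/ndG/leq_maxr.
  by move=> [n _ []/= ? ?]; split; exists n.
move=> k; have [? ?] := Foo k; have [? ?] := Goo k.
split; first exact: measurableX.
by rewrite product_measure1E// lte_mul_pinfty// ge0_fin_numE.
Qed.

End product_sigma_finite.

Section lebesgue_products.
Variable R : realType.

(* [leb2] and [leb3s] are convertible to the product measures of the statement;
   they carry the sigma-finiteness required by Fubini's theorem. *)
Definition leb2 : set (TR2 R) -> \bar R := (leb R \x leb R)%E.
HB.instance Definition _ := Measure.on leb2.
HB.instance Definition _ := Measure_isSigmaFinite.Build _ _ _ leb2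
  (product_sigma_finite (leb R) (leb R)).

Definition leb3s : set (TR3 R) -> \bar R := (leb2 \x leb R)%E.
HB.instance Definition _ := Measure.on leb3s.
HB.instance Definition _ := Measure_isSigmaFinite.Build _ _ _ leb3s
  (product_sigma_finite leb2 (leb R)).

End lebesgue_products.
Arguments leb2 : clear implicits.
Arguments leb3s : clear implicits.

(** * Squared moduli and complex-valued integrals *)

Section complex_algebra.
Variable R : realType.
Implicit Types (z w : R[i]) (t s : R).

(** The squared modulus as a real polynomial in the two parts: [ring] and measurability apply to it
    directly, without the square root hidden in [Normc.normc]. *)
Definition csq z : R := complex.Re z ^+ 2 + complex.Im z ^+ 2.

Lemma cReD z w : complex.Re (z + w) = complex.Re z + complex.Re w.
Proof. by case: z; case: w. Qed.
Lemma cImD z w : complex.Im (z + w) = complex.Im z + complex.Im w.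
Proof. by case: z; case: w. Qed.
Lemma cReN z : complex.Re (- z) = - complex.Re z. Proof. by case: z. Qed.
Lemma cImN z : complex.Im (- z) = - complex.Im z. Proof. by case: z. Qed.
Lemma cReM z w : complex.Re (z * w) =
  complex.Re z * complex.Re w - complex.Im z * complex.Im w.
Proof. by case: z; case: w. Qed.
Lemma cImM z w : complex.Im (z * w) =
  complex.Re z * complex.Im w + complex.Im z * complex.Re w.
Proof. by case: z; case: w. Qed.
Lemma cReJ z : complex.Re (conjc z) = complex.Re z. Proof. by case: z. Qed.
Lemma cImJ z : complex.Im (conjc z) = - complex.Im z. Proof. by case: z. Qed.

Lemma cReZ t z : complex.Re (t%:C * z) = t * complex.Re z.
Proof. by rewrite cReM/= mul0r subr0. Qed.
Lemma cImZ t z : complex.Im (t%:C * z) = t * complex.Im z.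
Proof. by rewrite cImM/= mul0r addr0. Qed.

Definition cE := (cReD, cImD, cReN, cImN, cReM, cImM, cReJ, cImJ).

Lemma c_ext z w : complex.Re z = complex.Re w -> complex.Im z = complex.Im w ->
  z = w.
Proof. by case: z => a b; case: w => c d /= -> ->. Qed.

Lemma csq_ge0 z : 0 <= csq z.
Proof. by rewrite addr_ge0// sqr_ge0. Qed.

Lemma cnorm_csq z : Normc.normc z = Num.sqrt (csq z).
Proof. by case: z. Qed.

Lemma cnorm_sqr z : Normc.normc z ^+ 2 = csq z.
Proof. by rewrite cnorm_csq sqr_sqrtr// csq_ge0. Qed.

Lemma csqM z w : csq (z * w) = csq z * csq w.
Proof. by rewrite /csq !cE; ring. Qed.

Lemma csqJ z : csq (conjc z) = csq z.
Proof. by rewrite /csq !cE; ring. Qed.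

Lemma csqN z : csq (- z) = csq z.
Proof. by rewrite /csq !cE; ring. Qed.

Lemma csq_real t : csq t%:C = t ^+ 2.
Proof. by rewrite /csq/= expr0n addr0. Qed.

Lemma cjM z w : conjc (z * w) = conjc z * conjc w.
Proof. by apply: c_ext; rewrite !cE; ring. Qed.

Lemma cjK z : conjc (conjc z) = z.
Proof. by apply: c_ext; rewrite !cE ?opprK. Qed.

Lemma mulcJ z : z * conjc z = (csq z)%:C.
Proof. by apply: c_ext; rewrite /csq !cE/=; ring. Qed.

Lemma csq_parallelogram z w :
  csq (z + w) + csq (z - w) = 2 * csq z + 2 * csq w.
Proof. by rewrite /csq !cE; ring. Qed.

Lemma csqD_le z w : csq (z + w) <= 2 * csq z + 2 * csq w.
Proof. by rewrite -csq_parallelogram lerDl csq_ge0. Qed.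

(** The defect of the inequality is $e^{-1}|ez-w|^2$. Unlike [csqD_le], the coefficient of the first
    term can be brought close to 1, which [bessel] needs to keep the sharp constant. *)
Lemma csqD_leW (e : R) z w : 0 < e ->
  csq (z + w) <= (1 + e) * csq z + (1 + e^-1) * csq w.
Proof.
move=> e0; have e1 : 0 < e^-1 by rewrite invr_gt0.
rewrite -subr_ge0; pose u := complex.Re z; pose v := complex.Im z.
have -> : (1 + e) * csq z + (1 + e^-1) * csq w - csq (z + w) =
  e^-1 * csq (e%:C * z - w).
  rewrite /csq !cE/=; field; exact: lt0r_neq0.
by rewrite mulr_ge0 ?csq_ge0// ltW.
Qed.

Lemma ler_cnormRe z : `|complex.Re z| <= Normc.normc z.
Proof.
by rewrite cnorm_csq -sqrtr_sqr ler_wsqrtr// /csq lerDl sqr_ge0.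
Qed.

Lemma ler_cnormIm z : `|complex.Im z| <= Normc.normc z.
Proof.
by rewrite cnorm_csq -sqrtr_sqr ler_wsqrtr// /csq lerDr sqr_ge0.
Qed.

Lemma cnorm_le z : Normc.normc z <= `|complex.Re z| + `|complex.Im z|.
Proof.
rewrite cnorm_csq -(ger0_norm (addr_ge0 (normr_ge0 _) (normr_ge0 _))).
rewrite -sqrtr_sqr ler_wsqrtr// sqrrD !real_normK ?num_real//.
by rewrite /csq lerD2r lerDl mulrn_wge0// mulr_ge0.
Qed.

Lemma cnorm_ge0 z : 0 <= Normc.normc z.
Proof. by rewrite cnorm_csq sqrtr_ge0. Qed.

Lemma cnormM z w : Normc.normc (z * w) = Normc.normc z * Normc.normc w.
Proof. by rewrite !cnorm_csq csqM sqrtrM ?csq_ge0. Qed.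

Lemma cnormJ z : Normc.normc (conjc z) = Normc.normc z.
Proof. by rewrite !cnorm_csq csqJ. Qed.

Lemma cnorm_real t : Normc.normc t%:C = `|t|.
Proof. by rewrite cnorm_csq csq_real sqrtr_sqr. Qed.

Lemma csq_cis t : csq (cis t) = 1.
Proof. by rewrite /csq/= cos2Dsin2. Qed.

Lemma cnorm_cis t : Normc.normc (cis t) = 1.
Proof. by rewrite cnorm_csq csq_cis sqrtr1. Qed.

Lemma cisD t s : cis (t + s) = cis t * cis s.
Proof. by apply: c_ext; rewrite !cE/= ?cosD ?sinD; ring. Qed.

Lemma cisN t : cis (- t) = conjc (cis t).
Proof. by apply: c_ext; rewrite !cE/= ?cosN ?sinN. Qed.

End complex_algebra.

Section complex_measurable.
Context d (T : measurableType d) (R : realType).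
Implicit Types f g : T -> R[i].

Definition cmeas f := measurable_fun setT (fun x => complex.Re (f x)) /\
  measurable_fun setT (fun x => complex.Im (f x)).

Lemma cmeasD f g : cmeas f -> cmeas g -> cmeas (fun x => f x + g x).
Proof.
move=> [f1 f2] [g1 g2]; split.
- by under eq_fun do rewrite cE; apply: measurable_funD.
- by under eq_fun do rewrite cE; apply: measurable_funD.
Qed.

Lemma cmeasN f : cmeas f -> cmeas (fun x => - f x).
Proof.
move=> [f1 f2]; split.
- by under eq_fun do rewrite cE; apply: measurable_funN.
- by under eq_fun do rewrite cE; apply: measurable_funN.
Qed.

Lemma cmeasB f g : cmeas f -> cmeas g -> cmeas (fun x => f x - g x).
Proof. by move=> mf mg; apply: cmeasD => //; exact: cmeasN. Qed.

Lemma cmeasM f g : cmeas f -> cmeas g -> cmeas (fun x => f x * g x).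
Proof.
move=> [f1 f2] [g1 g2]; split.
- under eq_fun do rewrite cE.
  by apply: measurable_funB; apply: measurable_funM.
- under eq_fun do rewrite cE.
  by apply: measurable_funD; apply: measurable_funM.
Qed.

Lemma cmeasJ f : cmeas f -> cmeas (fun x => conjc (f x)).
Proof.
move=> [f1 f2]; split; first by under eq_fun do rewrite cE.
by under eq_fun do rewrite cE; apply: measurable_funN.
Qed.

Lemma cmeas_cst (c : R[i]) : cmeas (fun=> c).
Proof. by split; exact: measurable_cst. Qed.

Lemma cmeasR (h : T -> R) : measurable_fun setT h -> cmeas (fun x => (h x)%:C).
Proof. by move=> mh; split => //=; exact: measurable_cst. Qed.

Lemma cmeas_cis (h : T -> R) : measurable_fun setT h ->
  cmeas (fun x => cis (h x)).
Proof.
move=> mh; split => /=; apply: measurableT_comp => //;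
  apply: continuous_measurable_fun; [exact: continuous_cos|exact: continuous_sin].
Qed.

Lemma measurable_csq f : cmeas f -> measurable_fun setT (fun x => csq (f x)).
Proof. by move=> [f1 f2]; apply: measurable_funD; apply: measurable_funX. Qed.

Lemma measurable_cnorm f : cmeas f ->
  measurable_fun setT (fun x => Normc.normc (f x)).
Proof.
move=> mf; under eq_fun do rewrite cnorm_csq.
apply: measurableT_comp; last exact: measurable_csq.
by apply: continuous_measurable_fun; exact: sqrt_continuous.
Qed.

End complex_measurable.

Section complex_integral.
Context d (T : measurableType d) (R : realType).
Variable m : {measure set T -> \bar R}.
Implicit Types f g : T -> R[i].

Definition cintegrable f := m.-integrable setT (fun x => (complex.Re (f x))%:E) /\
  m.-integrable setT (fun x => (complex.Im (f x))%:E).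

Lemma cintegrable_meas f : cintegrable f -> cmeas f.
Proof. by move=> [f1 f2]; split; apply/measurable_EFinP; exact: measurable_int f1 || exact: measurable_int f2. Qed.

Lemma le_cintegrable f (g : T -> R) : cmeas f -> m.-integrable setT (EFin \o g) ->
  (forall x, Normc.normc (f x) <= g x) -> cintegrable f.
Proof.
move=> [f1 f2] ig fg; split; apply: (le_integrable _ _ _ ig) => //.
- exact/measurable_EFinP.
- move=> x _ /=; rewrite lee_fin (le_trans (ler_cnormRe _))//.
  by rewrite (le_trans (fg x))// ler_norm.
- exact/measurable_EFinP.
- move=> x _ /=; rewrite lee_fin (le_trans (ler_cnormIm _))//.
  by rewrite (le_trans (fg x))// ler_norm.
Qed.

Lemma cintegrable_norm f : cintegrable f ->
  m.-integrable setT (fun x => (Normc.normc (f x))%:E).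
Proof.
move=> cf; have mf := cintegrable_meas cf; case: cf => f1 f2.
have := integrableD measurableT (integrable_abse f1) (integrable_abse f2).
apply: le_integrable => //; first exact/measurable_EFinP/measurable_cnorm.
move=> x _ /=; rewrite lee_fin ger0_norm ?cnorm_ge0//.
by rewrite (le_trans (cnorm_le _))// ler_norm.
Qed.

Lemma eq_cintegrable f g : f =1 g -> cintegrable f -> cintegrable g.
Proof. by move=> /funext ->. Qed.

Lemma cintegrableD f g : cintegrable f -> cintegrable g ->
  cintegrable (fun x => f x + g x).
Proof.
move=> [f1 f2] [g1 g2]; split.
- by under eq_fun do rewrite cE EFinD; apply: integrableD.
- by under eq_fun do rewrite cE EFinD; apply: integrableD.
Qed.

Lemma cintegrableZ (c : R[i]) f : cintegrable f -> cintegrable (fun x => c * f x).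
Proof.
move=> cf; have mf := cintegrable_meas cf.
have /(integrableZl measurableT (Normc.normc c)) := cintegrable_norm cf.
move=> /le_cintegrable; apply => //.
  by apply: cmeasM => //; exact: cmeas_cst.
by move=> x /=; rewrite cnormM.
Qed.

Lemma cintegrableN f : cintegrable f -> cintegrable (fun x => - f x).
Proof.
move=> /(cintegrableZ (-1)); apply: eq_cintegrable => x; exact: mulN1r.
Qed.

Lemma cintegrableJ f : cintegrable f -> cintegrable (fun x => conjc (f x)).
Proof.
move=> cf; have mf := cintegrable_meas cf.
have /le_cintegrable := cintegrable_norm cf; apply.
  exact: cmeasJ.
by move=> x; rewrite cnormJ.
Qed.

Lemma cintegrable_unimodular (u : T -> R[i]) f : cmeas u ->
  (forall x, Normc.normc (u x) = 1) -> cintegrable f ->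
  cintegrable (fun x => u x * f x).
Proof.
move=> mu u1 cf; have mf := cintegrable_meas cf.
have /le_cintegrable := cintegrable_norm cf; apply; first exact: cmeasM.
by move=> x; rewrite cnormM u1 mul1r.
Qed.

Lemma cintD f g : cintegrable f -> cintegrable g ->
  cint m setT (fun x => f x + g x) = cint m setT f + cint m setT g.
Proof.
move=> [f1 f2] [g1 g2]; apply: c_ext; rewrite cE/=.
- by under eq_Rintegral do rewrite cE; rewrite RintegralD.
- by under eq_Rintegral do rewrite cE; rewrite RintegralD.
Qed.

Lemma integrableZl_EFin (c : R) (h : T -> R) : m.-integrable setT (fun x => (h x)%:E) ->
  m.-integrable setT (fun x => (c * h x)%:E).
Proof. by move=> /(integrableZl measurableT c). Qed.

Lemma integrableD_EFin (h k : T -> R) : m.-integrable setT (fun x => (h x)%:E) ->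
  m.-integrable setT (fun x => (k x)%:E) -> m.-integrable setT (fun x => (h x + k x)%:E).
Proof. by move=> ih ik; exact: (integrableD measurableT ih ik). Qed.

Lemma integrableB_EFin (h k : T -> R) : m.-integrable setT (fun x => (h x)%:E) ->
  m.-integrable setT (fun x => (k x)%:E) -> m.-integrable setT (fun x => (h x - k x)%:E).
Proof. by move=> ih ik; exact: (integrableB measurableT ih ik). Qed.

Lemma cintZ (c : R[i]) f : cintegrable f ->
  cint m setT (fun x => c * f x) = c * cint m setT f.
Proof.
move=> [f1 f2]; apply: c_ext; rewrite cE/=.
- under eq_Rintegral do rewrite cE.
  rewrite RintegralB//; try exact: integrableZl_EFin.
  by rewrite !RintegralZl.
- under eq_Rintegral do rewrite cE.
  rewrite RintegralD//; try exact: integrableZl_EFin.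
  by rewrite !RintegralZl.
Qed.

Lemma cintN f : cintegrable f -> cint m setT (fun x => - f x) = - cint m setT f.
Proof.
move=> cf; rewrite -mulN1r -cintZ//; congr cint; apply/funext => x.
by rewrite mulN1r.
Qed.

Lemma cintB f g : cintegrable f -> cintegrable g ->
  cint m setT (fun x => f x - g x) = cint m setT f - cint m setT g.
Proof. by move=> cf cg; rewrite cintD ?cintN//; exact: cintegrableN. Qed.

Lemma cintJ f : cintegrable f ->
  cint m setT (fun x => conjc (f x)) = conjc (cint m setT f).
Proof.
move=> [f1 f2]; apply: c_ext; rewrite cE/=.
- by under eq_Rintegral do rewrite cE.
- under eq_Rintegral do rewrite cE -mulN1r.
  by rewrite RintegralZl// mulN1r.
Qed.

Lemma ae_eq_cint f g : cmeas f -> cmeas g -> {ae m, forall x, f x = g x} ->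
  cint m setT f = cint m setT g.
Proof.
move=> [f1 f2] [g1 g2] fg; apply: c_ext => /=; congr fine.
- apply: ae_eq_integral => //; try exact/measurable_EFinP.
  by apply: filterS fg => x -> .
- apply: ae_eq_integral => //; try exact/measurable_EFinP.
  by apply: filterS fg => x -> .
Qed.

Lemma cint_mkcond D f : cint m D f = cint m setT (fun x => (\1_D x)%:C * f x).
Proof.
by apply: c_ext; rewrite /= Rintegral_mkcond; apply: eq_Rintegral => x _;
  rewrite cE/= mul0r ?subr0 ?addr0 /patch indicE; case: (x \in D); rewrite ?mul1r ?mul0r.
Qed.

(** The factor 2 comes from estimating the real and imaginary parts separately; only the order of
    magnitude matters where this bound is used. *)
Lemma cnorm_cint_le f : cintegrable f ->
  Normc.normc (cint m setT f) <= 2 * \int[m]_x Normc.normc (f x).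
Proof.
move=> cf; have cn := cintegrable_norm cf; case: cf => f1 f2.
rewrite (le_trans (cnorm_le _))//= mulr_natl mulr2n lerD//.
- rewrite (le_trans (le_normr_Rintegral _ _))// le_Rintegral//.
    by have := integrable_norm f1.
  by move=> x _; exact: ler_cnormRe.
- rewrite (le_trans (le_normr_Rintegral _ _))// le_Rintegral//.
    by have := integrable_norm f2.
  by move=> x _; exact: ler_cnormIm.
Qed.

End complex_integral.

(** * Fubini for real and complex integrands *)

Section fubini.
Context d1 d2 (T1 : measurableType d1) (T2 : measurableType d2) (R : realType).
Variable m1 : {sigma_finite_measure set T1 -> \bar R}.
Variable m2 : {sigma_finite_measure set T2 -> \bar R}.

Lemma integrable_prodM (f : T1 -> R) (g : T2 -> R) :
  m1.-integrable setT (fun x => (f x)%:E) -> m2.-integrable setT (fun y => (g y)%:E) ->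
  (m1 \x m2)%E.-integrable setT (fun z => (f z.1 * g z.2)%:E).
Proof.
move=> fi gi.
have mf : measurable_fun setT f by apply/measurable_EFinP; exact: measurable_int fi.
have mg : measurable_fun setT g by apply/measurable_EFinP; exact: measurable_int gi.
apply/integrable12ltyP.
  by apply/measurable_EFinP/measurable_funM; apply: measurableT_comp.
have gfin : (\int[m2]_y `|(g y)%:E| \is a fin_num)%E.
  by rewrite ge0_fin_numE ?integral_ge0//; case/integrableP : gi.
rewrite [ltLHS](_ : _ = \int[m1]_x (`|(f x)%:E| * \int[m2]_y `|(g y)%:E|))%E; last first.
  apply: eq_integral => x _ /=.
  under eq_integral do rewrite normrM EFinM.
  by rewrite ge0_integralZl//; apply/measurable_EFinP/measurableT_comp.
have mabs : measurable_fun setT (fun x => `|(f x)%:E|)%E.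
  by apply/measurable_EFinP; exact: measurableT_comp.
rewrite ge0_integralZr//; last exact: integral_ge0.
apply: lte_mul_pinfty; [exact: integral_ge0| |by rewrite -ge0_fin_numE ?integral_ge0].
by rewrite ge0_fin_numE ?integral_ge0//; case/integrableP : fi.
Qed.

Variable f : T1 * T2 -> R.
Hypothesis fi : (m1 \x m2)%E.-integrable setT (fun z => (f z)%:E).

Lemma Rintegral_fubini1 :
  m1.-integrable setT (fun x => (\int[m2]_y f (x, y))%:E) /\
  \int[m1]_x (\int[m2]_y f (x, y)) = \int[(m1 \x m2)%E]_z f z.
Proof.
have iF := integrable_fubini_F fi.
(* The real integral is [fine] of the extended one and defaults to 0 where that is infinite. The two
   agree wherever the inner integral is finite, hence almost everywhere. *)
have aeF : {ae m1, forall x, setT x ->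
    (\int[m2]_y f (x, y))%:E = fubini_F m2 (fun z => (f z)%:E) x}.
  apply: filterS (integrable_ae measurableT iF) => x /= + _; move=> /(_ Logic.I) h.
  by rewrite /Rintegral fineK.
have mF : measurable_fun setT (fun x => (\int[m2]_y f (x, y))%:E).
  by apply/measurable_EFinP/measurableT_comp => //; exact: measurable_int iF.
split.
  apply: (le_integrable _ _ _ iF) => // x _ /=.
  rewrite /Rintegral /fubini_F/=; set a := integral _ _ _.
  by case: a => [r| |] //=; rewrite ?normr0 ?leey.
rewrite {1}/Rintegral (ae_eq_integral _ _ _ _ _ aeF)//.
  by rewrite (integral12_prod_meas1 fi).
exact: measurable_int iF.
Qed.

Lemma Rintegral_fubini2 :
  m2.-integrable setT (fun y => (\int[m1]_x f (x, y))%:E) /\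
  \int[m2]_y (\int[m1]_x f (x, y)) = \int[(m1 \x m2)%E]_z f z.
Proof.
have iF : m2.-integrable setT (fubini_G m1 (fun z => (f z)%:E)).
  apply/integrableP; split; first exact: measurable_fubini_G fi.
  have mf : measurable_fun setT (fun z => (f z)%:E) by exact: measurable_int fi.
  apply: le_lt_trans ((integrable21ltyP m1 m2 mf).1 fi).
  apply: ge0_le_integral => //.
  - by apply: measurableT_comp => //; exact: (measurable_fubini_G fi).
  - by apply: (measurable_fun_fubini_tonelli_G (abse \o (fun z => (f z)%:E))) => //=; exact: measurableT_comp.
  - by move=> y _; apply: le_abse_integral => //; exact: (measurableT_comp mf (pair2_measurable y)).
have aeF : {ae m2, forall x, setT x ->
    (\int[m1]_y f (y, x))%:E = fubini_G m1 (fun z => (f z)%:E) x}.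
  apply: filterS (integrable_ae measurableT iF) => x /= + _; move=> /(_ Logic.I) h.
  by rewrite /Rintegral fineK.
have mF : measurable_fun setT (fun x => (\int[m1]_y f (y, x))%:E).
  by apply/measurable_EFinP/measurableT_comp => //; exact: measurable_int iF.
split.
  apply: (le_integrable _ _ _ iF) => // x _ /=.
  rewrite /Rintegral /fubini_G/=; set a := integral _ _ _.
  by case: a => [r| |] //=; rewrite ?normr0 ?leey.
rewrite {1}/Rintegral (ae_eq_integral _ _ _ _ _ aeF)//.
  by rewrite (integral21_prod_meas1 fi).
exact: measurable_int iF.
Qed.

End fubini.

Section complex_fubini.
Context d1 d2 (T1 : measurableType d1) (T2 : measurableType d2) (R : realType).
Variable m1 : {sigma_finite_measure set T1 -> \bar R}.
Variable m2 : {sigma_finite_measure set T2 -> \bar R}.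

Lemma cintegrable_prodM (f : T1 -> R[i]) (g : T2 -> R[i]) :
  cintegrable m1 f -> cintegrable m2 g ->
  cintegrable (m1 \x m2)%E (fun z => f z.1 * g z.2).
Proof.
move=> fi gi.
have := integrable_prodM (cintegrable_norm fi) (cintegrable_norm gi).
move=> /le_cintegrable; apply; last by move=> z; rewrite cnormM.
have [f1 f2] := cintegrable_meas fi; have [g1 g2] := cintegrable_meas gi.
apply: cmeasM; split.
- exact: (measurableT_comp f1 measurable_fst).
- exact: (measurableT_comp f2 measurable_fst).
- exact: (measurableT_comp g1 measurable_snd).
- exact: (measurableT_comp g2 measurable_snd).
Qed.

Lemma cint_fubini1 (f : T1 * T2 -> R[i]) : cintegrable (m1 \x m2)%E f ->
  cintegrable m1 (fun x => cint m2 setT (fun y => f (x, y))) /\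
  cint m1 setT (fun x => cint m2 setT (fun y => f (x, y))) =
  cint (m1 \x m2)%E setT f.
Proof.
move=> [f1 f2].
have [i1 e1] := Rintegral_fubini1 f1; have [i2 e2] := Rintegral_fubini1 f2.
by split; [split|apply: c_ext].
Qed.

Lemma cint_fubini2 (f : T1 * T2 -> R[i]) : cintegrable (m1 \x m2)%E f ->
  cintegrable m2 (fun y => cint m1 setT (fun x => f (x, y))) /\
  cint m2 setT (fun y => cint m1 setT (fun x => f (x, y))) =
  cint (m1 \x m2)%E setT f.
Proof.
move=> [f1 f2].
have [i1 e1] := Rintegral_fubini2 f1; have [i2 e2] := Rintegral_fubini2 f2.
by split; [split|apply: c_ext].
Qed.

Lemma cint_prodM (f : T1 -> R[i]) (g : T2 -> R[i]) :
  cintegrable m1 f -> cintegrable m2 g ->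
  cint (m1 \x m2)%E setT (fun z => f z.1 * g z.2) =
  cint m1 setT f * cint m2 setT g.
Proof.
move=> fi gi; rewrite -(cint_fubini1 (cintegrable_prodM fi gi)).2/=.
rewrite mulrC -cintZ//; congr cint; apply/funext => x.
by rewrite cintZ// mulrC.
Qed.

End complex_fubini.

Section parametric_measurability.
Context d1 d2 (T1 : measurableType d1) (T2 : measurableType d2) (R : realType).
Variable m1 : {sigma_finite_measure set T1 -> \bar R}.
Variable m2 : {sigma_finite_measure set T2 -> \bar R}.

(** Integrability is not assumed: the extended integral is a difference of the integrals of the
    positive and negative parts, each measurable by Tonelli, and [fine] is measurable whatever
    default it returns. *)
Lemma measurable_Rintegral_param (f : T1 * T2 -> R) : measurable_fun setT f ->
  measurable_fun setT (fun x => \int[m2]_y f (x, y)).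
Proof.
move=> mf; have mfE : measurable_fun setT (EFin \o f) by exact/measurable_EFinP.
apply: measurableT_comp; first exact: fine_measurable.
rewrite (_ : (fun x => _) = fun x => (\int[m2]_y ((EFin \o f)^\+ (x, y)) -
    \int[m2]_y ((EFin \o f)^\- (x, y)))%E); last first.
  apply/funext => x; rewrite integralE.
  by congr (_ - _)%E; apply: eq_integral => y _; rewrite ?funeposE ?funenegE.
apply: emeasurable_funB.
- apply: (@measurable_fun_fubini_tonelli_F _ _ _ _ _ m2 ((EFin \o f)^\+)%E).
    exact: measurable_funepos.
  by move=> z; exact: funepos_ge0.
- apply: (@measurable_fun_fubini_tonelli_F _ _ _ _ _ m2 ((EFin \o f)^\-)%E).
    exact: measurable_funeneg.
  by move=> z; exact: funeneg_ge0.
Qed.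

Lemma cmeas_cint_param (f : T1 * T2 -> R[i]) : cmeas f ->
  cmeas (fun x => cint m2 setT (fun y => f (x, y))).
Proof. by move=> [f1 f2]; split; [exact: (measurable_Rintegral_param f1)|exact: (measurable_Rintegral_param f2)]. Qed.

End parametric_measurability.

Section ae_domination.
Context d (T : measurableType d) (R : realType) (m : {measure set T -> \bar R}).

Lemma ae_le_integrable (f g : T -> R) : measurable_fun setT f ->
  m.-integrable setT (fun x => (g x)%:E) -> {ae m, forall x, `|f x| <= g x} ->
  m.-integrable setT (fun x => (f x)%:E).
Proof.
move=> mf /integrableP[mg ig] fg; apply/integrableP; split.
  exact/measurable_EFinP.
apply: le_lt_trans ig; apply: ae_ge0_le_integral => //.
- by apply: measurableT_comp => //; exact/measurable_EFinP.
- exact: measurableT_comp.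
- by apply: filterS fg => x h _ /=; rewrite lee_fin (le_trans h)// ler_norm.
Qed.

Lemma ae_eq_Rintegral (f g : T -> R) : measurable_fun setT f ->
  measurable_fun setT g -> {ae m, forall x, f x = g x} ->
  \int[m]_x f x = \int[m]_x g x.
Proof.
move=> mf mg fg; congr fine; apply: ae_eq_integral => //.
- exact/measurable_EFinP.
- exact/measurable_EFinP.
- by apply: filterS fg => x ->.
Qed.

End ae_domination.

(** * Parseval's identity for step functions *)

Section improper_integrals.
Variable R : realType.
Implicit Types (x t u : R).

(** Used to get continuity of explicit functions: a derivative found by [is_derive_eq] replaces a
    term-by-term continuity proof. *)
Lemma is_derive_continuous (f df : R -> R) :
  (forall x, is_derive x 1 f (df x)) -> continuous f.
Proof.
move=> fd x; apply/differentiable_continuous/derivable1_diffP.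
by have [] := fd x.
Qed.

Lemma ge0_FTC0y (f F : R -> R) (l : R) :
  (forall x, 0 <= x -> 0 <= f x) -> continuous f ->
  F x @[x --> +oo] --> l -> (forall x, is_derive x 1 F (f x)) ->
  (\int[leb R]_(x in `[0%R, +oo[) (f x)%:E)%E = (l - F 0)%:E.
Proof.
move=> f0 cf Fl dF; rewrite (@ge0_continuous_FTC2y R f F 0 l)//.
- exact: continuous_subspaceT.
- by apply: cvg_at_right_filter; exact: (is_derive_continuous dF).
- by move=> x _; rewrite derive1E; exact: derive_val.
Qed.

Lemma cvg_expRN0 t : 0 < t -> expR (- (t * x)) @[x --> +oo] --> (0 : R).
Proof.
move=> t0; apply: (cvg_comp (fun x => t * x) (fun y => expR (- y))); last exact: cvgr_expR.
exact: gt0_cvgMry.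
Qed.

(** Squaring $tx/2 \le e^{tx/2}$, which comes from $1+y\le e^y$, gives quadratic growth of
    $e^{tx}$. *)
Lemma expRN_le t x : 0 < t -> 0 <= x -> x * expR (- (t * x)) <= 4 / t ^+ 2 / x.
Proof.
move=> t0; rewrite le_eqVlt => /orP[/eqP <-|x0]; first by rewrite mul0r invr0 mulr0.
rewrite ler_pdivlMr// expRN mulrAC ler_pdivrMr ?expR_gt0//.
rewrite mulrAC ler_pdivlMr ?exprn_gt0//.
have h : t * x / 2 <= expR (t * x / 2).
  by rewrite (le_trans _ (expR_ge1Dx _))// lerDr.
have h2 : (t * x / 2) ^+ 2 <= expR (t * x).
  rewrite [X in expR X]splitr expRD -expr2 lerXn2r ?nnegrE ?expR_ge0//.
  by rewrite divr_ge0// mulr_ge0// ltW.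
rewrite (_ : x * x * t ^+ 2 = 4 * (t * x / 2) ^+ 2); last by field.
by rewrite ler_wpM2l.
Qed.

Lemma cvg_xexpRN0 t : 0 < t -> x * expR (- (t * x)) @[x --> +oo] --> (0 : R).
Proof.
move=> t0.
have h : (4 / t ^+ 2) * x^-1 @[x --> +oo] --> (0 : R).
  rewrite -[X in _ --> X](mulr0 (4 / t ^+ 2)); apply: cvgMl_tmp.
  by apply/(@gtr0_cvgV0 _ _ _ _ id) => //; exists 0; split.
apply: (squeeze_cvgr _ (cvg_cst 0) h).
near=> x; rewrite expRN_le ?mulr_ge0 ?expR_ge0//; near: x;
  exists 0; split => // x; exact: ltW.
Unshelve. all: by end_near. Qed.

Lemma integral_xexpRN x : 0 < x ->
  (\int[leb R]_(t in `[0%R, +oo[) (t * expR (- (x * t)))%:E)%E = (x ^- 2)%:E.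
Proof.
move=> x0; have xn0 := lt0r_neq0 x0.
pose F t := - (x^-1 * (t * expR (- (x * t))) + x ^- 2 * expR (- (x * t))).
have dF t : is_derive t 1 F (t * expR (- (x * t))).
  by apply: is_derive_eq; rewrite /GRing.scale/=; field.
rewrite (@ge0_FTC0y _ F 0 _ _ _ dF).
- by rewrite /F !(mul0r, mulr0, oppr0, expR0, add0r, mulr1, opprK).
- by move=> t t0; rewrite mulr_ge0 ?expR_ge0.
- apply: (@is_derive_continuous _ (fun t => expR (- (x * t)) - x * (t * expR (- (x * t))))) => t.
  by apply: is_derive_eq; rewrite /GRing.scale/=; ring.
- rewrite /F -oppr0; apply: cvgN; rewrite -[X in _ --> X]addr0.
  apply: cvgD.
    by rewrite -[X in _ --> X](mulr0 x^-1); apply: cvgMl_tmp; exact: cvg_xexpRN0.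
  by rewrite -[X in _ --> X](mulr0 (x ^- 2)); apply: cvgMl_tmp; exact: cvg_expRN0.
Qed.

Lemma integral_expRN_1Bcos t u : 0 < t ->
  (\int[leb R]_(x in `[0%R, +oo[) (expR (- (t * x)) * (1 - cos (u * x)))%:E)%E =
  (u ^+ 2 / (t * (t ^+ 2 + u ^+ 2)))%:E.
Proof.
move=> t0; have tn0 := lt0r_neq0 t0.
have tu0 : t ^+ 2 + u ^+ 2 != 0.
  by rewrite lt0r_neq0// ltr_wpDr ?sqr_ge0// exprn_gt0.
(* The primitive of $e^{-tx}$ minus the real part of the primitive of $e^{(-t+iu)x}$. It tends to 0
   at infinity, so the integral is $-F(0)$. *)
pose F x := expR (- (t * x)) *
  ((t * cos (u * x) - u * sin (u * x)) / (t ^+ 2 + u ^+ 2) - t^-1).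
have dF x : is_derive x 1 F (expR (- (t * x)) * (1 - cos (u * x))).
  by apply: is_derive_eq; rewrite /GRing.scale/=; field; exact/andP.
rewrite (@ge0_FTC0y _ F 0 _ _ _ dF).
- rewrite /F !(mulr0, oppr0, expR0, cos0, sin0, subr0, mulr1, mul1r, sub0r).
  by congr EFin; field; apply/andP.
- by move=> x x0; rewrite mulr_ge0 ?expR_ge0// subr_ge0 cos_le1.
- apply: (@is_derive_continuous _ (fun x => - t * expR (- (t * x)) * (1 - cos (u * x)) + expR (- (t * x)) * (u * sin (u * x)))) => x.
  by apply: is_derive_eq; rewrite /GRing.scale/=; ring.
- pose C := (`|t| + `|u|) / (t ^+ 2 + u ^+ 2) + t^-1.
  have M (x : R) : `|(t * cos (u * x) - u * sin (u * x)) / (t ^+ 2 + u ^+ 2) - t^-1| <= C.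
    rewrite (le_trans (ler_normB _ _))// [X in _ + X <= _]gtr0_norm ?invr_gt0// lerD2r.
    rewrite normrM normfV [X in _ / X]ger0_norm ?addr_ge0 ?sqr_ge0//.
    rewrite ler_wpM2r ?invr_ge0 ?addr_ge0 ?sqr_ge0// (le_trans (ler_normB _ _))//.
    by rewrite !normrM lerD// ler_piMr// ler_norml ?cos_geN1 ?cos_le1 ?sin_geN1 ?sin_le1.
  apply/cvgr0Pnorm_lt => e e0.
  have : C * expR (- (t * x)) @[x --> +oo] --> (0 : R).
    by rewrite -[X in _ --> X](mulr0 C); apply: cvgMl_tmp; exact: cvg_expRN0.
  move=> /cvgr0Pnorm_lt/(_ _ e0); apply: filterS => x; apply: le_lt_trans.
  rewrite /F !normrM mulrC ler_wpM2r// (le_trans (M x))// ler_norm//.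
Qed.

Lemma integral_cauchy_kernel u : 0 < u ->
  (\int[leb R]_(t in `[0%R, +oo[) (u ^+ 2 / (t ^+ 2 + u ^+ 2))%:E)%E = (u * (pi / 2))%:E.
Proof.
move=> u0; have un0 := lt0r_neq0 u0.
have tu0 t : t ^+ 2 + u ^+ 2 != 0.
  by rewrite lt0r_neq0// ltr_wpDl ?sqr_ge0// exprn_gt0.
pose F t := u * atan (u^-1 * t).
have dF t : is_derive t 1 F (u ^+ 2 / (t ^+ 2 + u ^+ 2)).
  apply: is_derive_eq; rewrite /GRing.scale/=; field.
  by rewrite tu0 un0.
rewrite (@ge0_FTC0y _ F (u * (pi / 2)) _ _ _ dF).
- by rewrite /F mulr0 atan0 mulr0 subr0.
- by move=> t t0; rewrite divr_ge0 ?addr_ge0 ?sqr_ge0.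
- move=> t; apply: cvgMl_tmp; apply: cvgV; first exact: tu0.
  by apply: cvgD; [apply: exprn_continuous|exact: cvg_cst].
- rewrite /F; apply: cvgMl_tmp.
  apply: (cvg_comp (fun t => u^-1 * t) (@atan R)); last exact: cvgy_atan.
  by apply: gt0_cvgMry; [rewrite invr_gt0|exact: cvg_id].
Qed.

End improper_integrals.

Section tonelli_domains.
Context d1 d2 (T1 : measurableType d1) (T2 : measurableType d2) (R : realType).
Variable m1 : {sigma_finite_measure set T1 -> \bar R}.
Variable m2 : {sigma_finite_measure set T2 -> \bar R}.

Lemma tonelli_dom (D1 : set T1) (D2 : set T2) (f : T1 * T2 -> \bar R) :
  measurable D1 -> measurable D2 -> measurable_fun setT f ->
  (forall z, 0 <= f z)%E ->
  (\int[m1]_(x in D1) \int[m2]_(y in D2) f (x, y) =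
   \int[m2]_(y in D2) \int[m1]_(x in D1) f (x, y))%E.
Proof.
move=> mD1 mD2 mf f0.
pose g z := (f z * (\1_D1 z.1)%:E * (\1_D2 z.2)%:E)%E.
have mg : measurable_fun setT g.
  apply: emeasurable_funM; first apply: emeasurable_funM => //.
  - apply/measurable_EFinP.
    by apply: (measurableT_comp _ measurable_fst); exact: measurable_indic.
  - apply/measurable_EFinP.
    by apply: (measurableT_comp _ measurable_snd); exact: measurable_indic.
have g0 z : (0 <= g z)%E by rewrite !mule_ge0// lee_fin indicE ler0n.
transitivity (\int[m1]_x \int[m2]_y g (x, y))%E.
  rewrite integral_mkcond; apply: eq_integral => x _.
  rewrite /patch; case: ifPn => xD.
    rewrite integral_mkcond; apply: eq_integral => y _.
    by rewrite /patch /g/= !indicE xD; case: ifPn => _; rewrite ?mule1 ?mule0.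
  rewrite integral0_eq// => y _.
  by rewrite /g/= !indicE (negbTE xD) mule0 mul0e.
rewrite (fubini_tonelli g mg g0).
rewrite [RHS]integral_mkcond; apply: eq_integral => y _.
rewrite /patch; case: ifPn => yD.
  rewrite [RHS]integral_mkcond; apply: eq_integral => x _.
  by rewrite /patch /g/= !indicE yD; case: ifPn => _; rewrite ?mule1 ?mule0 ?mul0e.
rewrite integral0_eq// => x _.
by rewrite /g/= !indicE (negbTE yD) mule0.
Qed.

End tonelli_domains.

(** * The integral of (1 - cos (u x)) / x^2 *)

Section one_minus_cos.
Variable R : realType.
Implicit Types (x t u : R).

(* Tonelli's theorem with [1 / x ^ 2] written as the integral of [t e^(- t x)]. *)
Lemma integral0y_1Bcos u : 0 < u ->
  (\int[leb R]_(x in `]0%R, +oo[) ((1 - cos (u * x)) / x ^+ 2)%:E)%E =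
  (pi / 2 * u)%:E.
Proof.
move=> u0; set D := `]0%R, +oo[%classic.
have mD : measurable D by exact: measurable_itv.
pose f (z : R * R) := (z.2 * expR (- (z.1 * z.2)) * (1 - cos (u * z.1)))%:E.
(* On [D] the absolute value changes nothing; off [D] it makes the integrand nonnegative, as
   [tonelli_dom] requires positivity everywhere. *)
transitivity (\int[leb R]_(x in D) \int[leb R]_(t in D) f (x, `|t|%R))%E.
  apply: eq_integral => x; rewrite inE /D/= in_itv/= andbT => x0.
  have := integral_xexpRN x0; rewrite -integral_itv_obnd_cbnd; last first.
    by mmeas.
  move=> e; rewrite mulrC EFinM -e -ge0_integralZr//.
  - apply: eq_integral => t; rewrite inE /D/= in_itv/= andbT => t0.
    by rewrite /f/= gtr0_norm.
  - by mmeas.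
  - move=> t; rewrite /D/= in_itv/= andbT => t0.
    by rewrite lee_fin mulr_ge0 ?expR_ge0// ltW.
rewrite (@tonelli_dom _ _ _ _ _ (leb R) (leb R) D D (fun z => f (z.1, `|z.2|)))//; last 2 first.
- by rewrite /f/=; mmeas.
- by move=> z; rewrite /f/= lee_fin !mulr_ge0 ?expR_ge0 ?subr_ge0 ?cos_le1.
rewrite mulrC -integral_cauchy_kernel// -[RHS]integral_itv_obnd_cbnd; last first.
  by mmeas.
apply: eq_integral => t; rewrite inE /D/= in_itv/= andbT => t0.
have := integral_expRN_1Bcos u t0; rewrite -integral_itv_obnd_cbnd; last first.
  by mmeas.
move=> e.
transitivity (t%:E * (u ^+ 2 / (t * (t ^+ 2 + u ^+ 2)))%:E)%E; last first.
  rewrite -EFinM; congr EFin; field.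
  by rewrite !lt0r_neq0// ltr_wpDr ?sqr_ge0// exprn_gt0.
rewrite -e -ge0_integralZl//.
- by apply: eq_integral => x _; rewrite /f/= gtr0_norm// -EFinM mulrA [x * t]mulrC.
- by mmeas.
- by rewrite lee_fin ltW.
Qed.

Lemma measurable_1Bcos u : measurable_fun setT (fun x => (1 - cos (u * x)) / x ^+ 2).
Proof. by mmeas. Qed.

(** The integrand is even in [u] and in [x]: the sign of [u] is removed first, then the negative
    half-line contributes as much as the positive one. *)
Lemma integral_1Bcos u :
  (\int[leb R]_x ((1 - cos (u * x)) / x ^+ 2)%:E)%E = (pi * `|u|)%:E.
Proof.
wlog u0 : u / 0 < u.
  move=> h; have [u0|u0|->] := ltgtP u 0; last 2 first.
  - exact: h.
  - rewrite normr0 mulr0 integral0_eq// => x _.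
    by rewrite mul0r cos0 subrr mul0r.
  - rewrite -normrN -h ?oppr_gt0//; apply: eq_integral => x _.
    by rewrite mulNr cosN.
have mf := measurable_1Bcos u; set f := (X in measurable_fun _ X) in mf.
have f0 x : (0 <= (f x)%:E)%E.
  by rewrite lee_fin divr_ge0 ?sqr_ge0// subr_ge0 cos_le1.
have mfE : measurable_fun setT (fun x => (f x)%:E) by exact/measurable_EFinP.
have e := integral0y_1Bcos u0; rewrite -/f in e.
rewrite gtr0_norm// (_ : pi * u = pi / 2 * u + pi / 2 * u); last by field.
have e2 : (\int[leb R]_(x in `]-oo, 0%R]) (f x)%:E)%E = (pi / 2 * u)%:E.
  rewrite -e integral_itv_obnd_cbnd; last exact: measurable_funTS.
  rewrite ge0_integration_by_substitution0//; apply: eq_integral => x _.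
  by rewrite /f mulrN cosN sqrrN.
rewrite (_ : setT = `]0%R, +oo[ `|` `]-oo, 0%R]); last first.
  apply/seteqP; split=> x _ //=; rewrite !in_itv/= andbT.
  by case: (ltP 0 x) => ?; [left|right].
rewrite ge0_integral_setU ?EFinD ?e ?e2//.
- exact: measurable_funTS.
- by move=> x _; exact: f0.
- apply/disj_setPS => x [/=]; rewrite !in_itv/= andbT => x0 /(lt_le_trans x0).
  by rewrite ltxx.
Qed.

End one_minus_cos.

Section reflection.
Variable R : realType.

Lemma integrableN_comp (h : R -> R) : (leb R).-integrable setT (EFin \o h) ->
  (leb R).-integrable setT (fun x => (h (- x))%:E) /\
  \int[leb R]_x h (- x) = \int[leb R]_x h x.
Proof.
move=> ih; have mh : measurable_fun setT h by apply/measurable_EFinP; exact: measurable_int ih.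
have mN : measurable_fun [set: TR R] (-%R : TR R -> TR R).
  exact: (@mf_opp _ (TR R) R setT id).
have muE (f : R -> \bar R) : (\int[pushforward (leb R) (-%R : TR R -> TR R)]_x f x = \int[leb R]_x f x)%E.
  by apply: eq_measure_integral => A mA _; exact: lebesgue_measureN.
have ihN : (leb R).-integrable setT (fun x => (h (- x))%:E).
  apply/integrableP; split.
    apply/measurable_EFinP; exact: (measurableT_comp mh).
  rewrite -[ltLHS](@ge0_integral_pushforward _ _ _ _ _ _ mN (leb R) setT (fun x => `|(h x)%:E|)%E)//.
    by rewrite muE; case/integrableP : ih.
  by apply/measurable_EFinP; exact: mf_norm.
split=> //; congr fine.
rewrite -[RHS]muE integral_pushforward//.
  by apply/measurable_EFinP.
Qed.

Lemma Rintegral_odd (h : R -> R) : (leb R).-integrable setT (EFin \o h) ->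
  (forall x, h (- x) = - h x) -> \int[leb R]_x h x = 0.
Proof.
move=> ih hN; have [_] := integrableN_comp ih.
under eq_Rintegral do rewrite hN -mulN1r.
rewrite RintegralZl// mulN1r => /eqP.
by rewrite eq_sym -addr_eq0 -mulr2n mulrn_eq0/= => /eqP.
Qed.

End reflection.

(** * Parseval's identity for two intervals *)

Section interval_transform.
Variable R : realType.
Implicit Types (a b c : R) (x xi : TR R).

Definition ind a b x : R[i] := (\1_(`]a, b]%classic) x)%:C.

Definition fourier1 (f : TR R -> R[i]) xi : R[i] :=
  cint (leb R) setT (fun x => cis (- (x * xi)) * f x).

Lemma integrable_ind a b : (leb R).-integrable setT (fun x => (\1_(`]a, b]%classic) x)%:E).
Proof. exact: integrable_indic_itv. Qed.

Lemma cintegrable_ind a b : cintegrable (leb R) (ind a b).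
Proof.
split => /=; [exact: integrable_ind|exact: integrable0].
Qed.

Lemma Rintegral_mul_indic (h : R -> R) (A : set R) :
  \int[leb R]_x (h x * \1_A x) = \int[leb R]_(x in A) h x.
Proof.
rewrite [RHS]Rintegral_mkcond; apply: eq_Rintegral => x _.
by rewrite /patch indicE; case: (x \in A); rewrite ?mulr1 ?mulr0.
Qed.

Lemma Rintegral_FTC (f F : R -> R) a b : a <= b -> continuous f ->
  (forall x, is_derive x 1 F (f x)) -> \int[leb R]_(x in `]a, b]) f x = F b - F a.
Proof.
rewrite le_eqVlt => /orP[/eqP <-|ab] cf dF.
  by rewrite set_itvoc0 Rintegral_set0 subrr.
rewrite /Rintegral integral_itv_obnd_cbnd; last first.
  by apply/measurable_EFinP/measurable_funTS; exact: continuous_measurable_fun.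
rewrite (@continuous_FTC2 _ f F)//.
- exact: continuous_subspaceT.
- split.
  + by move=> x _.
  + by apply: cvg_at_right_filter; exact: (is_derive_continuous dF).
  + by apply: cvg_at_left_filter; exact: (is_derive_continuous dF).
- by move=> x _; rewrite derive1E; exact: derive_val.
Qed.

Lemma fourier1_ind a b xi : a <= b -> xi != 0 ->
  fourier1 (ind a b) xi =
  ((sin (b * xi) - sin (a * xi)) / xi) +i* ((cos (b * xi) - cos (a * xi)) / xi).
Proof.
move=> ab xi0.
have cc : continuous (fun x => cos (x * xi)).
  apply: (@is_derive_continuous _ _ (fun x => - xi * sin (x * xi))) => x.
  by apply: is_derive_eq; rewrite /GRing.scale/=; ring.
have cs : continuous (fun x => - sin (x * xi)).
  apply: (@is_derive_continuous _ _ (fun x => - xi * cos (x * xi))) => x.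
  by apply: is_derive_eq; rewrite /GRing.scale/=; ring.
have ds x : is_derive x 1 (fun x => sin (x * xi) / xi) (cos (x * xi)).
  by apply: is_derive_eq; rewrite /GRing.scale/=; field.
have dc x : is_derive x 1 (fun x => cos (x * xi) / xi) (- sin (x * xi)).
  by apply: is_derive_eq; rewrite /GRing.scale/=; field.
apply: c_ext => /=.
- rewrite mulrBl -(Rintegral_FTC ab cc ds) -Rintegral_mul_indic.
  by apply: eq_Rintegral => x _; rewrite mulr0 subr0 cosN.
- rewrite mulrBl -(Rintegral_FTC ab cs dc) -Rintegral_mul_indic.
  by apply: eq_Rintegral => x _; rewrite mulr0 add0r sinN.
Qed.

Lemma cmeas_fourier1 (f : TR R -> R[i]) : cmeas f -> cmeas (fourier1 f).
Proof.
move=> mf.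
apply: (@cmeas_cint_param _ _ _ _ _ (leb R) (fun z : TR R * TR R => cis (- (z.2 * z.1)) * f z.2)).
apply: cmeasM; first by apply: cmeas_cis; mmeas.
case: mf => f1 f2; split; [exact: (measurableT_comp f1 measurable_snd)|exact: (measurableT_comp f2 measurable_snd)].
Qed.

Lemma integrable_1Bcos u : (leb R).-integrable setT (fun x => ((1 - cos (u * x)) / x ^+ 2)%:E).
Proof.
apply/integrableP; split; first by mmeas.
rewrite [ltLHS](_ : _ = (pi * `|u|)%:E) ?ltry// -integral_1Bcos.
by apply: eq_integral => x _ /=; rewrite ger0_norm// divr_ge0 ?sqr_ge0 ?subr_ge0 ?cos_le1.
Qed.

Lemma ae_neq0 : {ae leb R, forall x : TR R, x != 0 :> R}.
Proof.
exists [set 0]; split => //; first exact: lebesgue_measure_set1.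
by move=> x /= /negP; rewrite negbK => /eqP.
Qed.

(** This is $|e^{-ib\xi}-e^{-ia\xi}|^2/\xi^2$, and the squared distance of two unimodular numbers is
    2 minus twice the cosine of the difference of their arguments. *)
Lemma csq_fourier1_ind a b xi : a <= b -> xi != 0 ->
  csq (fourier1 (ind a b) xi) = 2 * ((1 - cos ((b - a) * xi)) / xi ^+ 2).
Proof.
move=> ab xi0; rewrite fourier1_ind// /csq/= [(b - a) * xi]mulrBl cosB.
have hb := cos2Dsin2 (b * xi); have ha := cos2Dsin2 (a * xi).
set ca := cos (a * xi) in ha *; set cb := cos (b * xi) in hb *.
set sa := sin (a * xi) in ha *; set sb := sin (b * xi) in hb *.
rewrite !exprMn exprVn -mulrDl mulrA; congr (_ / _).
have -> : 2 = (cb ^+ 2 + sb ^+ 2) + (ca ^+ 2 + sa ^+ 2) :> R by rewrite hb ha.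
transitivity ((cb ^+ 2 + sb ^+ 2) + (ca ^+ 2 + sa ^+ 2) - 2 * (cb * ca + sb * sa)); first by ring.
by rewrite mulrBr mulr1 hb ha.
Qed.

Lemma integrable_csq_fourier1_ind a b : a <= b ->
  (leb R).-integrable setT (fun x => (csq (fourier1 (ind a b) x))%:E).
Proof.
move=> ab; have mF := cmeas_fourier1 (cintegrable_meas (cintegrable_ind a b)).
apply: (@ae_le_integrable _ _ _ _ _ (fun x => 2 * ((1 - cos ((b - a) * x)) / x ^+ 2))).
- exact: measurable_csq.
- exact: (integrableZl measurableT 2 (integrable_1Bcos (b - a))).
- by apply: filterS ae_neq0 => x x0; rewrite ger0_norm ?csq_ge0// csq_fourier1_ind.
Qed.

Lemma fourier1_indN a b xi : fourier1 (ind a b) (- xi) = conjc (fourier1 (ind a b) xi).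
Proof.
rewrite -cintJ; last first.
  apply: cintegrable_unimodular; last exact: cintegrable_ind.
  - by apply: cmeas_cis; mmeas.
  - by move=> x; exact: cnorm_cis.
congr cint; apply/funext => x; rewrite mulrN opprK cisN.
by apply: c_ext; rewrite !cE/=; ring.
Qed.

(** The numerator of the real part is $\cos((a-c)\xi)+\cos((b-d)\xi)-\cos((a-d)\xi)-\cos((b-c)\xi)$.
    As the signs cancel, each cosine may be replaced by $\cos-1$, which makes the four terms
    separately integrable against $\xi^{-2}$. *)
Lemma fourier1_ind_parseval_re a b c d : a <= b -> c <= d ->
  \int[leb R]_x complex.Re (fourier1 (ind a b) x * conjc (fourier1 (ind c d) x)) =
  pi * (`|a - d| + `|b - c| - `|a - c| - `|b - d|).
Proof.
move=> ab cd; pose phi u x := (1 - cos (u * x)) / x ^+ 2.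
have iphi u : (leb R).-integrable setT (EFin \o phi u) by exact: integrable_1Bcos.
have Iphi u : \int[leb R]_x phi u x = pi * `|u|.
  by rewrite /Rintegral integral_1Bcos.
transitivity (\int[leb R]_x (phi (a - d) x + phi (b - c) x - phi (a - c) x - phi (b - d) x)).
  apply: ae_eq_Rintegral.
  - by have [] := cmeasM (cmeas_fourier1 (cintegrable_meas (cintegrable_ind a b)))
       (cmeasJ (cmeas_fourier1 (cintegrable_meas (cintegrable_ind c d)))).
  - by rewrite /phi; mmeas.
  apply: filterS ae_neq0 => x x0; rewrite !fourier1_ind// !cE/= /phi.
  by rewrite ![(_ - _) * x]mulrBl !cosB; field.
have i1 := integrableD_EFin (iphi (a - d)) (iphi (b - c)).
rewrite RintegralB//; last exact: integrableB_EFin i1 (iphi (a - c)).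
rewrite RintegralB//.
by rewrite RintegralD// !Iphi; ring.
Qed.

(** The signed sum of end point distances is twice the length of the overlap; the proof runs through
    the relative positions of the end points. Compared with [fourier1_ind_parseval_re] it yields the
    factor $2\pi$ in each dimension. *)
Lemma Rintegral_ind2 a b c d : a <= b -> c <= d ->
  \int[leb R]_x (\1_(`]a, b]%classic) x * \1_(`]c, d]%classic) x) =
  2^-1 * (`|a - d| + `|b - c| - `|a - c| - `|b - d|).
Proof.
move=> ab cd.
rewrite Rintegral_mul_indic.
transitivity (\int[leb R]_(x in `]Num.max a c, Num.min b d]) (1 : R)).
  rewrite Rintegral_mkcond [RHS]Rintegral_mkcond; apply: eq_Rintegral => x _.
  rewrite /patch indicE !mem_setE !in_itv/= gt_max le_min.
  by case: (a < x) (c < x) (x <= b) (x <= d) => [] [] [] [].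
have h := lebesgue_measure_itv `](Num.max a c), (Num.min b d)].
rewrite /= lte_fin in h; rewrite Rintegral_cst// mul1r.
set m := fine _; have {h}-> : m = fine (if Num.max a c < Num.min b d
    then ((Num.min b d)%:E + (- Num.max a c)%R%:E)%E else 0%E) by rewrite -h.
have P (x y : R) : x <= y -> `|x - y| = y - x by move=> xy; rewrite distrC ger0_norm// subr_ge0.
have P' (x y : R) : x <= y -> `|y - x| = y - x by move=> xy; rewrite ger0_norm// subr_ge0.
have [bc|cb] := leP b c.
  have ac := le_trans ab bc; have bd := le_trans bc cd; have ad := le_trans ac cd.
  rewrite (P _ _ ad) (P _ _ bc) (P _ _ ac) (P _ _ bd) (max_idPr ac) (min_idPl bd).
  by rewrite ltNge bc/=; ring.
have [da|ad] := leP d a.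
  have ca := le_trans cd da; have db := le_trans da ab.
  rewrite (P' _ _ da) (P' _ _ (ltW cb)) (P' _ _ ca) (P' _ _ db) (max_idPl ca) (min_idPr db).
  by rewrite ltNge da/=; ring.
rewrite (P _ _ (ltW ad)) (P' _ _ (ltW cb)).
have [ac|/ltW ca] := leP a c; have [bd|/ltW db] := leP b d.
- by rewrite (P _ _ ac) (P _ _ bd) cb/=; field.
- rewrite (P _ _ ac) (P' _ _ db); case: ltP => /= [_|dc]; first by field.
  by rewrite (le_anti (introT andP (conj cd dc))); field.
- rewrite (P' _ _ ca) (P _ _ bd); case: ltP => /= [_|ba]; first by field.
  by rewrite (le_anti (introT andP (conj ab ba))); field.
- by rewrite (P' _ _ ca) (P' _ _ db) ad/=; field.
Qed.

(** The real parts are compared by the two formulas in the end points. The imaginary parts vanish: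
    on the right the functions are real, on the left the integrand is odd because the transform of a
    real function at $-\xi$ is the conjugate of its value at $\xi$. *)
Lemma fourier1_ind_parseval a b c d : a <= b -> c <= d ->
  let F x := fourier1 (ind a b) x * conjc (fourier1 (ind c d) x) in
  cintegrable (leb R) F /\
  cint (leb R) setT F =
    (2 * pi)%:C * cint (leb R) setT (fun x => ind a b x * conjc (ind c d x)).
Proof.
move=> ab cd F.
have mab := cmeas_fourier1 (cintegrable_meas (cintegrable_ind a b)).
have mcd := cmeas_fourier1 (cintegrable_meas (cintegrable_ind c d)).
have mF : cmeas F by apply: cmeasM => //; exact: cmeasJ.
have iF : cintegrable (leb R) F.
  apply: (@le_cintegrable _ _ _ _ _ (fun x => csq (fourier1 (ind a b) x) + csq (fourier1 (ind c d) x))) => //.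
    by apply: integrableD_EFin; exact: integrable_csq_fourier1_ind.
  move=> x; rewrite cnormM cnormJ -!cnorm_sqr.
  set u := Normc.normc _; set v := Normc.normc _.
  have := sqr_ge0 (u - v); have := sqr_ge0 u; have := sqr_ge0 v; nra.
split=> //; apply: c_ext; [rewrite cReZ|rewrite cImZ].
- rewrite [LHS](fourier1_ind_parseval_re ab cd).
  transitivity (2 * pi * \int[leb R]_x (\1_(`]a, b]%classic) x * \1_(`]c, d]%classic) x)).
    by rewrite Rintegral_ind2//; field.
  by congr (_ * _); apply: eq_Rintegral => x _; rewrite cReM/= mul0r subr0.
- transitivity (2 * pi * 0 : R); last first.
    congr (_ * _); apply/esym; rewrite /cint/=.
    rewrite (@eq_Rintegral _ _ _ _ _ (cst 0)).
      by rewrite /Rintegral integral0.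
    by move=> x _; rewrite oppr0 mulr0 mul0r addr0.
  rewrite mulr0 [LHS]Rintegral_odd//; first by case: iF.
  by move=> x; rewrite /F !fourier1_indN !cE; ring.
Qed.

End interval_transform.

(** * A generating pi-system for the Borel sets of space *)

Section product_generator.
Context d1 d2 (T1 : measurableType d1) (T2 : measurableType d2).

(** As each family contains the whole space, cylinders over generators are generators. Cylinders
    over arbitrary measurable sets follow by the sigma-algebra axioms, and a rectangle is the
    intersection of two cylinders. *)
Lemma measurable_prod_gen (C1 : set (set T1)) (C2 : set (set T2)) :
  @measurable _ T1 = <<s C1 >> -> @measurable _ T2 = <<s C2 >> ->
  C1 setT -> C2 setT ->
  @measurable _ (T1 * T2)%type = <<s [set A `*` B | A in C1 & B in C2] >>.
Proof.
move=> e1 e2 C1T C2T; apply/seteqP; split; last first.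
  apply: smallest_sub; first exact: sigma_algebra_measurable.
  move=> _ [A CA] [B CB] <-; apply: measurableX.
    by rewrite e1; exact: sub_sigma_algebra.
  by rewrite e2; exact: sub_sigma_algebra.
set G := [set A `*` B | A in C1 & B in C2].
rewrite measurable_prod_measurableType.
apply: smallest_sub; first exact: smallest_sigma_algebra.
have S1 : <<s C1 >> `<=` [set A | <<s G >> (A `*` setT)].
  apply: smallest_sub; last first.
    by move=> A CA; apply: sub_sigma_algebra; exists A => //; exists setT.
  split => /=.
  - by rewrite set0X; exact: sigma_algebra0.
  - move=> A GA; rewrite (_ : (setT `\` A) `*` setT = setT `\` (A `*` setT)).
      by apply: sigma_algebraCD.
    apply/seteqP; split => -[x y] /=; first by move=> [[_ nA] _]; split => // -[].
    by move=> [_ nA]; split => //; split => // Ax; apply: nA.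
  - move=> F GF; rewrite (_ : _ `*` setT = \bigcup_k (F k `*` setT)).
      exact: sigma_algebra_bigcup.
    apply/seteqP; split => -[x y] /=; first by move=> [[k _ Fk] _]; exists k.
    by move=> [k _ [Fk _]]; split => //; exists k.
have S2 : <<s C2 >> `<=` [set A | <<s G >> (setT `*` A)].
  apply: smallest_sub; last first.
    by move=> A CA; apply: sub_sigma_algebra; exists setT => //; exists A.
  split => /=.
  - by rewrite setX0; exact: sigma_algebra0.
  - move=> A GA; rewrite (_ : setT `*` (setT `\` A) = setT `\` (setT `*` A)).
      by apply: sigma_algebraCD.
    apply/seteqP; split => -[x y] /=; first by move=> [_ [_ nA]]; split => // -[].
    by move=> [_ nA]; split => //; split => // Ax; apply: nA.
  - move=> F GF; rewrite (_ : setT `*` _ = \bigcup_k (setT `*` F k)).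
      exact: sigma_algebra_bigcup.
    apply/seteqP; split => -[x y] /=; first by move=> [_ [k _ Fk]]; exists k.
    by move=> [k _ [_ Fk]]; split => //; exists k.
move=> _ [A mA] [B mB] <-.
rewrite (_ : A `*` B = (A `*` setT) `&` (setT `*` B)); last first.
  by apply/seteqP; split => -[x y] /=; [move=> []|move=> [[? _] [_ ?]]].
have mGI := @measurableI _ (g_sigma_algebraType G).
apply: mGI.
- by apply: S1; rewrite -e1.
- by apply: S2; rewrite -e2.
Qed.

Lemma setI_closed_prod (C1 : set (set T1)) (C2 : set (set T2)) :
  setI_closed C1 -> setI_closed C2 ->
  setI_closed [set A `*` B | A in C1 & B in C2].
Proof.
move=> I1 I2 _ _ [A CA [B CB <-]] [A' CA' [B' CB' <-]].
exists (A `&` A'); first exact: I1.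
exists (B `&` B'); first exact: I2.
by rewrite setXI.
Qed.

End product_generator.

Section rays.
Variable R : realType.

(** The whole line is adjoined for the sake of [measurable_prod_gen]; the family remains closed
    under intersection. *)
Definition rays : set (set (TR R)) :=
  [set A | A = setT \/ exists c : R, A = [set` `]-oo, c]]].

Lemma rays_setI : setI_closed rays.
Proof.
move=> A B [->|[a ->]]; first by rewrite setTI.
move=> [->|[b ->]]; first by rewrite setIT; right; exists a.
right; exists (Num.min a b); apply/seteqP; split => x /=.
  by move=> []; rewrite !in_itv/= le_min => -> ->.
by rewrite !in_itv/= le_min => /andP[-> ->].
Qed.

Lemma measurable_rays : @measurable _ (TR R) = <<s rays >>.
Proof.
apply/seteqP; split; last first.
  apply: smallest_sub; first exact: sigma_algebra_measurable.
  move=> A [->|[c ->]]; first exact: measurableT.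
  exact: measurable_itv.
apply: smallest_sub; first exact: smallest_sigma_algebra.
have mD := @measurableD _ (g_sigma_algebraType rays).
move=> _ [[a b] _ <-] /=.
rewrite (_ : [set` _] = [set` `]-oo, b]] `\` [set` `]-oo, a]]); last first.
  apply/seteqP; split => x /=; rewrite !in_itv/=.
    by move=> /andP[ax ->]; split=> //; apply/negP; rewrite -ltNge.
  by move=> [-> /negP]; rewrite -ltNge => ->.
by apply: mD; apply: sub_sigma_algebra; right; [exists b|exists a].
Qed.

Definition corners : set (set (TR3 R)) :=
  [set A `*` B | A in [set A `*` B | A in rays & B in rays] & B in rays].

Lemma measurable_corners : @measurable _ (TR3 R) = <<s corners >>.
Proof.
have rT : rays setT by left.
apply: measurable_prod_gen => //; last 2 first.
- exact: measurable_rays.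
- by exists setT => //; exists setT => //; rewrite setXTT.
apply: measurable_prod_gen => //; exact: measurable_rays.
Qed.

Lemma corners_setI : setI_closed corners.
Proof.
by apply: setI_closed_prod; [apply: setI_closed_prod|]; exact: rays_setI.
Qed.

End rays.

(** * Parseval's identity for boxes and their linear combinations *)

Section box_transform.
Variable R : realType.
Implicit Types (a b c d x xi : TR3 R) (f g : TR3 R -> R[i]).

Lemma dotE (x y : space3 R) : dot x y = x.1.1 * y.1.1 + x.1.2 * y.1.2 + x.2 * y.2.
Proof. by rewrite /dot !big_ord_recr big_ord0/= add0r. Qed.

Lemma measurable_dot (dT : measure_display) (T : measurableType dT) (D : set T) (u v : T -> TR3 R) :
  measurable_fun D u -> measurable_fun D v ->
  measurable_fun D (fun z => dot (u z) (v z)).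
Proof.
move=> mu mv; rewrite (_ : (fun z => _) = fun z => (u z).1.1 * (v z).1.1 +
  (u z).1.2 * (v z).1.2 + (u z).2 * (v z).2); last by apply/funext => z; exact: dotE.
by mmeas.
Qed.

(** A unimodular factor leaves the modulus of the joint integrand equal to that of a tensor product
    of integrable functions, so Fubini applies. *)
Lemma cint_swap (U : TR3 R * TR3 R -> R[i]) f g : cmeas U ->
  (forall w, Normc.normc (U w) = 1) -> cintegrable (leb3 R) f -> cintegrable (leb3 R) g ->
  cintegrable (leb3 R) (fun z => cint (leb3 R) setT (fun w => U (z, w) * (f z * g w))) /\
  cint (leb3 R) setT (fun z => cint (leb3 R) setT (fun w => U (z, w) * (f z * g w))) =
  cint (leb3 R) setT (fun w => cint (leb3 R) setT (fun z => U (z, w) * (f z * g w))).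
Proof.
move=> mU U1 fi gi.
have iF : cintegrable (leb3s R \x leb3s R)%E (fun w => U w * (f w.1 * g w.2)).
  apply: cintegrable_unimodular => //.
  exact: (@cintegrable_prodM _ _ _ _ _ (leb3s R) (leb3s R) _ _ fi gi).
have [i1 e1] := cint_fubini1 iF; have [_ e2] := cint_fubini2 iF.
by split; [exact: i1|exact: (etrans e1 (esym e2))].
Qed.

Definition le3 a b := [/\ a.1.1 <= b.1.1, a.1.2 <= b.1.2 & a.2 <= b.2].

Definition box a b x : R[i] :=
  ind a.1.1 b.1.1 x.1.1 * ind a.1.2 b.1.2 x.1.2 * ind a.2 b.2 x.2.

Lemma cintegrable_leb3_prodM (f g h : TR R -> R[i]) :
  cintegrable (leb R) f -> cintegrable (leb R) g -> cintegrable (leb R) h ->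
  cintegrable (leb3 R) (fun x => f x.1.1 * g x.1.2 * h x.2) /\
  cint (leb3 R) setT (fun x => f x.1.1 * g x.1.2 * h x.2) =
  cint (leb R) setT f * cint (leb R) setT g * cint (leb R) setT h.
Proof.
move=> fi gi hi; pose fg (z : TR2 R) := f z.1 * g z.2.
have fgi : cintegrable (leb2 R) fg by exact: (cintegrable_prodM fi gi).
split; first exact: (cintegrable_prodM fgi hi).
transitivity (cint (leb2 R) setT fg * cint (leb R) setT h).
  exact: (cint_prodM fgi hi).
by congr (_ * _); exact: (cint_prodM fi gi).
Qed.

Lemma cintegrable_box a b : cintegrable (leb3 R) (box a b).
Proof.
by have [] := cintegrable_leb3_prodM (cintegrable_ind a.1.1 b.1.1)
  (cintegrable_ind a.1.2 b.1.2) (cintegrable_ind a.2 b.2).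
Qed.

Lemma fourier_box a b xi : fourier (box a b) xi =
  fourier1 (ind a.1.1 b.1.1) xi.1.1 * fourier1 (ind a.1.2 b.1.2) xi.1.2 *
  fourier1 (ind a.2 b.2) xi.2.
Proof.
have ci (s u v : R) : cintegrable (leb R) (fun y : TR R => cis (- (y * s)) * ind u v y).
  apply: cintegrable_unimodular; last exact: cintegrable_ind.
    by apply: cmeas_cis; mmeas.
  by move=> x; exact: cnorm_cis.
have [_ e] := cintegrable_leb3_prodM (ci xi.1.1 a.1.1 b.1.1)
  (ci xi.1.2 a.1.2 b.1.2) (ci xi.2 a.2 b.2).
rewrite -[RHS]e; congr cint; apply/funext => x.
by rewrite dotE !opprD !cisD /box; ring.
Qed.

Lemma cmeas_fourier f : cmeas f -> cmeas (fourier f).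
Proof.
move=> mf.
apply: (@cmeas_cint_param _ _ _ _ _ (leb3s R)
  (fun z : TR3 R * TR3 R => cis (- dot z.2 z.1) * f z.2)).
apply: cmeasM.
  apply: cmeas_cis; apply: mf_opp; apply: measurable_dot.
  - exact: measurable_snd.
  - exact: measurable_fst.
case: mf => f1 f2; split.
- exact: (measurableT_comp f1 measurable_snd).
- exact: (measurableT_comp f2 measurable_snd).
Qed.

Lemma cintegrable_fourier f xi : cintegrable (leb3 R) f ->
  cintegrable (leb3 R) (fun x => cis (- dot x xi) * f x).
Proof.
move=> fi; apply: cintegrable_unimodular => //.
  by apply/cmeas_cis/mf_opp/measurable_dot; [exact: mf_id|exact: measurable_cst].
by move=> x; exact: cnorm_cis.
Qed.

Lemma fourierD f g xi : cintegrable (leb3 R) f -> cintegrable (leb3 R) g ->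
  fourier (fun x => f x + g x) xi = fourier f xi + fourier g xi.
Proof.
move=> fi gi; rewrite -cintD; try exact: cintegrable_fourier.
by congr cint; apply/funext => x; rewrite mulrDr.
Qed.

Lemma fourierZ (k : R[i]) f xi : cintegrable (leb3 R) f ->
  fourier (fun x => k * f x) xi = k * fourier f xi.
Proof.
move=> fi; rewrite -cintZ; last exact: cintegrable_fourier.
by congr cint; apply/funext => x; rewrite mulrCA.
Qed.

(** The integrability facts are part of the relation, so that it is inherited by sums, scalar
    multiples and the exchange of [f] and [g] without side conditions. *)
Definition parseval f g :=
  [/\ cintegrable (leb3 R) f, cintegrable (leb3 R) g,
      cintegrable (leb3 R) (fun x => f x * conjc (g x)),
      cintegrable (leb3 R) (fun x => fourier f x * conjc (fourier g x)) &
      cint (leb3 R) setT (fun x => fourier f x * conjc (fourier g x)) =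
      ((2 * pi) ^+ 3)%:C * cint (leb3 R) setT (fun x => f x * conjc (g x))].

(** Both integrands are products of functions of one coordinate each, so the identity is the product
    of three one-dimensional ones, whence the third power of $2\pi$. *)
Lemma parseval_box a b c d : le3 a b -> le3 c d -> parseval (box a b) (box c d).
Proof.
move=> [ab1 ab2 ab3] [cd1 cd2 cd3].
have i1 (s t u v : R) : cintegrable (leb R) (fun y : TR R => ind s t y * conjc (ind u v y)).
  apply: (le_cintegrable _ (integrable_ind s t)).
    by apply: cmeasM; [|apply: cmeasJ]; exact: cintegrable_meas (cintegrable_ind _ _).
  move=> x; rewrite cnormM cnormJ !cnorm_real !indicE.
  by case: (_ \in _); case: (_ \in _); rewrite !(normr0, normr1, mulr0, mul0r, mulr1).
have [j1 e1] := fourier1_ind_parseval ab1 cd1.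
have [j2 e2] := fourier1_ind_parseval ab2 cd2.
have [j3 e3] := fourier1_ind_parseval ab3 cd3.
have [i2 ei] := cintegrable_leb3_prodM (i1 a.1.1 b.1.1 c.1.1 d.1.1)
  (i1 a.1.2 b.1.2 c.1.2 d.1.2) (i1 a.2 b.2 c.2 d.2).
have [i3 ej] := cintegrable_leb3_prodM j1 j2 j3.
have E1 : (fun x => box a b x * conjc (box c d x)) =
  (fun x => ind a.1.1 b.1.1 x.1.1 * conjc (ind c.1.1 d.1.1 x.1.1) *
    (ind a.1.2 b.1.2 x.1.2 * conjc (ind c.1.2 d.1.2 x.1.2)) *
    (ind a.2 b.2 x.2 * conjc (ind c.2 d.2 x.2))).
  by apply/funext => x; rewrite /box !cjM; ring.
have E2 : (fun x => fourier (box a b) x * conjc (fourier (box c d) x)) =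
  (fun x => fourier1 (ind a.1.1 b.1.1) x.1.1 * conjc (fourier1 (ind c.1.1 d.1.1) x.1.1) *
    (fourier1 (ind a.1.2 b.1.2) x.1.2 * conjc (fourier1 (ind c.1.2 d.1.2) x.1.2)) *
    (fourier1 (ind a.2 b.2) x.2 * conjc (fourier1 (ind c.2 d.2) x.2))).
  by apply/funext => x; rewrite !fourier_box !cjM; ring.
split; try exact: cintegrable_box.
- by rewrite E1.
- by rewrite E2.
- rewrite E1 E2 [LHS]ej e1 e2 e3.
  transitivity (((2 * pi) ^+ 3)%:C *
    (cint (leb R) setT (fun y => ind a.1.1 b.1.1 y * conjc (ind c.1.1 d.1.1 y)) *
     cint (leb R) setT (fun y => ind a.1.2 b.1.2 y * conjc (ind c.1.2 d.1.2 y)) *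
     cint (leb R) setT (fun y => ind a.2 b.2 y * conjc (ind c.2 d.2 y))));
    last by congr (_ * _); exact: esym ei.
  rewrite (_ : ((2 * pi) ^+ 3)%:C = (2 * pi)%:C * (2 * pi)%:C * (2 * pi)%:C :> R[i]);
    first by ring.
  by apply: c_ext; rewrite !cE/=; ring.
Qed.

Lemma parsevalD f f' g : parseval f g -> parseval f' g ->
  parseval (fun x => f x + f' x) g.
Proof.
move=> [i1 i2 i3 i4 e] [i1' _ i3' i4' e'].
have E1 : (fun x => (f x + f' x) * conjc (g x)) =
    (fun x => f x * conjc (g x) + f' x * conjc (g x)).
  by apply/funext => x; rewrite mulrDl.
have E2 : (fun x => fourier (fun x => f x + f' x) x * conjc (fourier g x)) =
    (fun x => fourier f x * conjc (fourier g x) + fourier f' x * conjc (fourier g x)).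
  by apply/funext => x; rewrite fourierD// mulrDl.
split => //; rewrite ?E1 ?E2; try exact: cintegrableD.
by rewrite cintD// e e' cintD// [RHS]mulrDr.
Qed.

Lemma parsevalZ (k : R[i]) f g : parseval f g -> parseval (fun x => k * f x) g.
Proof.
move=> [i1 i2 i3 i4 e].
have E1 : (fun x => (k * f x) * conjc (g x)) = (fun x => k * (f x * conjc (g x))).
  by apply/funext => x; rewrite mulrA.
have E2 : (fun x => fourier (fun x => k * f x) x * conjc (fourier g x)) =
    (fun x => k * (fourier f x * conjc (fourier g x))).
  by apply/funext => x; rewrite fourierZ// mulrA.
split => //; rewrite ?E1 ?E2; try exact: cintegrableZ.
by rewrite cintZ// e cintZ// [LHS]mulrCA.
Qed.

Lemma parseval_sym f g : parseval f g -> parseval g f.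
Proof.
move=> [i1 i2 i3 i4 e].
have E1 : (fun x => g x * conjc (f x)) = (fun x => conjc (f x * conjc (g x))).
  by apply/funext => x; rewrite cjM cjK mulrC.
have E2 : (fun x => fourier g x * conjc (fourier f x)) =
    (fun x => conjc (fourier f x * conjc (fourier g x))).
  by apply/funext => x; rewrite cjM cjK mulrC.
split => //; rewrite ?E1 ?E2; try exact: cintegrableJ.
rewrite cintJ// e cintJ// cjM; congr (_ * _).
by apply: c_ext; rewrite !cE/= ?oppr0.
Qed.

Definition cube (N : R) : set (TR3 R) :=
  [set` `]- N, N]] `*` [set` `]- N, N]] `*` [set` `]- N, N]].

(** An inductive span instead of explicit finite sums: bilinearity of Parseval becomes a double
    induction. All boxes lie in the cube, so the approximants vanish off it together with the
    function they approximate. *)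
Inductive stepfun (N : R) : (TR3 R -> R[i]) -> Prop :=
| stepfun_box a b of le3 (- N, - N, - N) a & le3 a b & le3 b (N, N, N) :
    stepfun N (box a b)
| stepfunD f g of stepfun N f & stepfun N g : stepfun N (fun x => f x + g x)
| stepfunZ k f of stepfun N f : stepfun N (fun x => k * f x).

Lemma parseval_stepfun N f g : stepfun N f -> stepfun N g -> parseval f g.
Proof.
move=> sf sg; elim: sf => {f} [a b _ ab _|f f' _ pf _ pf'|k f _ pf].
- apply: parseval_sym.
  elim: sg => {g} [c d _ cd _|g g' _ pg _ pg'|k g _ pg].
  + exact: parseval_box.
  + exact: parsevalD.
  + exact: parsevalZ.
- exact: parsevalD.
- exact: parsevalZ.
Qed.

Lemma measurable_cube N : measurable (cube N).
Proof. by apply: measurableX; [apply: measurableX|]; exact: measurable_itv. Qed.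

Lemma leb3_cube N : (leb3 R (cube N) < +oo)%E.
Proof.
pose I : set (TR R) := [set` `]- N, N]].
have mi : measurable I by exact: measurable_itv.
have fi : (leb R I < +oo)%E.
  by have h := lebesgue_measure_itv `]- N, N]; rewrite [leb R I]h/=; case: ifP; rewrite ltry.
have fn : (leb R I \is a fin_num)%E by rewrite ge0_fin_numE.
have e2 : (leb2 R (I `*` I) = leb R I * leb R I)%E by exact: product_measure1E.
have -> : (leb3 R (cube N) = leb2 R (I `*` I) * leb R I)%E.
  by apply: product_measure1E => //; exact: measurableX.
by rewrite e2 -ge0_fin_numE ?mule_ge0// !fin_numM.
Qed.

Lemma box_cube N x : box (- N, - N, - N) (N, N, N) x = (\1_(cube N) x)%:C.
Proof.
rewrite /box /ind/= !indicE.
have -> : (x \in cube N) = (x.1.1 \in `]- N, N]) && (x.1.2 \in `]- N, N]) && (x.2 \in `]- N, N]).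
  apply/idP/idP; rewrite inE /cube/=; first by move=> [[-> ->] ->].
  by move=> /andP[/andP[-> ->] ->].
rewrite !mem_setE.
by case: (_ \in _); case: (_ \in _); case: (_ \in _); apply: c_ext; rewrite !cE/= ?mulr0 ?mulr1 ?mul0r ?subr0 ?addr0.
Qed.

Lemma stepfun_out N f x : stepfun N f -> ~ cube N x -> f x = 0.
Proof.
elim=> {f} [a b [/= a1 a2 a3] [ab1 ab2 ab3] [/= b1 b2 b3]|f g _ ef _ eg|k f _ ef] nx.
- suff : ~ (x.1.1 \in `]a.1.1, b.1.1] /\ x.1.2 \in `]a.1.2, b.1.2] /\ x.2 \in `]a.2, b.2]).
    rewrite /box /ind !indicE !mem_setE.
    case: (_ \in _); case: (_ \in _); case: (_ \in _) => h;
      rewrite ?mulr0 ?mul0r//=.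
    by case: h.
  move=> [h1 [h2 h3]]; apply: nx; rewrite /cube/=.
  move: h1 h2 h3; rewrite !in_itv/= => /andP[? ?] /andP[? ?] /andP[? ?].
  by split; [split|]; apply/andP; split; lra.
- by rewrite ef// eg// addr0.
- by rewrite ef// mulr0.
Qed.

End box_transform.

(** * Density of step functions *)

Section stepfun_density.
Variable R : realType.
Implicit Types (f g h : TR3 R -> R[i]) (S : set (TR3 R)).

(** Squared and extended-valued, so that it can be used before any integrability is known. The price
    is a triangle inequality with a factor 2. *)
Definition sqdist f g : \bar R := (\int[leb3 R]_x (csq (f x - g x))%:E)%E.

Definition approximable (N : R) f := cmeas f /\
  forall e, 0 < e -> exists2 s, stepfun N s & (sqdist f s <= e%:E)%E.

Lemma cmeas_stepfun N f : stepfun N f -> cmeas f.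
Proof.
by move=> sf; have [fi _ _ _ _] := parseval_stepfun sf sf; exact: cintegrable_meas fi.
Qed.

Lemma ge0_le_integral_leb3 (u v : TR3 R -> R) : measurable_fun setT u ->
  measurable_fun setT v -> (forall x, 0 <= u x <= v x) ->
  (\int[leb3 R]_x (u x)%:E <= \int[leb3 R]_x (v x)%:E)%E.
Proof.
move=> mu mv uv; apply: ge0_le_integral => //.
- by move=> x _; rewrite lee_fin; have /andP[] := uv x.
- exact/measurable_EFinP.
- exact/measurable_EFinP.
- by move=> x _; rewrite lee_fin; have /andP[] := uv x.
Qed.

Lemma sqdist_triangle f g h : cmeas f -> cmeas g -> cmeas h ->
  (sqdist f h <= 2%:E * sqdist f g + 2%:E * sqdist g h)%E.
Proof.
move=> mf mg mh.
have m1 := measurable_csq (cmeasB mf mg); have m2 := measurable_csq (cmeasB mg mh).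
have m3 := measurable_csq (cmeasB mf mh).
rewrite /sqdist -!ge0_integralZl//; last 4 first.
- exact/measurable_EFinP.
- by move=> x _; rewrite lee_fin csq_ge0.
- exact/measurable_EFinP.
- by move=> x _; rewrite lee_fin csq_ge0.
rewrite -ge0_integralD//; last 4 first.
- by move=> x _; rewrite mule_ge0// lee_fin csq_ge0.
- by apply/measurable_EFinP/mf_mul.
- by move=> x _; rewrite mule_ge0// lee_fin csq_ge0.
- by apply/measurable_EFinP/mf_mul.
apply: (@ge0_le_integral_leb3 _ (fun x => 2 * csq (f x - g x) + 2 * csq (g x - h x))) => //.
  by apply: mf_add; apply: mf_mul.
move=> x; rewrite csq_ge0/=.
by rewrite (_ : f x - h x = (f x - g x) + (g x - h x)) ?csqD_le// addrA subrK.
Qed.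

Lemma sqdist0 f : sqdist f f = 0%E.
Proof.
rewrite /sqdist integral0_eq// => x _.
by rewrite subrr /csq/= expr0n addr0.
Qed.

Lemma approximable_stepfun N f : stepfun N f -> approximable N f.
Proof.
move=> sf; split; first exact: cmeas_stepfun sf.
by move=> e e0; exists f => //; rewrite sqdist0 lee_fin ltW.
Qed.

Lemma approximable_close N f : cmeas f ->
  (forall e, 0 < e -> exists2 g, approximable N g & (sqdist f g <= e%:E)%E) ->
  approximable N f.
Proof.
move=> mf h; split=> // e e0.
(* Two errors, each doubled by [sqdist_triangle], share [e]. *)
have e4 : 0 < e / 4 by rewrite divr_gt0.
have [g [mg /(_ _ e4)[s ss gs]] fg] := h _ e4; exists s => //.
rewrite (le_trans (sqdist_triangle mf mg (cmeas_stepfun ss)))//.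
rewrite (_ : e%:E = 2%:E * (e / 4)%:E + 2%:E * (e / 4)%:E)%E.
  by rewrite leeD// lee_pmul2l.
by rewrite -!EFinM -EFinD; congr EFin; field.
Qed.

Lemma approximableD N f g : approximable N f -> approximable N g ->
  approximable N (fun x => f x + g x).
Proof.
move=> [mf af] [mg ag]; split; first exact: cmeasD.
move=> e e0; have e4 : 0 < e / 4 by rewrite divr_gt0.
have [s ss fs] := af _ e4; have [t st gt] := ag _ e4.
exists (fun x => s x + t x); first exact: stepfunD.
have ms := cmeas_stepfun ss; have mt := cmeas_stepfun st.
have := @sqdist_triangle (fun x => f x + g x) (fun x => s x + g x) (fun x => s x + t x)
  (cmeasD mf mg) (cmeasD ms mg) (cmeasD ms mt).
move=> /le_trans; apply.
have -> : sqdist (fun x => f x + g x) (fun x => s x + g x) = sqdist f s.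
  by apply: eq_integral => x _; rewrite opprD addrACA subrr addr0.
have -> : sqdist (fun x => s x + g x) (fun x => s x + t x) = sqdist g t.
  by apply: eq_integral => x _; rewrite opprD addrACA subrr add0r.
rewrite (_ : e%:E = 2%:E * (e / 4)%:E + 2%:E * (e / 4)%:E)%E.
  by rewrite leeD// lee_pmul2l.
by rewrite -!EFinM -EFinD; congr EFin; field.
Qed.

Lemma approximableZ N (k : R[i]) f : approximable N f ->
  approximable N (fun x => k * f x).
Proof.
move=> [mf af]; split; first by apply: cmeasM => //; exact: cmeas_cst.
(* Dividing by [1 + csq k] instead of [csq k] covers the scalar 0. *)
move=> e e0; have k0 : 0 < 1 + csq k by rewrite ltr_pwDl// csq_ge0.
have ek : 0 < e / (1 + csq k) by rewrite divr_gt0.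
have [s ss fs] := af _ ek; exists (fun x => k * s x); first exact: stepfunZ.
have ms := cmeas_stepfun ss.
have -> : sqdist (fun x => k * f x) (fun x => k * s x) = ((csq k)%:E * sqdist f s)%E.
  rewrite /sqdist -ge0_integralZl//.
  - by apply: eq_integral => x _; rewrite -mulrBr csqM.
  - by apply/measurable_EFinP/measurable_csq/cmeasB.
  - by move=> x _; rewrite lee_fin csq_ge0.
  - by rewrite lee_fin csq_ge0.
rewrite (@le_trans _ _ ((csq k)%:E * (e / (1 + csq k))%:E)%E)//.
  by rewrite lee_wpmul2l// lee_fin csq_ge0.
rewrite -EFinM lee_fin mulrA ler_pdivrMr// mulrC ler_wpM2l ?ltW//.
by rewrite ltrDr.
Qed.

(** Dominated convergence makes some [F n] close to [f] in squared distance, and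
    [approximable_close] then passes the property on. *)
Lemma approximable_lim N f (F : nat -> TR3 R -> R[i]) (G : TR3 R -> R) :
  cmeas f -> (forall n, approximable N (F n)) ->
  (leb3 R).-integrable setT (fun x => (G x)%:E) ->
  (forall n x, csq (f x - F n x) <= G x) ->
  (forall x, csq (f x - F n x) @[n --> \oo] --> 0) ->
  approximable N f.
Proof.
move=> mf aF iG fG cF; apply: approximable_close => // e e0.
have mcs n : measurable_fun setT (fun x => (csq (f x - F n x))%:E).
  by apply/measurable_EFinP/measurable_csq/cmeasB => //; case: (aF n).
have [] := @dominated_convergence _ _ _ (leb3 R) setT measurableT
  (fun n x => (csq (f x - F n x))%:E) (cst 0%E) (fun x => (G x)%:E) mcs (measurable_cst _).
- by apply: aeW => x _; apply: cvg_EFin; [exact: nearW|exact: cF].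
- exact: iG.
- by apply: aeW => x n _; rewrite /= lee_fin ger0_norm ?csq_ge0.
move=> _ _; rewrite integral0 => /fine_cvgP[fin] /cvgr0Pnorm_le/(_ _ e0) lim.
have : \forall n \near \oo, (sqdist f (F n) <= e%:E)%E.
  near=> n; rewrite -(@fineK _ (sqdist f (F n))); last by near: n; exact: fin.
  rewrite lee_fin (le_trans (ler_norm _))//.
  by near: n; exact: lim.
move=> [n _ /(_ _ (leqnn n)) h]; exists (F n) => //; exact: aF.
Unshelve. all: by end_near. Qed.

Definition icube (N : R) S (x : TR3 R) : R[i] := (\1_(cube N `&` S) x)%:C.

Lemma integrable_cube N : (leb3 R).-integrable setT (fun x => (\1_(cube N) x)%:E).
Proof.
have mQ := measurable_cube N; apply/integrableP; split.
  by apply/measurable_EFinP; exact: mf_indic.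
rewrite (_ : (fun x => _) = (fun x => (\1_(cube N) x)%:E)).
  by rewrite integral_indic// setIT; exact: leb3_cube.
by apply/funext => x /=; rewrite ger0_norm.
Qed.

Lemma ray_cap (N : R) (A : set (TR R)) : 0 <= N -> rays A ->
  exists b, [/\ - N <= b, b <= N &
    forall x, (x \in `]- N, b]) = (x \in `]- N, N]) && (x \in A)].
Proof.
move=> N0 [->|[c ->]].
  exists N; split => //; first lra.
  by move=> x; rewrite in_setT andbT.
exists (Num.max (- N) (Num.min c N)); split.
- by rewrite le_max lexx.
- by rewrite ge_max ge_min lexx orbT andbT; lra.
- move=> x; rewrite mem_setE !in_itv/= le_max le_min.
  by case: ltP => //= h; rewrite andbC.
Qed.

Lemma approximable_corner (N : R) S : 0 <= N -> corners S -> approximable N (icube N S).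
Proof.
move=> N0 [_ [A rA [B rB <-]] [C rC <-]].
have [a [a1 a2 ea]] := ray_cap N0 rA; have [b [b1 b2 eb]] := ray_cap N0 rB.
have [c [c1 c2 ec]] := ray_cap N0 rC.
rewrite (_ : icube _ _ = box (- N, - N, - N) (a, b, c)).
  by apply: approximable_stepfun; constructor.
apply/funext => x; rewrite /icube /box /ind/= !indicE !mem_setE ea eb ec.
have -> : (x \in cube N `&` ((A `*` B) `*` C)) =
    [&& (x.1.1 \in `]- N, N]) && (x.1.1 \in A), (x.1.2 \in `]- N, N]) && (x.1.2 \in B) &
      (x.2 \in `]- N, N]) && (x.2 \in C)].
  apply/idP/idP => [/set_mem[[[h1 h2] h3] [[? ?] ?]]|].
    by apply/and3P; split; apply/andP; split; rewrite ?mem_set.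
  move=> /and3P[/andP[h1 /set_mem ?] /andP[h2 /set_mem ?] /andP[h3 /set_mem ?]].
  by apply/mem_set.
case: ((x.1.1 \in _) && _); case: ((x.1.2 \in _) && _); case: ((x.2 \in _) && _);
  by apply: c_ext; rewrite !cE/= ?mulr0 ?mulr1 ?mul0r ?subr0 ?addr0.
Qed.

Lemma cmeas_icube N S : measurable S -> cmeas (icube N S).
Proof.
by move=> mS; apply/cmeasR/mf_indic/measurableI => //; exact: measurable_cube.
Qed.

(** Dynkin induction over the corners, whose traces on the cube are boxes. A complement is taken
    relative to the cube. A disjoint union is a limit of finite ones, whose indicators are sums, and
    the indicator of the cube dominates the error. *)
Lemma approximable_indic (N : R) S : 0 <= N -> measurable S -> approximable N (icube N S).
Proof.
move=> N0; rewrite measurable_corners.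
have aT : approximable N (icube N setT).
  apply: approximable_corner => //; exists setT; last first.
    by exists setT; [left|rewrite setXTT].
  by exists setT; [left|exists setT; [left|rewrite setXTT]].
move: S; apply: (@dynkin_induction _ (TR3 R) (@corners R)
  (fun S => approximable N (icube N S))) => //.
- exact: measurable_corners.
- exact: corners_setI.
- by move=> A; exact: approximable_corner.
- move=> A mA aA.
  rewrite (_ : icube N (~` A) = (fun x => icube N setT x + (-1) * icube N A x)).
    by apply: approximableD => //; exact: approximableZ.
  apply/funext => x; rewrite mulN1r /icube !indicE setIT !(@in_setI _ x (cube N)) in_setC.
  by case: (x \in cube N); case: (x \in A); apply: c_ext; rewrite !cE/=; lra.
- move=> F mF tF aF.
  pose U n := \big[setU/set0]_(k < n) F k.
  have mU n : measurable (U n) by exact: bigsetU_measurable.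
  have aU n : approximable N (icube N (U n)).
    elim: n => [|n IH].
      rewrite (_ : icube _ _ = (fun x => 0 * icube N setT x)); first exact: approximableZ.
      by apply/funext => x; rewrite mul0r /icube /U big_ord0 setI0 indicE in_set0.
    rewrite (_ : icube _ _ = (fun x => icube N (U n) x + icube N (F n) x)).
      exact: approximableD.
    apply/funext => x; rewrite /icube /U big_ord_recr/= -/(U n) !indicE !(@in_setI _ x (cube N)) in_setU.
    have : ~~ ((x \in U n) && (x \in F n)).
      have tF' : trivIset (fun i => predT i) F by move=> i j _ _; exact: tF.
      have e := trivIset_bigsetUI tF' isT (leqnn n).
      by rewrite -in_setI [X in _ \in X]e in_set0.
    by case: (x \in cube N); case: (x \in U n); case: (x \in F n) => //= _; apply: c_ext; rewrite !cE/=; lra.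
  apply: (@approximable_lim N _ (fun n => icube N (U n)) (fun x => \1_(cube N) x)) => //.
  + by apply: cmeas_icube; exact: bigcup_measurable.
  + exact: integrable_cube.
  + move=> n x; rewrite /icube !indicE !(@in_setI _ x (cube N)).
    by case: (x \in cube N); case: (x \in _); case: (x \in _); rewrite /csq !cE/=; lra.
  + move=> x; apply: cvg_near_cst.
    have [[k _ Fkx]|nF] := pselect ((\bigcup_k F k) x).
      near=> n; rewrite /icube !indicE !(@in_setI _ x (cube N)).
      have -> : x \in \bigcup_k F k by rewrite inE; exists k.
      have -> : x \in U n.
        rewrite inE /U -bigcup_mkord; exists k => //=.
        by near: n; exact: nbhs_infty_gt.
      by rewrite subrr /csq/= expr0n addr0.
    near=> n; rewrite /icube !indicE !(@in_setI _ x (cube N)).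
    have -> : (x \in \bigcup_k F k) = false by apply: memNset.
    have -> : (x \in U n) = false.
      apply: memNset; rewrite /U -bigcup_mkord => -[k _ Fk]; apply: nF; by exists k.
    by rewrite subrr /csq/= expr0n addr0.
Unshelve. all: by end_near. Qed.

End stepfun_density.

(** * Square integrable functions that vanish off a cube *)

Section L2_density.
Variable R : realType.
Implicit Types (f g h : TR3 R -> R[i]).
Import HBNNSimple.

Lemma approximable_sum (N : R) n (c : 'I_n -> R) (F : 'I_n -> TR3 R -> R[i]) : 0 <= N ->
  (forall k, approximable N (F k)) ->
  approximable N (fun x => \sum_(k < n) (c k)%:C * F k x).
Proof.
move=> N0; elim: n => [|n IH] in c F * => aF.
  rewrite (_ : (fun x => _) = (fun x => 0 * icube N setT x)).
    by apply: approximableZ; exact: approximable_indic.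
  by apply/funext => x; rewrite big_ord0 mul0r.
rewrite (_ : (fun x => _) = (fun x => \sum_(k < n) (c (widen_ord (leqnSn n) k))%:C *
    F (widen_ord (leqnSn n) k) x + (c ord_max)%:C * F ord_max x)).
  by apply: approximableD; [exact: IH|exact: approximableZ].
by apply/funext => x; rewrite big_ord_recr.
Qed.

Lemma approximable_nnsfun (N : R) (h : {nnsfun TR3 R >-> R}) : 0 <= N ->
  approximable N (fun x => (\1_(cube N) x * h x)%:C).
Proof.
move=> N0; pose s := fset_set (h @` setT).
rewrite (_ : (fun x => _) = (fun x => \sum_(i < #|`s|)
    (s`_i)%:C * icube N (h @^-1` [set s`_i]) x)).
  by apply: approximable_sum => // k; exact: approximable_indic.
apply/funext => x; have e := @fimfunEord _ _ h x.
rewrite e -/s mulr_sumr rmorph_sum/=.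
apply: eq_bigr => i _; rewrite /icube -rmorphM/=; congr (_%:C).
by rewrite indicI/=; ring.
Qed.

(** Simple functions increase to [h] pointwise, and the squared error stays below the integrable
    [h ^+ 2] because they remain between 0 and [h]. *)
Lemma approximable_ge0 (N : R) (h : TR3 R -> R) : 0 <= N ->
  measurable_fun setT h -> (forall x, 0 <= h x) ->
  (leb3 R).-integrable setT (fun x => (h x ^+ 2)%:E) ->
  approximable N (fun x => (\1_(cube N) x * h x)%:C).
Proof.
move=> N0 mh h0 ih.
have mhE : measurable_fun setT (EFin \o h) by exact/measurable_EFinP.
pose F n := nnsfun_approx measurableT mhE n.
have cF x : F n x @[n --> \oo] --> h x.
  have hx : forall y : TR3 R, setT y -> (0 <= (EFin \o h) y)%E.
    by move=> y _; rewrite lee_fin.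
  by have /fine_cvgP[_] := cvg_nnsfun_approx measurableT mhE hx (I : setT x).
have leF n x : F n x <= h x.
  have nd := nd_nnsfun_approx measurableT mhE.
  have ndx : nondecreasing_seq (fun n => F n x).
    by move=> i j ij; have /lefP := nd _ _ ij; exact.
  have := nondecreasing_cvgn_le ndx (cvgP _ (cF x)) n.
  by rewrite (cvg_lim _ (cF x)).
have Q01 x : 0 <= (\1_(cube N) x : R) <= 1 by rewrite indicE; case: (_ \in _); rewrite lexx ler01.
apply: (@approximable_lim _ N _ (fun n x => (\1_(cube N) x * F n x)%:C) (fun x => h x ^+ 2)) => //.
- by apply/cmeasR/mf_mul => //; apply: mf_indic; exact: measurable_cube.
- by move=> n; exact: approximable_nnsfun.
- move=> n x; rewrite -rmorphB csq_real -mulrBr exprMn.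
  have /andP[q0 q1] := Q01 x; have := leF n x; have : 0 <= F n x by [].
  move=> F0 Fh; apply: (@le_trans _ _ ((h x - F n x) ^+ 2)).
    by rewrite ler_piMl ?sqr_ge0// exprn_ile1.
  by apply: lerXn2r; rewrite ?nnegrE; lra.
- move=> x; under eq_fun do rewrite -rmorphB csq_real.
  rewrite (_ : 0 = (\1_(cube N) x * h x - \1_(cube N) x * h x) ^+ 2 :> R); last first.
    by rewrite subrr expr0n.
  apply: (cvg_comp _ (fun y => y ^+ 2)); last exact: exprn_continuous.
  by apply: cvgB; [exact: cvg_cst|apply: cvgMl_tmp; exact: cF].
Qed.

(** The function vanishes at every point off the cube, not just almost everywhere. Fields and
    derivatives are replaced by such representatives before any transform is inverted. *)
Definition L2cube (N : R) f := [/\ cmeas f,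
  (leb3 R).-integrable setT (fun x => (csq (f x))%:E) &
  forall x, ~ cube N x -> f x = 0].

Lemma approximable_L2cube (N : R) f : 0 <= N -> L2cube N f -> approximable N f.
Proof.
move=> N0 [[mr mi] ifs fout].
(* The positive part: with [p a - p (- a) = a] it reduces a real function to two nonnegative
   ones. *)
pose p (a : R) := (`|a| + a) / 2.
have p0 a : 0 <= p a.
  by rewrite divr_ge0//; have := ler_norm (- a); rewrite normrN; lra.
have pN a : p a - p (- a) = a by rewrite /p normrN; field.
have pa a : `|p a| <= `|a|.
  rewrite ger0_norm// /p; have := ler_norm a; lra.
have ap (u : TR3 R -> R) : measurable_fun setT u ->
    (forall x, u x ^+ 2 <= csq (f x)) ->
    approximable N (fun x => (\1_(cube N) x * p (u x))%:C).
  move=> mu uf.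
  have mp : measurable_fun setT (fun x => p (u x)) by rewrite /p; mmeas.
  apply: approximable_ge0 => //.
  apply: (le_integrable _ _ _ ifs) => //.
    by apply/measurable_EFinP; exact: mf_exprn.
  move=> x _ /=; rewrite lee_fin !ger0_norm ?csq_ge0 ?sqr_ge0//.
  by rewrite (le_trans _ (uf x))// -(real_normK (num_real (p _))) -(real_normK (num_real (u x))) lerXn2r ?nnegrE.
have ap2 (u : TR3 R -> R) : measurable_fun setT u ->
    (forall x, u x ^+ 2 <= csq (f x)) ->
    approximable N (fun x => (\1_(cube N) x * u x)%:C).
  move=> mu uf.
  rewrite (_ : (fun x => _) = (fun x => (\1_(cube N) x * p (u x))%:C +
      (-1) * (\1_(cube N) x * p (- u x))%:C)).
    apply: approximableD; first exact: ap.
    apply: approximableZ; apply: (ap (fun x => - u x)); first exact: mf_opp.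
    by move=> x; rewrite sqrrN.
  apply/funext => x; rewrite mulN1r -rmorphB/= -mulrBr pN//.
rewrite (_ : f = (fun x => (\1_(cube N) x * complex.Re (f x))%:C +
    'i * (\1_(cube N) x * complex.Im (f x))%:C)).
  apply: approximableD; first by apply: ap2 => // x; rewrite /csq lerDl sqr_ge0.
  by apply: approximableZ; apply: ap2 => // x; rewrite /csq lerDr sqr_ge0.
apply/funext => x; rewrite indicE; have [xQ|xQ] := boolP (x \in cube N).
  by apply: c_ext; rewrite !cE/=; ring.
rewrite fout; last by move=> Qx; move/negP: xQ; apply; exact: mem_set.
by apply: c_ext; rewrite !cE/=; ring.
Qed.

Lemma L2cubeD N f g : L2cube N f -> L2cube N g -> L2cube N (fun x => f x + g x).
Proof.
move=> [mf jf of_] [mg jg og]; split.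
- exact: cmeasD.
- have := integrableD_EFin (integrableZl_EFin 2 jf) (integrableZl_EFin 2 jg).
  apply: le_integrable => //; first exact/measurable_EFinP/measurable_csq/cmeasD.
  move=> x _ /=; rewrite lee_fin ger0_norm ?csq_ge0//.
  by rewrite (le_trans (csqD_le _ _))// ler_norm.
- by move=> x nx; rewrite of_// og// addr0.
Qed.

Lemma L2cubeZ N (k : R[i]) f : L2cube N f -> L2cube N (fun x => k * f x).
Proof.
move=> [mf jf of_]; split.
- by apply: cmeasM => //; exact: cmeas_cst.
- have := integrableZl_EFin (csq k) jf.
  by apply: eq_integrable => // x _; rewrite csqM.
- by move=> x nx; rewrite of_// mulr0.
Qed.

Lemma L2cubeB N f g : L2cube N f -> L2cube N g -> L2cube N (fun x => f x - g x).
Proof.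
move=> lf lg; rewrite (_ : (fun x => _) = (fun x => f x + (-1) * g x)).
  by apply: L2cubeD => //; exact: L2cubeZ.
by apply/funext => x; rewrite mulN1r.
Qed.

Lemma L2cubeJ N f : L2cube N f -> L2cube N (fun x => conjc (f x)).
Proof.
move=> [mf jf of_]; split.
- exact: cmeasJ.
- by apply: eq_integrable jf => // x _; rewrite csqJ.
- by move=> x nx; rewrite of_//; apply: c_ext; rewrite !cE/= ?oppr0.
Qed.

Lemma L2cube_stepfun N f : stepfun N f -> L2cube N f.
Proof.
move=> sf; have [fi _ fs _ _] := parseval_stepfun sf sf; split.
- exact: cintegrable_meas fi.
- case: fs => + _; apply: eq_integrable => // x _.
  by rewrite mulcJ.
- by move=> x; exact: stepfun_out sf.
Qed.

(** Young's inequality $u\le k+u^2/k$ on the cube. With the free weight [k] it stands in for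
    Cauchy-Schwarz when an $L^1$ norm is bounded by an $L^2$ norm. *)
Lemma L2cube_norm_le N f k x : 0 < k -> L2cube N f ->
  Normc.normc (f x) <= k * \1_(cube N) x + csq (f x) / k.
Proof.
move=> k0 [_ _ fout]; rewrite indicE; have [xQ|xQ] := boolP (x \in cube N); last first.
  rewrite fout; last by move=> Qx; move/negP: xQ; apply; exact: mem_set.
  by rewrite mulr0 add0r cnorm_csq /csq/= expr0n addr0 mul0r sqrtr0.
rewrite mulr1 -cnorm_sqr; set u := Normc.normc _.
rewrite -subr_ge0.
have -> : k + u ^+ 2 / k - u = ((u - k / 2) ^+ 2 + 3 / 4 * k ^+ 2) / k.
  by field; exact: lt0r_neq0.
apply: divr_ge0; last exact: ltW.
by apply: addr_ge0; rewrite ?sqr_ge0// mulr_ge0 ?sqr_ge0// divr_ge0.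
Qed.

Lemma L2cube_integrable N f : L2cube N f -> cintegrable (leb3 R) f.
Proof.
move=> lf; have [mf jf _] := lf.
have := integrableD_EFin (integrable_cube N) jf.
move=> /le_cintegrable; apply => // x.
have := L2cube_norm_le x ltr01 lf.
by rewrite mul1r divr1.
Qed.

End L2_density.

(** * Plancherel's identity and truncated inversion *)

Section parseval_L2.
Variable R : realType.
Implicit Types (f g : TR3 R -> R[i]).

Lemma cvgn_EFin (u : nat -> R) (l : R) : u n @[n --> \oo] --> l ->
  ((u n)%:E @[n --> \oo] --> l%:E)%E.
Proof. by move=> ul; apply/fine_cvgP; split => //; exact: nearW. Qed.

Lemma cvgn_sqr_dist (u d : nat -> R) (l : R) : (forall n, (l - u n) ^+ 2 <= d n) ->
  d n @[n --> \oo] --> 0 -> u n @[n --> \oo] --> l.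
Proof.
move=> ud d0; apply/cvgrPdist_le => e e0.
have e2 : 0 < e ^+ 2 by rewrite exprn_gt0.
have /cvgr0Pnorm_le/(_ _ e2) := d0; apply: filterS => n dn.
rewrite -(@ler_pXn2r _ 2)// ?nnegrE ?(ltW e0)// real_normK ?num_real//.
by rewrite (le_trans (ud n))// (le_trans (ler_norm _)).
Qed.

(** Fatou's lemma with a convergent sequence of bounds instead of a single one, since the
    approximants in [bessel] satisfy only asymptotically sharp bounds. *)
Lemma fatou_le d (T : measurableType d) (m : {measure set T -> \bar R})
    (u : nat -> T -> R) (v : T -> R) (b : nat -> R) (B : R) :
  (forall n, measurable_fun setT (u n)) -> (forall n x, 0 <= u n x) ->
  (forall x, u n x @[n --> \oo] --> v x) ->
  (forall n, (\int[m]_x (u n x)%:E <= (b n)%:E)%E) -> b n @[n --> \oo] --> B ->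
  (\int[m]_x (v x)%:E <= B%:E)%E.
Proof.
move=> mu u0 uv ub bB.
have muE n : measurable_fun setT (fun x => (u n x)%:E) by exact/measurable_EFinP.
have := @fatou _ _ _ m setT measurableT (fun n x => (u n x)%:E) muE.
move=> /(_ (fun n x _ => ltac:(rewrite lee_fin; exact: u0))).
have -> : (\int[m]_x limn_einf (fun n => (u n x)%:E) = \int[m]_x (v x)%:E)%E.
  apply: eq_integral => x _.
  by have [-> _] := cvg_limn_einf_sup (cvgn_EFin (uv x)).
move=> /le_trans; apply; rewrite limn_einf_lim.
have bE := cvgn_EFin bB.
rewrite -(cvg_lim _ bE)//; apply: lee_lim; [exact: is_cvg_einfs|exact: cvgP bE|].
apply: nearW => n; rewrite (le_trans _ (ub n))//; apply: ereal_inf_lbound.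
by exists n => /=.
Qed.

Lemma RintegralE (h : TR3 R -> R) : (leb3 R).-integrable setT (fun x => (h x)%:E) ->
  (\int[leb3 R]_x (h x)%:E)%E = (\int[leb3 R]_x h x)%:E.
Proof. by move=> ih; rewrite /Rintegral fineK//; exact: integrable_fin_num. Qed.

Lemma parseval_norm f : parseval f f ->
  (leb3 R).-integrable setT (fun x => (csq (fourier f x))%:E) /\
  \int[leb3 R]_x csq (fourier f x) = (2 * pi) ^+ 3 * \int[leb3 R]_x csq (f x).
Proof.
move=> [_ _ i3 [i4 _] e]; have E (z : R[i]) : complex.Re (z * conjc z) = csq z.
  by rewrite mulcJ.
split; first by apply: eq_integrable i4 => // x _; rewrite E.
have /(congr1 (@complex.Re R)) := e; rewrite cReZ => e'.
transitivity (complex.Re (cint (leb3 R) setT (fun x => fourier f x * conjc (fourier f x)))).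
  by apply: eq_Rintegral => x _; rewrite E.
rewrite e'; congr (_ * _).
by apply: eq_Rintegral => x _; rewrite E.
Qed.

Lemma sqdist_Rintegral N f g : L2cube N f -> L2cube N g ->
  sqdist f g = (\int[leb3 R]_x csq (f x - g x))%:E.
Proof. by move=> lf lg; apply: RintegralE; have [] := L2cubeB lf lg. Qed.

(** A bound uniform in [xi]. If the squared norm of [f] is at most $k^2$, it is of order $k^2$, so
    $L^2$ convergence on a fixed cube forces pointwise convergence of transforms. *)
Lemma csq_fourier_le N f k xi : 0 < k -> L2cube N f ->
  csq (fourier f xi) <=
  (2 * (k * \int[leb3 R]_x \1_(cube N) x + (\int[leb3 R]_x csq (f x)) / k)) ^+ 2.
Proof.
move=> k0 lf; have fi := L2cube_integrable lf; have [mf jf _] := lf.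
have iQ := integrable_cube N.
have cfi := cintegrable_fourier xi fi.
rewrite -cnorm_sqr; apply: lerXn2r; rewrite ?nnegrE ?cnorm_ge0//.
  rewrite mulr_ge0// addr_ge0// ?mulr_ge0 ?invr_ge0 ?(ltW k0)// Rintegral_ge0// => x _.
  exact: csq_ge0.
rewrite (le_trans (cnorm_cint_le cfi))// ler_pM2l//.
have iB := integrableD_EFin (integrableZl_EFin k iQ) (integrableZl_EFin k^-1 jf).
apply: (@le_trans _ _ (\int[leb3 R]_x (k * \1_(cube N) x + k^-1 * csq (f x)))).
  apply: le_Rintegral => //; first exact: cintegrable_norm.
  move=> x _; rewrite cnormM cnorm_cis mul1r.
  by rewrite [k^-1 * _]mulrC; exact: L2cube_norm_le lf.
rewrite RintegralD//; try exact: integrableZl_EFin.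
by rewrite !RintegralZl// [k^-1 * _]mulrC.
Qed.

(** Step functions converging to [f] satisfy the identity and their transforms converge pointwise,
    but Fatou's lemma preserves only one inequality. The other one is recovered in
    [parseval_L2cube]. *)
Lemma bessel N f : 0 <= N -> L2cube N f ->
  (leb3 R).-integrable setT (fun x => (csq (fourier f x))%:E) /\
  \int[leb3 R]_x csq (fourier f x) <= (2 * pi) ^+ 3 * \int[leb3 R]_x csq (f x).
Proof.
move=> N0 lf; have [mf jf fout] := lf.
have [_ af] := approximable_L2cube N0 lf.
set q := \int[leb3 R]_x csq (f x).
have c0 : 0 <= (2 * pi) ^+ 3 :> R by rewrite exprn_ge0// mulr_ge0// pi_ge0.
have [s hs] : {s : nat -> TR3 R -> R[i] & forall n, stepfun N (s n) /\
    (sqdist f (s n) <= (harmonic n ^+ 2)%:E)%E}.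
  apply: (@choice _ _ (fun n s => stepfun N s /\
    (sqdist f s <= (harmonic n ^+ 2)%:E)%E)) => n; have [|s ss fs] := af (harmonic n ^+ 2).
    by rewrite exprn_gt0// harmonic_gt0.
  by exists s.
have ss n := (hs n).1; have ls n := L2cube_stepfun (ss n).
have ds n : \int[leb3 R]_x csq (f x - s n x) <= harmonic n ^+ 2.
  by rewrite -lee_fin -(sqdist_Rintegral lf (ls n)); exact: (hs n).2.
have [pn ps] : (forall n, (leb3 R).-integrable setT (fun x => (csq (fourier (s n) x))%:E)) /\
   forall n, \int[leb3 R]_x csq (fourier (s n) x) = (2 * pi) ^+ 3 * \int[leb3 R]_x csq (s n x).
  by split=> n; have [] := parseval_norm (parseval_stepfun (ss n) (ss n)).
(* The weight in [csqD_leW] is [harmonic n]: the large coefficient $1+1/h$ meets an error of at most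
   $h^2$, so the bound still tends to [q]. *)
have qs n : \int[leb3 R]_x csq (s n x) <= (1 + harmonic n) * q + (harmonic n ^+ 2 + harmonic n).
  have h0 : 0 < harmonic n :> R by exact: harmonic_gt0.
  have jb : (leb3 R).-integrable setT (fun x => (csq (f x - s n x))%:E).
    by have [] := L2cubeB lf (ls n).
  have js : (leb3 R).-integrable setT (fun x => (csq (s n x))%:E) by have [] := ls n.
  apply: (@le_trans _ _ (\int[leb3 R]_x ((1 + harmonic n) * csq (f x) +
      (1 + (harmonic n)^-1) * csq (f x - s n x)))).
    apply: le_Rintegral => //.
      exact: integrableD_EFin (integrableZl_EFin _ jf) (integrableZl_EFin _ jb).
    move=> x _; have := csqD_leW (f x) (s n x - f x) h0.
    by rewrite addrCA subrr addr0 -[csq (s n x - f x)]csqN opprB.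
  rewrite RintegralD//; try exact: integrableZl_EFin.
  rewrite !RintegralZl// lerD2l.
  apply: (@le_trans _ _ ((1 + (harmonic n)^-1) * harmonic n ^+ 2)).
    by rewrite ler_wpM2l// addr_ge0// invr_ge0 ltW.
  rewrite mulrDl mul1r lerD2l expr2 mulrA mulVf ?mul1r//; exact: lt0r_neq0.
have h0 : @harmonic R n @[n --> \oo] --> 0 by exact: cvg_harmonic.
have h2 : @harmonic R n ^+ 2 @[n --> \oo] --> 0.
  rewrite [X in _ --> X](_ : _ = 0 ^+ 2 :> R); last by rewrite expr0n.
  by apply: (cvg_comp _ (fun y => y ^+ 2) h0); exact: exprn_continuous.
have cb : (2 * pi) ^+ 3 * ((1 + harmonic n) * q + (harmonic n ^+ 2 + harmonic n))
    @[n --> \oo] --> (2 * pi) ^+ 3 * q.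
  rewrite [X in _ --> X](_ : _ = (2 * pi) ^+ 3 * ((1 + 0) * q + (0 + 0))); last by ring.
  apply: cvgMl_tmp; apply: cvgD; last exact: cvgD.
  by apply: cvgMr_tmp; apply: cvgD; [exact: cvg_cst|].
have mF n : measurable_fun setT (fun x => csq (fourier (s n) x)).
  by apply/measurable_csq/cmeas_fourier; case: (ls n).
have le : (\int[leb3 R]_x (csq (fourier f x))%:E <= ((2 * pi) ^+ 3 * q)%:E)%E.
  apply: (@fatou_le _ _ (leb3 R) (fun n x => csq (fourier (s n) x)) (fun x => csq (fourier f x)) _ _ mF _ _ _ cb).
  - by move=> n x; exact: csq_ge0.
  - move=> xi.
    have di n : fourier (fun x => f x - s n x) xi = fourier f xi - fourier (s n) xi.
      rewrite (_ : (fun x => _) = (fun x => f x + (-1) * s n x)); last first.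
        by apply/funext => x; rewrite mulN1r.
      have fi := L2cube_integrable lf; have si := L2cube_integrable (ls n).
      by rewrite fourierD//; [rewrite fourierZ// mulN1r|exact: cintegrableZ].
    pose A : R := \int[leb3 R]_x \1_(cube N) x.
    (* The weight [k := harmonic n] balances both terms of [csq_fourier_le], as the squared distance
       is at most [harmonic n ^+ 2]. *)
    have dle n : csq (fourier f xi - fourier (s n) xi) <= (2 * (harmonic n * A + harmonic n)) ^+ 2.
      have hp : 0 < harmonic n :> R by exact: harmonic_gt0.
      rewrite -di (le_trans (csq_fourier_le _ hp (L2cubeB lf (ls n))))//.
      have A0 : 0 <= A by apply: Rintegral_ge0.
      apply: lerXn2r; rewrite ?nnegrE ?mulr_ge0 ?addr_ge0 ?mulr_ge0 ?invr_ge0 ?(ltW hp)//.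
        by apply: Rintegral_ge0 => x _; exact: csq_ge0.
      rewrite ler_pM2l// lerD2l ler_pdivrMr// -expr2; exact: ds.
    have dl : csq (fourier f xi - fourier (s n) xi) @[n --> \oo] --> 0.
      apply: (squeeze_cvgr _ (cvg_cst 0)); last first.
        have : (2 * (harmonic n * A + harmonic n)) ^+ 2 @[n --> \oo] --> (2 * (0 * A + 0)) ^+ 2.
          apply: (cvg_comp _ (fun y => y ^+ 2)); last exact: exprn_continuous.
          by apply: cvgMl_tmp; apply: cvgD => //; exact: cvgMr_tmp.
        by rewrite mul0r addr0 mulr0 expr0n; exact.
      by apply: nearW => n; rewrite csq_ge0 dle.
    have dre : complex.Re (fourier (s n) xi) @[n --> \oo] --> complex.Re (fourier f xi).
      by apply: (cvgn_sqr_dist _ dl) => n; rewrite -cReN -cReD /csq lerDl sqr_ge0.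
    have dim : complex.Im (fourier (s n) xi) @[n --> \oo] --> complex.Im (fourier f xi).
      by apply: (cvgn_sqr_dist _ dl) => n; rewrite -cImN -cImD /csq lerDr sqr_ge0.
    by apply: cvgD; apply: (cvg_comp _ (fun y => y ^+ 2)); (try exact: exprn_continuous).
  - by move=> n; rewrite RintegralE// lee_fin ps ler_wpM2l.
have fi : (leb3 R).-integrable setT (fun x => (csq (fourier f x))%:E).
  apply/integrableP; split.
    by apply/measurable_EFinP/measurable_csq/cmeas_fourier.
  apply: (@le_lt_trans _ _ ((2 * pi) ^+ 3 * q)%:E); last exact: ltry.
  apply: le_trans le; rewrite le_eqVlt; apply/orP; left; apply/eqP.
  by apply: eq_integral => x _; rewrite /= ger0_norm ?csq_ge0.
by split=> //; rewrite -lee_fin -RintegralE.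
Qed.

(** The lower-case letters [a], [b], [d], [s] stand for the squared norms of [f], [f - 2s], [f - s]
    and [s], the capitals for those of the transforms. Then $ca = 2cd+2S-cb \le 2cd+2S-B = 2cd+A-2D
    \le A+e$. *)
Lemma parallelogram_le (c a b d s A B D S e : R) :
  a + b = 2 * d + 2 * s -> A + B = 2 * D + 2 * S -> S = c * s -> B <= c * b ->
  0 <= D -> 0 <= d -> (2 * c + 1) * d <= e -> c * a <= A + e.
Proof.
move=> h1 h2 hS hB D0 d0 hd.
have h1' : c * a + c * b = 2 * (c * d) + 2 * (c * s).
  by rewrite -mulrDr h1; ring.
have hd' : 2 * (c * d) + d <= e by apply: le_trans hd; rewrite le_eqVlt; apply/orP; left; apply/eqP; ring.
lra.
Qed.

(** Bessel's inequality for [f - 2s] bounds from above what the parallelogram identity subtracts. As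
    the identity is exact for the step function [s], this turns into the reverse inequality for [f],
    up to an error controlled by [f - s]. *)
Theorem parseval_L2cube N f : 0 <= N -> L2cube N f ->
  (leb3 R).-integrable setT (fun x => (csq (fourier f x))%:E) /\
  \int[leb3 R]_x csq (fourier f x) = (2 * pi) ^+ 3 * \int[leb3 R]_x csq (f x).
Proof.
move=> N0 lf; have [fi fle] := bessel N0 lf; split => //.
set c := (2 * pi) ^+ 3 in fle *.
have c0 : 0 <= c by rewrite exprn_ge0// mulr_ge0// pi_ge0.
apply/eqP; rewrite eq_le fle/=; apply/ler_addgt0Pr => e e0.
have [_ af] := approximable_L2cube N0 lf.
(* The error is [2 * c] times the squared norm of [f - s]; the extra 1 keeps the divisor
   positive. *)
have ec : 0 < e / (2 * c + 1) by rewrite divr_gt0// ltr_wpDl// mulr_ge0.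
have [s ss] := af _ ec; have ls := L2cube_stepfun ss.
rewrite (sqdist_Rintegral lf ls) lee_fin => fs.
have lfs := L2cubeB lf ls; have lfss := L2cubeB lfs ls.
have [_ eqs] := parseval_norm (parseval_stepfun ss ss).
have [_ le1] := bessel N0 lfs; have [_ le2] := bessel N0 lfss.
pose q g := \int[leb3 R]_x csq (g x).
(* The parallelogram identity applied to [f - s] and [s]. *)
have para (u v w : TR3 R -> R[i]) : (forall x, u x = w x + v x) ->
    (leb3 R).-integrable setT (fun x => (csq (u x))%:E) ->
    (leb3 R).-integrable setT (fun x => (csq (v x))%:E) ->
    (leb3 R).-integrable setT (fun x => (csq (w x))%:E) ->
    (leb3 R).-integrable setT (fun x => (csq (w x - v x))%:E) ->
    q u + q (fun x => w x - v x) = 2 * q w + 2 * q v.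
  move=> uwv iu iv iw id; rewrite /q -RintegralD//.
  rewrite -!RintegralZl// -RintegralD//; try exact: integrableZl_EFin.
  by apply: eq_Rintegral => x _; rewrite uwv csq_parallelogram.
have i1 : (leb3 R).-integrable setT (fun x => (csq (f x))%:E) by case: lf.
have i2 : (leb3 R).-integrable setT (fun x => (csq (s x))%:E) by case: ls.
have i3 : (leb3 R).-integrable setT (fun x => (csq (f x - s x))%:E) by case: lfs.
have i4 : (leb3 R).-integrable setT (fun x => (csq (f x - s x - s x))%:E) by case: lfss.
have p1 := para f s (fun x => f x - s x) (fun x => ltac:(by rewrite subrK)) i1 i2 i3 i4.
have B g : L2cube N g -> (leb3 R).-integrable setT (fun x => (csq (fourier g x))%:E).
  by move=> lg; have [] := bessel N0 lg.
have subF (u v : TR3 R -> R[i]) : L2cube N u -> L2cube N v ->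
    forall x, fourier (fun x => u x - v x) x = fourier u x - fourier v x.
  move=> lu lv x; rewrite (_ : (fun x => _) = (fun x => u x + (-1) * v x)); last first.
    by apply/funext => y; rewrite mulN1r.
  have ui := L2cube_integrable lu; have vi := L2cube_integrable lv.
  by rewrite fourierD//; [rewrite fourierZ// mulN1r|exact: cintegrableZ].
have E1 := subF _ _ lf ls.
have E2 x : fourier (fun x => f x - s x - s x) x =
    fourier (fun x => f x - s x) x - fourier s x by rewrite (subF _ _ lfs ls).
have i5 : (leb3 R).-integrable setT
    (fun x => (csq (fourier (fun x => f x - s x) x - fourier s x))%:E).
  by apply: eq_integrable (B _ lfss) => // x _; rewrite E2.
have p2 := para (fourier f) (fourier s) (fourier (fun x => f x - s x))
  (fun x => ltac:(by rewrite E1 subrK)) (B _ lf) (B _ ls) (B _ lfs) i5.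
have e3 : q (fun x => fourier (fun x => f x - s x) x - fourier s x) =
    q (fourier (fun x => f x - s x - s x)).
  by apply: eq_Rintegral => x _; rewrite E2.
rewrite e3 in p2.
rewrite -/(q _) -/(q _) in fs le1 le2 eqs *.
have h1 : 0 <= q (fourier (fun x => f x - s x)).
  by apply: Rintegral_ge0 => x _; exact: csq_ge0.
have h2 : (2 * c + 1) * q (fun x => f x - s x) <= e.
  by rewrite mulrC -ler_pdivlMr// ltr_wpDl// mulr_ge0.
have h3 : 0 <= q (fun x => f x - s x).
  by apply: Rintegral_ge0 => x _; exact: csq_ge0.
exact: (parallelogram_le p1 p2 eqs le2 h1 h3 h2).
Qed.

End parseval_L2.

(** * Truncated Fourier inversion *)

Section inversion.
Variable R : realType.
Variables (N : R) (g : TR3 R -> R[i]).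
Hypotheses (N0 : 0 <= N) (lg : L2cube N g).

Definition ball3 (r : R) : set (TR3 R) := [set x | dot x x < r ^+ 2].

Lemma measurable_ball3 r : measurable (ball3 r).
Proof.
have m : measurable_fun setT (fun x : TR3 R => dot x x).
  by apply: measurable_dot; exact: mf_id.
rewrite (_ : ball3 r = setT `&` (fun x : TR3 R => dot x x) @^-1` [set` `]-oo, r ^+ 2[]).
  exact: (m measurableT _ (measurable_itv _)).
by rewrite setTI; apply/seteqP; split => x; rewrite /= in_itv.
Qed.

Lemma ball3_cube r : 0 <= r -> ball3 r `<=` cube r.
Proof.
move=> r0 x; rewrite /ball3/= dotE -!expr2 => h.
have s1 := sqr_ge0 x.1.1; have s2 := sqr_ge0 x.1.2; have s3 := sqr_ge0 x.2.
have lt a : a ^+ 2 < r ^+ 2 -> (- r < a <= r).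
  move=> ar; suff : `|a| < r by rewrite ltr_norml => /andP[-> /ltW].
  by rewrite -(@ltr_pXn2r _ 2)// ?nnegrE// real_normK ?num_real.
by split; [split|]; rewrite /= in_itv/=; apply: lt; lra.
Qed.

Definition cut_fourier r (xi : TR3 R) : R[i] := (\1_(ball3 r) xi)%:C * fourier g xi.

Definition partial_inverse r (z : TR3 R) : R[i] :=
  (((2 * pi) ^+ 3)^-1)%:C * cint (leb3 R) setT (fun xi => cis (dot xi z) * cut_fourier r xi).

Let c : R := (2 * pi) ^+ 3.

Let c0 : 0 < c.
Proof. by rewrite exprn_gt0// mulr_gt0// pi_gt0. Qed.

Let q (f : TR3 R -> R[i]) := \int[leb3 R]_x csq (f x).

Lemma cmeas_cut_fourier r : cmeas (cut_fourier r).
Proof.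
have [mg _ _] := lg; apply: cmeasM; last exact: cmeas_fourier.
by apply/cmeasR/mf_indic; exact: measurable_ball3.
Qed.

Lemma csq_cut_fourier r xi : csq (cut_fourier r xi) = \1_(ball3 r) xi * csq (fourier g xi).
Proof.
rewrite csqM csq_real indicE; case: (_ \in _); rewrite ?expr1n ?expr0n//.
Qed.

(** A ball of radius [r] lies in the cube of half-side [r], so the truncated transform belongs to
    the class for which Parseval is known. *)
Lemma L2cube_cut_fourier r : 0 <= r -> L2cube r (cut_fourier r).
Proof.
move=> r0; have [ig _] := parseval_L2cube N0 lg; split.
- exact: cmeas_cut_fourier.
- apply: (le_integrable _ _ _ ig) => //.
    by apply/measurable_EFinP/measurable_csq; exact: cmeas_cut_fourier.
  move=> x _ /=; rewrite lee_fin csq_cut_fourier !ger0_norm ?csq_ge0 ?mulr_ge0 ?csq_ge0//.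
  by rewrite ler_piMl ?csq_ge0// indicE; case: (_ \in _).
- move=> x nx; rewrite /cut_fourier indicE memNset ?mul0r//.
  by move=> /(ball3_cube r0).
Qed.

(** The inverse integral is written through the forward transform of the conjugate, so that Parseval
    needs no version for the inverse. *)
Lemma partial_inverse_conj r z : 0 <= r -> partial_inverse r z =
  (c^-1)%:C * conjc (fourier (fun xi => conjc (cut_fourier r xi)) z).
Proof.
move=> r0; have li := L2cube_integrable (L2cubeJ (L2cube_cut_fourier r0)).
rewrite /partial_inverse -cintJ; last exact: cintegrable_fourier.
by congr (_ * cint _ _ _); apply/funext => xi; rewrite cjM cjK cisN cjK.
Qed.

Lemma csq_partial_inverse r z : 0 <= r -> csq (partial_inverse r z) =
  c ^- 2 * csq (fourier (fun xi => conjc (cut_fourier r xi)) z).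
Proof. by move=> r0; rewrite partial_inverse_conj// csqM csqJ csq_real exprVn. Qed.

Lemma L2_partial_inverse r : 0 <= r -> [/\ cmeas (partial_inverse r),
  (leb3 R).-integrable setT (fun z => (csq (partial_inverse r z))%:E) &
  q (partial_inverse r) = c^-1 * q (cut_fourier r)].
Proof.
move=> r0; have lc := L2cubeJ (L2cube_cut_fourier r0); have [mc _ _] := lc.
have [iF eF] := parseval_L2cube r0 lc; split.
- rewrite (_ : partial_inverse r = fun z =>
    (c^-1)%:C * conjc (fourier (fun xi => conjc (cut_fourier r xi)) z)).
    by apply: cmeasM; [exact: cmeas_cst|apply: cmeasJ; exact: cmeas_fourier].
  by apply/funext => z; exact: partial_inverse_conj.
- have := integrableZl_EFin (c ^- 2) iF.
  by apply: eq_integrable => // z _; rewrite csq_partial_inverse.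
- rewrite /q (_ : (fun _ => _) = fun z =>
    c ^- 2 * csq (fourier (fun xi => conjc (cut_fourier r xi)) z)); last first.
    by apply/funext => z; rewrite csq_partial_inverse.
  rewrite RintegralZl// eF -/c mulrA; congr (_ * _).
    by field; exact: lt0r_neq0.
  by apply: eq_Rintegral => x _; rewrite csqJ.
Qed.

(** Fubini moves the exponential onto the conjugate of [g], where it produces the conjugate of the
    transform of [g]; against the cut transform this leaves its squared modulus. *)
Lemma partial_inverse_inner r : 0 <= r ->
  cintegrable (leb3 R) (fun z => partial_inverse r z * conjc (g z)) /\
  complex.Re (cint (leb3 R) setT (fun z => partial_inverse r z * conjc (g z))) =
  c^-1 * q (cut_fourier r).
Proof.
move=> r0; have lc := L2cube_cut_fourier r0; have lgJ := L2cubeJ lg.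
have ic := L2cube_integrable lc; have ig := L2cube_integrable lgJ.
pose U (w : TR3 R * TR3 R) := cis (dot w.2 w.1).
have mU : cmeas U by apply/cmeas_cis/measurable_dot; [exact: measurable_snd|exact: measurable_fst].
have [i1 e1] := cint_swap mU (fun w => cnorm_cis _) ig ic.
pose F z := cint (leb3 R) setT (fun w => U (z, w) * (conjc (g z) * cut_fourier r w)).
have {}i1 : cintegrable (leb3 R) F by exact: i1.
have {}e1 : cint (leb3 R) setT F =
  cint (leb3 R) setT (fun w => cint (leb3 R) setT
    (fun z => U (z, w) * (conjc (g z) * cut_fourier r w))) by exact: e1.
have E1 : (fun z => partial_inverse r z * conjc (g z)) = (fun z => (c^-1)%:C * F z).
  apply/funext => z; rewrite /partial_inverse -mulrA; congr (_ * _).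
  have iz : cintegrable (leb3 R) (fun xi => cis (dot xi z) * cut_fourier r xi).
    apply: (@cintegrable_unimodular _ _ _ (leb3 R) (fun xi => cis (dot xi z)) (cut_fourier r)).
    - by apply/cmeas_cis/measurable_dot; [exact: mf_id|exact: measurable_cst].
    - by move=> x; exact: cnorm_cis.
    - exact: ic.
  rewrite [LHS]mulrC -(cintZ _ iz) /F; congr cint; apply/funext => xi.
  exact: mulrCA.
have E2 : (fun w => cint (leb3 R) setT (fun z => U (z, w) * (conjc (g z) * cut_fourier r w))) =
    (fun w => (csq (cut_fourier r w))%:C).
  apply/funext => w.
  have iz := cintegrable_fourier w (L2cube_integrable lg).
  rewrite (_ : (fun z => _) = fun z => cut_fourier r w * conjc (cis (- dot z w) * g z)).
    transitivity (cut_fourier r w * conjc (fourier g w)).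
      rewrite (cintZ _ (cintegrableJ iz)).
      exact: (congr1 (fun t => cut_fourier r w * t) (cintJ iz)).
    by rewrite csq_cut_fourier /cut_fourier -mulrA mulcJ -rmorphM.
  apply/funext => z; rewrite cjM -cisN opprK /U/= (_ : dot w z = dot z w).
    by rewrite mulrCA mulrA mulrC [conjc (g z) * _]mulrC.
  by rewrite !dotE [w.1.1 * _]mulrC [w.1.2 * _]mulrC [w.2 * _]mulrC.
rewrite E1; split; first exact: (cintegrableZ _ i1).
rewrite (cintZ _ i1) cReZ e1 E2; congr (_ * _).
Qed.

(** The square of the difference is expanded. The squared norm of the partial inverse and its inner
    product with [g] have the same value, so one of the two subtracted copies cancels. *)
Lemma partial_inverse_dist r : 0 <= r ->
  [/\ (leb3 R).-integrable setT (fun z => (csq (partial_inverse r z - g z))%:E) &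
  q (fun z => partial_inverse r z - g z) = q g - c^-1 * q (cut_fourier r)].
Proof.
move=> r0; have [mS iS eS] := L2_partial_inverse r0.
have [[iR _] eR] := partial_inverse_inner r0; have [mg jg _] := lg.
have E z : csq (partial_inverse r z - g z) = csq (partial_inverse r z) + csq (g z) +
    (-2) * complex.Re (partial_inverse r z * conjc (g z)).
  by rewrite /csq !cE; ring.
have i1 := integrableD_EFin iS jg; have i2 := integrableZl_EFin (-2) iR.
split.
  by have := integrableD_EFin i1 i2; apply: eq_integrable => // z _; rewrite E.
rewrite /q (_ : (fun _ => _) = fun z => csq (partial_inverse r z) + csq (g z) +
    (-2) * complex.Re (partial_inverse r z * conjc (g z))); last by apply/funext.
rewrite RintegralD// RintegralD// RintegralZl// -/(q _) eS.
by rewrite [X in _ + -2 * X]eR /q; ring.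
Qed.

(** Dominated convergence is applied along integer radii; the energy in a ball grows with the
    radius, which carries the bound to all larger real radii. *)
Lemma cut_fourier_cvg e : 0 < e -> exists M, forall r, M < r -> 0 <= r ->
  c * q g - e <= q (cut_fourier r).
Proof.
move=> e0; have [ig eg] := parseval_L2cube N0 lg; have [mg _ _] := lg.
have mF : cmeas (fourier g) by exact: cmeas_fourier.
have m1 n : measurable_fun setT (fun x => (csq (cut_fourier n%:R x))%:E).
  by apply/measurable_EFinP/measurable_csq; exact: cmeas_cut_fourier.
have m2 : measurable_fun setT (fun x => (csq (fourier g x))%:E).
  exact/measurable_EFinP/measurable_csq.
have [] := @dominated_convergence _ _ _ (leb3 R) setT measurableT
  (fun n x => (csq (cut_fourier n%:R x))%:E) (fun x => (csq (fourier g x))%:E)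
  (fun x => (csq (fourier g x))%:E) m1 m2.
- apply: aeW => x _; apply: cvg_near_cst.
  (* The integer exceeds the squared length of [x]; from [n] on, $|x|^2 < n \le k \le k^2$ puts [x]
     in the ball of radius [k]. *)
  have [n hn] : exists n : nat, dot x x < n%:R.
    by exists (Num.bound (dot x x)); rewrite archi_boundP// dotE !addr_ge0// -expr2 sqr_ge0.
  exists n => // k /= nk; rewrite csq_cut_fourier indicE mem_set ?mul1r//.
  rewrite /ball3/= (lt_le_trans hn)// -natrX ler_nat (leq_trans nk)//.
  by case: k {nk} => // k; rewrite leq_pmulr.
- exact: ig.
- apply: aeW => x n _; rewrite /= lee_fin csq_cut_fourier ger0_norm ?mulr_ge0 ?csq_ge0//.
  by rewrite ler_piMl ?csq_ge0// indicE; case: (_ \in _).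
move=> _ _; have li n : L2cube n%:R (cut_fourier n%:R) by exact: L2cube_cut_fourier.
have -> : (\int[leb3 R]_x (csq (fourier g x))%:E = (c * q g)%:E)%E by rewrite RintegralE// eg.
move=> /fine_cvgP[_] /cvgrPdist_le/(_ _ e0)[n _ /(_ _ (leqnn n))]/= h.
exists n%:R => r nr r0; have := le_trans (ler_norm _) h.
rewrite lerBlDr -lerBlDl => /le_trans; apply.
apply: le_Rintegral => //.
- by have [] := li n.
- by have [] := L2cube_cut_fourier r0.
move=> x _; rewrite !csq_cut_fourier ler_wpM2r ?csq_ge0// !indicE.
have [xn|] := boolP (x \in ball3 n%:R); last by rewrite ler0n.
rewrite mem_set//; move/set_mem : xn; rewrite /ball3/= => /lt_le_trans; apply.
by apply: lerXn2r; rewrite ?nnegrE// ltW.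
Qed.

Theorem partial_inverse_cvg e : 0 < e -> exists M, forall r, M < r -> 0 <= r ->
  (sqdist (partial_inverse r) g <= e%:E)%E.
Proof.
move=> e0; have ec : 0 < c * e by rewrite mulr_gt0.
have [M h] := cut_fourier_cvg ec; exists M => r Mr r0.
have [i e1] := partial_inverse_dist r0.
rewrite /sqdist RintegralE// lee_fin [leLHS]e1 lerBlDr -lerBlDl.
by rewrite -(@ler_pM2l _ c)// mulrA mulfV ?lt0r_neq0// mul1r mulrBr; exact: h.
Qed.

End inversion.

(** * Spherical coordinates *)

Section change_of_variables.
Variable R : realType.
Local Open Scope ereal_scope.

(* The measure [w dt] on [D], pushed forward by [phi], is the image of planar
   Lebesgue measure on the region under the graph of [w]. *)
Lemma change_variables (D : set (TR R)) (phi w : TR R -> TR R) (h : TR R -> \bar R) :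
  measurable D -> measurable_fun setT phi -> measurable_fun setT w ->
  (forall t, D t -> (0 <= w t)%R) ->
  (forall a b : R, (a < b)%R ->
    \int[leb R]_(t in D) ((\1_(`]a, b]%classic) (phi t) * w t)%R)%:E = (b - a)%:E) ->
  measurable_fun setT h -> (forall x, 0 <= h x) ->
  \int[leb R]_(t in D) (h (phi t) * (w t)%:E) = \int[leb R]_x h x.
Proof.
move=> mD mphi mw w0 hab mh h0.
pose G : set (TR2 R) := [set z | D z.1 /\ (0 <= z.2 < w z.1)%R].
have mG : measurable G.
  rewrite (_ : G = (D `*` setT) `&` ((fun z : TR2 R => z.2) @^-1` [set` `[0%R, +oo[] `&`
      (fun z : TR2 R => (w z.1 - z.2)%R) @^-1` [set` `]0%R, +oo[])).
    apply: measurableI; first exact: measurableX.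
    have m1 : measurable_fun setT (fun z : TR2 R => z.2) by exact: measurable_snd.
    have m2 : measurable_fun setT (fun z : TR2 R => (w z.1 - z.2)%R).
      apply: mf_add; first exact: (measurableT_comp mw measurable_fst).
      by apply: mf_opp.
    apply: measurableI.
      by rewrite -[X in measurable X]setTI; apply: m1 => //; exact: measurable_itv.
    by rewrite -[X in measurable X]setTI; apply: m2 => //; exact: measurable_itv.
  apply/seteqP; split => z; rewrite /G/= !in_itv/= !andbT subr_gt0.
    by move=> [Dz /andP[-> ->]].
  by move=> [[Dz _] [-> ->]].
have mphi1 : measurable_fun setT (fun z : TR2 R => phi z.1).
  exact: (measurableT_comp mphi measurable_fst).
pose m := mrestr (leb2 R) mG.
have mcG : measurable (~` G) by exact: measurableC.
(* The section of [G] over [t] is [[0, w t[], of length [w t]; Tonelli thus converts the integral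
   over [G] into the weighted one. *)
have key (k : TR R -> \bar R) : measurable_fun setT k -> (forall x, 0 <= k x) ->
    \int[leb R]_(t in D) (k (phi t) * (w t)%:E) =
    \int[pushforward m (fun z : TR2 R => phi z.1)]_x k x.
  move=> mk k0; have mk1 : measurable_fun setT (fun z : TR2 R => k (phi z.1)).
    exact: (measurableT_comp mk mphi1).
  rewrite [RHS](ge0_integral_pushforward mphi1 m measurableT mk); last by move=> y _; exact: k0.
  rewrite preimage_setT.
  have mG0 : m (~` G) = 0 by rewrite /m /= /mrestr setICl measure0.
  have -> : \int[m]_x (k \o (fun z : TR2 R => phi z.1)) x =
      \int[m]_(x in setT `\` (~` G)) (k \o (fun z : TR2 R => phi z.1)) x.
    by apply: ge0_negligible_integral => // x _; exact: k0.
  rewrite setTD setCK.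
  have -> : \int[m]_(x in G) (k \o (fun z : TR2 R => phi z.1)) x =
      \int[leb2 R]_(x in G) (k (phi x.1)).
    by apply: eq_measure_integral => A mA AG; rewrite /m /= /mrestr (setIidl AG).
  rewrite [RHS]integral_mkcond.
  rewrite [RHS](@fubini_tonelli1 _ _ _ _ _ (leb R) (leb R)); last 2 first.
  - by apply/(measurable_restrictT _ _).1 => //; exact: measurable_funTS.
  - by move=> z; rewrite /patch; case: ifPn => // _; exact: k0.
  rewrite [LHS]integral_mkcond; apply: eq_integral => t _; rewrite /fubini_F.
  rewrite /patch; case: ifPn => tD; last first.
    rewrite integral0_eq// => y _; case: ifPn => // /set_mem[/= Dt _].
    by move/negP : tD; case; exact: mem_set.
  have Dt := set_mem tD.
  transitivity (\int[leb R]_(y in [set` `[0%R, w t[]) (cst (k (phi t)) y)).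
    rewrite integral_cst; last exact: measurable_itv.
    have := lebesgue_measure_itv `[0%R, w t[; rewrite /= lte_fin => e.
    congr (_ * _); apply: esym; apply: etrans; first exact: e.
    have := w0 _ Dt; rewrite le_eqVlt => /orP[/eqP <-|->]; first by rewrite ltxx.
    by rewrite oppr0 adde0.
  rewrite [LHS]integral_mkcond; apply: eq_integral => y _; rewrite /patch/=.
  congr (if _ then _ else _).
  apply/idP/idP => [/set_mem|/set_mem[_ /=]]; rewrite /= ?in_itv/= => yw.
    by apply/mem_set.
  by apply/mem_set; rewrite /= in_itv.
(* Uniqueness of Lebesgue measure: the image measure needs to be identified on intervals []a, b]]
   only, which is the hypothesis; the intervals with $b\le a$ are empty. *)
rewrite (key h mh h0); apply: eq_measure_integral => A mA _; apply/esym.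
apply: lebesgue_measure_unique => // _ [[a b] _ <-]; rewrite /=.
have mI : measurable (`]a, b]%classic : set (TR R)) by exact: measurable_itv.
have mi : measurable_fun setT (fun x : TR R => (\1_(`]a, b]%classic) x : R)%:E).
  by apply: mf_EFin; exact: mf_indic.
have i0 (x : TR R) : 0 <= (\1_(`]a, b]%classic) x : R)%:E by rewrite lee_fin.
have := key _ mi i0.
rewrite integral_indic// setIT => <-; rewrite [LHS]lebesgue_measure_itv/= lte_fin.
have [ab|ba] := ltP a b.
  by rewrite -EFinB -hab//; apply: eq_integral => t _; rewrite EFinM.
rewrite integral0_eq// => t _; rewrite set_itv_ge ?indic0 ?mul0e//.
by rewrite bnd_simp -leNgt.
Qed.

End change_of_variables.

(** * Substitutions leading to polar coordinates *)

Section polar_coordinates.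
Variable R : realType.
Local Open Scope ereal_scope.

Lemma integral_indic_comp (D J : set (TR R)) (phi w : TR R -> R) (a b : R) :
  (forall t, J t <-> D t /\ (a < phi t <= b)%R) ->
  \int[leb R]_(t in D) ((\1_(`]a, b]%classic) (phi t) * w t)%R)%:E =
  \int[leb R]_(t in J) (w t)%:E.
Proof.
move=> JP; rewrite [LHS]integral_mkcond [RHS]integral_mkcond.
apply: eq_integral => t _; rewrite /patch indicE mem_setE in_itv/=.
have [tJ|tJ] := boolP (t \in J).
  have [Dt h] := (JP t).1 (set_mem tJ).
  by rewrite (mem_set Dt) h mul1r.
case: ifPn => // tD; have -> : (a < phi t <= b)%R = false.
  apply/negP => h; move/negP: tJ; apply; apply/mem_set/JP; split=> //.
  exact: set_mem.
by rewrite mul0r.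
Qed.

Lemma integral_scale (c : R) (h : TR R -> \bar R) : (0 < c)%R ->
  measurable_fun setT h -> (forall x, 0 <= h x) ->
  \int[leb R]_(k in `]0%R, +oo[) (h (k * c)%R * c%:E) =
  \int[leb R]_(x in `]0%R, +oo[) h x.
Proof.
move=> c0 mh h0; have mI : measurable (`]0%R, +oo[ : set (TR R)) by exact: measurable_itv.
rewrite [LHS]integral_mkcond [RHS]integral_mkcond.
pose g := h \_ `]0%R, +oo[.
rewrite -(@change_variables _ setT (fun k => k * c)%R (fun=> c) g)//.
- apply: eq_integral => k _; rewrite /g /patch !mem_setE !in_itv/= !andbT pmulr_lgt0//.
  by case: ifP => // _; rewrite mul0e.
- by apply: mf_mul; [exact: mf_id|exact: mf_cst].
- by move=> _ _; exact: ltW.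
- move=> a b ab.
  rewrite (@integral_indic_comp _ `](a / c)%R, (b / c)%R]); last first.
    move=> t; rewrite /= in_itv/= ltr_pdivrMr// ler_pdivlMr//.
    by split => [|[]].
  rewrite integral_cst; last exact: measurable_itv.
  rewrite [X in _ * X](_ : _ = ((b - a) / c)%:E); last first.
    apply: etrans; first exact: lebesgue_measure_itv.
    by rewrite /= lte_fin ltr_pM2r ?invr_gt0// ab mulrBl.
  by rewrite -EFinM; congr EFin; field; exact: lt0r_neq0.
- by apply/(measurable_restrictT _ _).1 => //; exact: measurable_funTS.
- by move=> x; rewrite /g /patch; case: ifPn.
Qed.

Lemma integral_reflect (c : R) (h : TR R -> \bar R) :
  measurable_fun setT h -> (forall x, 0 <= h x) ->
  \int[leb R]_x h (c - x)%R = \int[leb R]_x h x.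
Proof.
move=> mh h0; rewrite -(@change_variables _ setT (fun x => c - x)%R (fun=> 1%R) h)//.
- by apply: eq_integral => x _; rewrite mule1.
- by apply: mf_add; [exact: mf_cst|apply: mf_opp].
- move=> a b ab.
  rewrite (@integral_indic_comp _ `[(c - b)%R, (c - a)%R[); last first.
    move=> t; rewrite /= in_itv/=; split => [/andP[u v]|[_ /andP[u v]]];
      (try split => //); apply/andP; split; lra.
  rewrite integral_cst ?mul1e; last exact: measurable_itv.
  apply: etrans; first exact: lebesgue_measure_itv.
  rewrite /= lte_fin ltrD2l ltrN2 ab -EFinB; congr EFin; ring.
Qed.

Lemma is_derive_cot (x : R) : sin x != 0%R ->
  is_derive x 1%R (fun x : R => - (cos x / sin x))%R ((sin x) ^- 2)%R.
Proof.
move=> sx; apply: is_derive_eq; rewrite /GRing.scale/=.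
have := cos2Dsin2 x => h; apply/eqP; rewrite -subr_eq0; apply/eqP.
rewrite (_ : (_ - _)%R = ((cos x ^+ 2 + sin x ^+ 2) - 1) / sin x ^+ 2)%R; last by field.
by rewrite h subrr mul0r.
Qed.

(** The map $t\mapsto s\cot t$ decreases from $+\infty$ to $-\infty$ on $]0,\pi[$, and the weight is
    minus its derivative. *)
Lemma integral_cot (s : R) (h : TR R -> \bar R) : (0 < s)%R ->
  measurable_fun setT h -> (forall x, 0 <= h x) ->
  \int[leb R]_(t in `]0%R, pi[) (h (s * (cos t / sin t))%R * (s * (sin t) ^- 2)%R%:E) =
  \int[leb R]_x h x.
Proof.
move=> s0 mh h0; apply: change_variables => //.
- by mmeas.
- by mmeas.
- by move=> t _; rewrite mulr_ge0 ?invr_ge0 ?exprn_even_ge0// ltW.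
- move=> a b ab.
  (* The arccotangents of [b / s] and [a / s]. The cotangent reverses the order, so the preimage of
     []a, b]] is [[al, be[], closed on the left. *)
  pose al := (pi / 2 - atan (b / s))%R; pose be := (pi / 2 - atan (a / s))%R.
  have alb : (al < be)%R.
    by rewrite /al /be ltrD2l ltrN2; apply: lt_atan; rewrite ltr_pM2r ?invr_gt0.
  have al0 : (0 < al)%R by rewrite subr_gt0 atan_ltpi2.
  have bepi : (be < pi)%R.
    rewrite /be; have := atan_gtNpi2 (a / s); lra.
  have cotE (u : R) : (cos (pi / 2 - u) / sin (pi / 2 - u) = tan u)%R.
    by rewrite cosB sinB !cos_pihalf !sin_pihalf !mul0r !mul1r add0r subr0.
  rewrite (@integral_indic_comp _ `[al, be[); last first.
    move=> t; rewrite /= !in_itv/=.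
    pose u := (pi / 2 - t)%R; have -> : t = (pi / 2 - u)%R by rewrite /u; ring.
    rewrite cotE; split.
      move=> /andP[h1 h2].
      have uI : u \in `](- (pi / 2))%R, (pi / 2)%R[ by rewrite in_itv/=; apply/andP; split; lra.
      split; first by apply/andP; split; lra.
      rewrite mulrC -ltr_pdivrMr// -ler_pdivlMr//; apply/andP; split.
        rewrite -[(a / s)%R]atanK ltr_tan//; first by rewrite /be in h2; lra.
        by rewrite in_itv/= atan_gtNpi2 atan_ltpi2.
      rewrite leNgt -[(b / s)%R]atanK ltr_tan//; first by rewrite -leNgt; rewrite /al in h1; lra.
      by rewrite in_itv/= atan_gtNpi2 atan_ltpi2.
    move=> [/andP[h1 h2]].
    have uI : u \in `](- (pi / 2))%R, (pi / 2)%R[ by rewrite in_itv/=; apply/andP; split; lra.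
    rewrite mulrC -ltr_pdivrMr// -ler_pdivlMr// => /andP[h3 h4].
    rewrite -[(a / s)%R]atanK ltr_tan// in h3; last first.
      by rewrite in_itv/= atan_gtNpi2 atan_ltpi2.
    rewrite leNgt -[(b / s)%R]atanK ltr_tan// -?leNgt in h4; last first.
      by rewrite in_itv/= atan_gtNpi2 atan_ltpi2.
    by rewrite /al /be; apply/andP; split; lra.
  have sn0 (t : R) : (al <= t <= be)%R -> sin t != 0%R.
    move=> /andP[h1 h2]; apply/lt0r_neq0/sin_gt0_pi; apply/andP; split; lra.
  rewrite integral_itv_bndo_bndc; last by mmeas.
  pose F := (fun t : R => s * - (cos t / sin t))%R.
  have dF (t : R) : (al <= t <= be)%R -> is_derive t 1%R F (s * (sin t) ^- 2)%R.
    move=> /sn0/is_derive_cot dt; rewrite /F; apply: is_derive_eq.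
    by rewrite /GRing.scale/=.
  have cF (t : R) : (al <= t <= be)%R -> {for t, continuous F}.
    move=> ht; apply/differentiable_continuous/derivable1_diffP.
    by have [] := dF _ ht.
  rewrite (@continuous_FTC2 _ (fun t => s * (sin t) ^- 2)%R F)//.
  + rewrite /F -EFinB; congr EFin; rewrite !cotE !atanK; field; exact: lt0r_neq0.
  + apply: continuous_in_subspaceT => t; rewrite inE/= in_itv/= => ht.
    apply: cvgMl_tmp; apply: cvgV; first by rewrite expf_neq0// sn0.
    apply: (@cvg_comp _ _ _ (@sin R) (fun y => y ^+ 2)%R); first exact: continuous_sin.
    exact: exprn_continuous.
  + split.
    * by move=> t; rewrite in_itv/= => /andP[/ltW h1 /ltW h2]; have [] := dF t (introT andP (conj h1 h2)).
    * by apply: cvg_at_right_filter; apply: cF; rewrite lexx ltW.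
    * by apply: cvg_at_left_filter; apply: cF; rewrite lexx ltW.
  + move=> t; rewrite in_itv/= => /andP[/ltW h1 /ltW h2].
    by have dt := dF t (introT andP (conj h1 h2)); rewrite derive1E; exact: derive_val.
Qed.

End polar_coordinates.

Section parametric_domains.
Context d1 d2 (T1 : measurableType d1) (T2 : measurableType d2) (R : realType).
Variable m1 : {sigma_finite_measure set T1 -> \bar R}.
Variable m2 : {sigma_finite_measure set T2 -> \bar R}.
Local Open Scope ereal_scope.
Variable f : T1 * T2 -> \bar R.
Hypotheses (mf : measurable_fun setT f) (f0 : forall z, 0 <= f z).

Let g (D1 : set T1) (D2 : set T2) z := f z * ((\1_D1 z.1 : R)%:E * (\1_D2 z.2 : R)%:E).

Let mg D1 D2 : measurable D1 -> measurable D2 -> measurable_fun setT (g D1 D2).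
Proof.
move=> mD1 mD2; apply: emeasurable_funM => //.
apply: emeasurable_funM; apply: mf_EFin.
- by apply: (@measurableT_comp _ _ _ _ _ _ (\1_D1 : T1 -> R)) => //; exact: measurable_indic.
- by apply: (@measurableT_comp _ _ _ _ _ _ (\1_D2 : T2 -> R)) => //; exact: measurable_indic.
Qed.

Let g0 D1 D2 z : 0 <= g D1 D2 z.
Proof. by rewrite !mule_ge0// lee_fin indicE. Qed.

Lemma measurable_integral_dom (D2 : set T2) : measurable D2 ->
  measurable_fun setT (fun x => \int[m2]_(y in D2) f (x, y)).
Proof.
move=> mD2; rewrite (_ : (fun _ => _) = fubini_F m2 (g setT D2)).
  apply: measurable_fun_fubini_tonelli_F; first exact: mg.
  exact: g0.
apply/funext => x; rewrite integral_mkcond; apply: eq_integral => y _.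
rewrite /patch /g/= !indicE in_setT.
by case: (y \in D2); rewrite ?mule1 ?mule0.
Qed.

Lemma tonelli_setX (D1 : set T1) (D2 : set T2) : measurable D1 -> measurable D2 ->
  \int[(m1 \x m2)%E]_(z in D1 `*` D2) f z = \int[m1]_(x in D1) \int[m2]_(y in D2) f (x, y).
Proof.
move=> mD1 mD2; rewrite [LHS]integral_mkcond.
transitivity (\int[(m1 \x m2)%E]_z g D1 D2 z).
  apply: eq_integral => z _; rewrite /patch /g !indicE.
  have -> : (z \in D1 `*` D2) = (z.1 \in D1) && (z.2 \in D2).
    by apply/idP/andP => [/set_mem[? ?]|[/set_mem ? /set_mem ?]]; rewrite ?mem_set.
  by case: (z.1 \in D1); case: (z.2 \in D2); rewrite /= ?(mul0e, mule0, mule1).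
rewrite (@fubini_tonelli1 _ _ _ _ _ m1 m2 _ (mg mD1 mD2) (g0 D1 D2)).
rewrite [RHS]integral_mkcond; apply: eq_integral => x _; rewrite /fubini_F /patch.
case: ifPn => xD.
  rewrite [RHS]integral_mkcond; apply: eq_integral => y _; rewrite /patch /g/= !indicE xD.
  by case: (y \in D2); rewrite ?mule0 ?mule1.
rewrite integral0_eq// => y _.
by rewrite /g/= !indicE (negbTE xD) mul0e mule0.
Qed.

End parametric_domains.

(** * Polar and spherical coordinates by iterated integrals *)

Section spherical_coordinates.
Variable R : realType.
Local Open Scope ereal_scope.

Notation pos := (`]0%R, +oo[%classic : set (TR R)).

Let mpos : measurable pos. Proof. exact: measurable_itv. Qed.

Lemma mf_comp2 d (T : measurableType d) (f : TR2 R -> \bar R) (a b : T -> TR R) :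
  measurable_fun setT f -> measurable_fun setT a -> measurable_fun setT b ->
  measurable_fun setT (fun t => f (a t, b t)).
Proof.
by move=> mf ma mb; apply: (measurableT_comp mf (measurable_fun_pair ma mb)).
Qed.

(* The substitutions [z = s cot t] and then [s = k sin t]. *)
Lemma polar_half (f : TR2 R -> \bar R) : measurable_fun setT f -> (forall z, 0 <= f z) ->
  \int[leb R]_(s in pos) \int[leb R]_z f (z, s) =
  \int[leb R]_(t in `]0%R, pi[) \int[leb R]_(k in pos) (f (k * cos t, k * sin t)%R * k%:E).
Proof.
move=> mf f0.
(* The Jacobian of $z=s\cot t$, with an absolute value for positivity off the domain. After $s=k\sin
   t$, with its own factor $\sin t$, it becomes [k]. *)
pose g (z : TR2 R) := f (z.1 * (cos z.2 / sin z.2), z.1)%R * (`|z.1| * (sin z.2) ^- 2)%:E.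
have mg : measurable_fun setT g.
  apply: emeasurable_funM; last by mmeas.
  by apply: mf_comp2; mmeas.
have g0 z : 0 <= g z.
  by rewrite mule_ge0// lee_fin mulr_ge0// invr_ge0 exprn_even_ge0.
transitivity (\int[leb R]_(s in pos) \int[leb R]_(t in `]0%R, pi[) g (s, t)).
  apply: eq_integral => s; rewrite inE/= in_itv/= andbT => s0.
  rewrite -(@integral_cot _ s (fun z => f (z, s)))//.
    by apply: eq_integral => t _; rewrite /g/= gtr0_norm.
  exact: (measurableT_comp mf (pair2_measurable s)).
have mop : measurable (`]0%R, pi[%classic : set (TR R)) by exact: measurable_itv.
rewrite (@tonelli_dom _ _ (TR R) (TR R) R (leb R) (leb R) pos `]0%R, pi[%classic g mpos mop mg g0).
apply: eq_integral => t; rewrite inE/= in_itv/= => ht.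
have st : (0 < sin t)%R by exact: sin_gt0_pi.
rewrite -(@integral_scale _ (sin t) (fun s => g (s, t)))//; last first.
  exact: (measurableT_comp mg (pair2_measurable t)).
apply: eq_integral => k; rewrite inE/= in_itv/= andbT => k0.
rewrite /g/= -muleA -EFinM; congr (f (_, _) * _%:E).
- by field; exact: lt0r_neq0.
- by rewrite gtr0_norm ?mulr_gt0//; field; exact: lt0r_neq0.
Qed.

(** The upper half-plane gives the angles in $]0,\pi[$. The lower one is reflected into it and
    returns the angles in $]\pi,2\pi[$ through $t\mapsto 2\pi-t$. The remaining angles are a null
    set. *)
Lemma polar_full (f : TR2 R -> \bar R) : measurable_fun setT f -> (forall z, 0 <= f z) ->
  \int[leb R]_x \int[leb R]_y f (x, y) =
  \int[leb R]_(t in `[0%R, (2 * pi)%R]) \int[leb R]_(k in pos) (f (k * cos t, k * sin t)%R * k%:E).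
Proof.
move=> mf f0; rewrite (fubini_tonelli f mf f0).
pose A y := \int[leb R]_x f (x, y).
have mA : measurable_fun setT A by exact: measurable_fun_fubini_tonelli_G.
have A0 y : 0 <= A y by exact: integral_ge0.
pose B (t : TR R) := \int[leb R]_(k in pos) (f (k * cos t, k * sin t)%R * k%:E).
pose b (z : TR2 R) := f (z.2 * cos z.1, z.2 * sin z.1)%R * `|z.2|%:E.
have mb : measurable_fun setT b.
  apply: emeasurable_funM; last by mmeas.
  by apply: mf_comp2; mmeas.
have b0 z : 0 <= b z by rewrite mule_ge0// lee_fin.
have BE t : B t = \int[leb R]_(k in pos) b (t, k).
  apply: eq_integral => k; rewrite inE/= in_itv/= andbT => k0.
  by rewrite /b/= gtr0_norm.
have mB : measurable_fun setT B.
  rewrite (funext BE).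
  exact: (@measurable_integral_dom _ _ (TR R) (TR R) R (leb R) b mb b0 _ mpos).
have B0 t : 0 <= B t by rewrite BE; exact: integral_ge0.
have pi0 := pi_gt0 R.
have e1 : \int[leb R]_(y in pos) A y = \int[leb R]_(t in `]0%R, pi[) B t.
  exact: polar_half.
have e2 : \int[leb R]_(y in `]-oo, 0%R]) A y = \int[leb R]_(t in `]pi, (2 * pi)%R[) B t.
  pose A' (y : TR R) := A (- y)%R.
  have mA' : measurable_fun setT A'.
    by apply: (measurableT_comp mA); exact: (@mf_opp _ (TR R) R setT id).
  transitivity (\int[leb R]_(y in `]-oo, 0%R]) A' (- y)%R).
    by apply: eq_integral => y _; rewrite /A' opprK.
  rewrite -(@ge0_integration_by_substitution0 R A' mA' (fun y => A0 (- y)%R)).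
  rewrite -(@integral_itv_obnd_cbnd R 0%R _ A' (measurable_funTS mA')).
  pose f' (z : TR2 R) := f (z.1, - z.2)%R.
  have mf' : measurable_fun setT f' by apply: mf_comp2; mmeas.
  rewrite [LHS](polar_half mf' (fun z => f0 _)).
  transitivity (\int[leb R]_x ((B \_ `]pi, (2 * pi)%R[) (2 * pi - x)%R)).
    rewrite [LHS]integral_mkcond; apply: eq_integral => t _; rewrite /patch !mem_setE !in_itv/=.
    have -> : (pi < 2 * pi - t < 2 * pi)%R = (0 < t < pi)%R.
      by apply/idP/idP => /andP[? ?]; apply/andP; split; lra.
    case: ifP => // _; apply: eq_integral => k _; rewrite /f'/=.
    have -> : cos (2 * pi - t) = cos t by rewrite addrC mulr_natl cosD2pi cosN.
    by rewrite addrC mulr_natl sinD2pi sinN mulrN.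
  rewrite integral_reflect; last 2 first.
  - by apply/(measurable_restrictT _ _).1; [exact: measurable_itv|exact: measurable_funTS].
  - by move=> x; rewrite /patch; case: ifPn.
  by rewrite [RHS]integral_mkcond.
transitivity (\int[leb R]_(y in pos `|` `]-oo, 0%R]) A y).
  congr integral; apply/seteqP; split=> x _ //=; rewrite !in_itv/= andbT.
  by case: (ltP 0%R x) => ?; [left|right].
have mneg : measurable (`]-oo, 0%R]%classic : set (TR R)) by exact: measurable_itv.
have dj : [disjoint pos & (`]-oo, 0%R]%classic : set (TR R))].
  apply/disj_setPS => x [/=]; rewrite !in_itv/= andbT => x0 /(lt_le_trans x0).
  by rewrite ltxx.
rewrite (@ge0_integral_setU _ _ _ (leb R) _ _ mpos mneg A (measurable_funTS mA) (fun x _ => A0 x) dj).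
rewrite e1 e2.
have mL : measurable (`[0%R, pi]%classic : set (TR R)) by exact: measurable_itv.
have mU : measurable (`]pi, (2 * pi)%R]%classic : set (TR R)) by exact: measurable_itv.
have dLU : [disjoint (`[0%R, pi]%classic : set (TR R)) & (`]pi, (2 * pi)%R]%classic : set (TR R))].
  apply/disj_setPS => x [/=]; rewrite !in_itv/= => /andP[_ h] /andP[/(le_lt_trans h)].
  by rewrite ltxx.
transitivity (\int[leb R]_(t in `[0%R, pi] `|` `]pi, (2 * pi)%R]) B t); last first.
  congr integral; apply/seteqP; split=> x /=; rewrite !in_itv/=.
    by move=> [/andP[? ?]|/andP[? ?]]; apply/andP; split; lra.
  move=> /andP[x0 x2]; have [xp|xp] := leP x pi; [left|right]; first by rewrite x0.
  by rewrite x2.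
rewrite (@ge0_integral_setU _ _ _ (leb R) _ _ mL mU B (measurable_funTS mB) (fun x _ => B0 x) dLU).
by congr (_ + _); rewrite [RHS](integral_itv_bndoo _ _ (measurable_funTS mB)).
Qed.

(** Polar coordinates are used twice: [polar_full] in the horizontal plane gives cylindrical
    coordinates, then [polar_half] acts on the half-plane of height [x3] and distance [s > 0] to the
    axis. The Jacobians [s] and [k], with $s=k\sin\theta$, multiply to $k^2\sin\theta$. *)
Lemma spherical (f : TR3 R -> \bar R) : measurable_fun setT f -> (forall z, 0 <= f z) ->
  \int[leb3 R]_x f x =
  \int[leb2 R]_(t in `[0%R, pi] `*` `[0%R, (2 * pi)%R]) \int[leb R]_(k in pos)
    (f (k * (sin t.1 * cos t.2), k * (sin t.1 * sin t.2), k * cos t.1)%R *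
     (k ^+ 2 * sin t.1)%:E).
Proof.
move=> mf f0; have pi0 := pi_gt0 R.
pose Ph : set (TR R) := `[0%R, (2 * pi)%R]%classic.
have mPh : measurable Ph by exact: measurable_itv.
have mf3 d (T : measurableType d) (a b c : T -> TR R) :
    measurable_fun setT a -> measurable_fun setT b -> measurable_fun setT c ->
    measurable_fun setT (fun t => f (a t, b t, c t)).
  move=> ma mb mc; apply: (measurableT_comp mf).
  apply: (measurable_fun_pair (measurable_fun_pair ma mb) mc).
pose g (w : (TR R * TR R) * TR R) := f (w.2 * cos w.1.2, w.2 * sin w.1.2, w.1.1)%R * `|w.2|%:E.
have mg : measurable_fun setT g.
  by apply: emeasurable_funM; [apply: mf3|]; mmeas.
have g0 w : 0 <= g w by rewrite mule_ge0// lee_fin.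
transitivity (\int[leb R]_x3 \int[leb R]_(p in Ph) \int[leb R]_(s in pos) g ((x3, p), s)).
  rewrite [LHS](@fubini_tonelli2 _ _ _ _ _ (leb2 R) (leb R) f mf f0).
  apply: eq_integral => x3 _; rewrite /fubini_G.
  pose fx (z : TR2 R) := f (z, x3).
  have mfx : measurable_fun setT fx by exact: (measurableT_comp mf (pair2_measurable x3)).
  apply: (etrans (@fubini_tonelli1 _ _ _ _ _ (leb R) (leb R) fx mfx (fun z => f0 _))).
  apply: (etrans (polar_full mfx (fun z => f0 _))).
  apply: eq_integral => p _; apply: eq_integral => s; rewrite inE/= in_itv/= andbT => s0.
  by rewrite /fx /g/= gtr0_norm.
pose G (w : TR2 R) := \int[leb R]_(s in pos) g (w, s).
have mG : measurable_fun setT G.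
  exact: (@measurable_integral_dom _ _ (TR2 R) (TR R) R (leb R) g mg g0 _ mpos).
have G0 w : 0 <= G w by exact: integral_ge0.
rewrite -[LHS]/(\int[leb R]_x3 \int[leb R]_(p in Ph) G (x3, p)).
rewrite (@tonelli_dom _ _ (TR R) (TR R) R (leb R) (leb R) setT Ph G measurableT mPh mG G0).
pose H (w : TR2 R) := \int[leb R]_(k in pos)
    (f (k * (sin w.1 * cos w.2), k * (sin w.1 * sin w.2), k * cos w.1)%R *
     (k ^+ 2 * `|sin w.1|)%:E).
have mH : measurable_fun setT H.
  pose h (w : TR2 R * TR R) := f (w.2 * (sin w.1.1 * cos w.1.2),
    w.2 * (sin w.1.1 * sin w.1.2), w.2 * cos w.1.1)%R * (w.2 ^+ 2 * `|sin w.1.1|)%:E.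
  apply: (@measurable_integral_dom _ _ (TR2 R) (TR R) R (leb R) h _ _ _ mpos).
    by apply: emeasurable_funM; [apply: mf3|]; mmeas.
  by move=> w; rewrite mule_ge0// lee_fin mulr_ge0// sqr_ge0.
have H0 w : 0 <= H w.
  by apply: integral_ge0 => k _; rewrite mule_ge0// lee_fin mulr_ge0// sqr_ge0.
transitivity (\int[leb R]_(p in Ph) \int[leb R]_(t in `]0%R, pi[) H (t, p)).
  apply: eq_integral => p _.
  pose gp (z : TR2 R) := g ((z.1, p), z.2).
  have mgp : measurable_fun setT gp.
    apply: (measurableT_comp mg).
    exact: (measurable_fun_pair (measurable_fun_pair measurable_fst (measurable_cst p)) measurable_snd).
  transitivity (\int[leb R]_(s in pos) \int[leb R]_z gp (z, s)).
    exact: (@tonelli_dom _ _ (TR R) (TR R) R (leb R) (leb R) setT pos gp measurableT mpos mgp (fun z => g0 _)).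
  apply: (etrans (polar_half mgp (fun z => g0 _))).
  apply: eq_integral => t; rewrite inE/= in_itv/= => ht.
  have st : (0 < sin t)%R by exact: sin_gt0_pi.
  apply: eq_integral => k; rewrite inE/= in_itv/= andbT => k0.
  rewrite /gp /g/= -muleA -EFinM; congr (f (_, _, _) * _%:E).
  - by rewrite mulrA.
  - by rewrite mulrA.
  - by rewrite !gtr0_norm ?mulr_gt0//; ring.
transitivity (\int[leb R]_(p in Ph) \int[leb R]_(t in `[0%R, pi]) H (t, p)).
  apply: eq_integral => p _; rewrite [RHS](@integral_itv_bndoo R 0%R pi (fun t => H (t, p)))//.
  by apply: measurable_funTS; exact: (measurableT_comp mH (pair2_measurable p)).
have mL : measurable (`[0%R, pi]%classic : set (TR R)) by exact: measurable_itv.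
rewrite -(@tonelli_dom _ _ (TR R) (TR R) R (leb R) (leb R) _ Ph H mL mPh mH H0).
apply: (etrans (esym (@tonelli_setX _ _ (TR R) (TR R) R (leb R) (leb R) H mH H0 _ _ mL mPh))).
apply: eq_integral => t; rewrite inE/= => -[]; rewrite /= in_itv/= => /andP[t0 tp] _.
have st : (0 <= sin t.1)%R by apply: sin_ge0_pi; rewrite t0 tp.
by apply: eq_integral => k _; rewrite ger0_norm.
Qed.

End spherical_coordinates.

Section spherical_ball.
Variable R : realType.

Notation SQ := (`[0%R, pi]%classic `*` `[0%R, (2 * pi)%R]%classic : set (TR2 R)).
Notation pos := (`]0%R, +oo[%classic : set (TR R)).

Definition spherical_point (w : TR2 R * TR R) : TR3 R := w.2 *: sphere_param w.1.

(** The indicators carry the parameter domain, so integrals run over a full product space, and the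
    absolute value makes the density nonnegative everywhere. *)
Definition spherical_jacobian (w : TR2 R * TR R) : R :=
  w.2 ^+ 2 * `|sin w.1.1| * (\1_SQ w.1 * \1_pos w.2).

Let mSQ : measurable SQ.
Proof. by apply: measurableX; exact: measurable_itv. Qed.

Let mpos : measurable pos. Proof. exact: measurable_itv. Qed.

Lemma measurable_spherical_point : measurable_fun setT spherical_point.
Proof.
apply: (measurable_fun_pair (measurable_fun_pair _ _) _).
- by rewrite /GRing.scale/=; mmeas.
- by rewrite /GRing.scale/=; mmeas.
- by rewrite /GRing.scale/=; mmeas.
Qed.

Lemma measurable_spherical_jacobian : measurable_fun setT spherical_jacobian.
Proof.
apply: mf_mul; first by mmeas.
apply: mf_mul.
- by apply: (@measurableT_comp _ _ _ _ _ _ (\1_SQ : TR2 R -> R)) => //; exact: measurable_indic.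
- by apply: (@measurableT_comp _ _ _ _ _ _ (\1_pos : TR R -> R)) => //; exact: measurable_indic.
Qed.

Lemma spherical_jacobian_ge0 w : 0 <= spherical_jacobian w.
Proof.
by apply: (mulr_ge0 (mulr_ge0 (sqr_ge0 _) (normr_ge0 _))); rewrite !indicE mulr_ge0.
Qed.

Lemma ge0_spherical (h : TR3 R -> R) : measurable_fun setT h -> (forall x, 0 <= h x) ->
  (\int[(leb2 R \x leb R)%E]_w (h (spherical_point w) * spherical_jacobian w)%:E =
   \int[leb3 R]_x (h x)%:E)%E.
Proof.
move=> mh h0.
have mH : measurable_fun setT (fun w => (h (spherical_point w) * spherical_jacobian w)%:E).
  apply: mf_EFin; apply: mf_mul; last exact: measurable_spherical_jacobian.
  exact: (measurableT_comp mh measurable_spherical_point).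
have H0 w : (0 <= (h (spherical_point w) * spherical_jacobian w)%:E)%E.
  by rewrite lee_fin mulr_ge0// spherical_jacobian_ge0.
apply: (etrans (@fubini_tonelli1 _ _ (TR2 R) (TR R) R (leb2 R) (leb R) _ mH H0)).
apply: (etrans _ (esym (@spherical R (fun x => (h x)%:E) (mf_EFin mh) (fun x => h0 x)))).
rewrite [RHS]integral_mkcond; apply: eq_integral => t _; rewrite /fubini_F /patch.
case: ifPn => [tS|tS]; last first.
  apply: integral0_eq => k _.
  by rewrite /spherical_jacobian/= indicE (negbTE tS) mul0r mulr0 mulr0.
have st : 0 <= sin t.1.
  by move: tS => /set_mem[/=]; rewrite in_itv/= => ? _; exact: sin_ge0_pi.
rewrite [RHS]integral_mkcond; apply: eq_integral => k _; rewrite /patch.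
rewrite /spherical_jacobian/= !indicE tS mul1r ger0_norm//.
by case: ifPn => kp; rewrite ?mulr1 ?mulr0// -EFinM.
Qed.

(** A signed function is the difference of the nonnegative functions $h+|h|$ and $|h|$, both
    integrable. *)
Lemma spherical_Rintegral (h : TR3 R -> R) : (leb3 R).-integrable setT (fun x => (h x)%:E) ->
  (leb2 R \x leb R)%E.-integrable setT
    (fun w => (h (spherical_point w) * spherical_jacobian w)%:E) /\
  \int[(leb2 R \x leb R)%E]_w (h (spherical_point w) * spherical_jacobian w) =
  \int[leb3 R]_x h x.
Proof.
have base (u : TR3 R -> R) : (forall x, 0 <= u x) -> (leb3 R).-integrable setT (fun x => (u x)%:E) ->
  (leb2 R \x leb R)%E.-integrable setT
    (fun w => (u (spherical_point w) * spherical_jacobian w)%:E) /\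
  \int[(leb2 R \x leb R)%E]_w (u (spherical_point w) * spherical_jacobian w) =
  \int[leb3 R]_x u x.
  move=> u0 /integrableP[/measurable_EFinP mu iu]; have e := ge0_spherical mu u0.
  split; last by rewrite /Rintegral; congr fine.
  apply/integrableP; split.
    apply: mf_EFin; apply: mf_mul; last exact: measurable_spherical_jacobian.
    exact: (measurableT_comp mu measurable_spherical_point).
  rewrite (eq_integral (fun w => (u (spherical_point w) * spherical_jacobian w)%:E)).
    rewrite e; apply: le_lt_trans iu; rewrite le_eqVlt; apply/orP; left; apply/eqP.
    by apply: eq_integral => x _; rewrite gee0_abs// lee_fin.
  by move=> w _; rewrite gee0_abs// lee_fin mulr_ge0// spherical_jacobian_ge0.
move=> ih; have ia := integrable_norm ih.
have p0 x : 0 <= h x + `|h x| by rewrite addrC -[h x]opprK subr_ge0 opprK -normrN ler_norm.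
have [i1 e1] := base _ p0 (integrableD_EFin ih ia).
have [i2 e2] := base (fun x => `|h x|) (fun x => normr_ge0 _) ia.
have E w : h (spherical_point w) * spherical_jacobian w =
   (h (spherical_point w) + `|h (spherical_point w)|) * spherical_jacobian w -
   `|h (spherical_point w)| * spherical_jacobian w by ring.
split.
  rewrite (_ : (fun w => _) = fun w => ((h (spherical_point w) + `|h (spherical_point w)|) * spherical_jacobian w -
   `|h (spherical_point w)| * spherical_jacobian w)%:E).
    exact: (integrableB_EFin i1 i2).
  by apply/funext => w; rewrite E.
under eq_Rintegral do rewrite E.
rewrite (RintegralB _ i1 i2)// e1 e2 (RintegralD _ ih ia)//; ring.
Qed.

Lemma dot_sphere_param (k : R) (t : TR2 R) : dot (k *: sphere_param t) (k *: sphere_param t) = k ^+ 2.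
Proof.
rewrite dotE/= /GRing.scale/=.
have -> : k * (sin t.1 * cos t.2) * (k * (sin t.1 * cos t.2)) +
  k * (sin t.1 * sin t.2) * (k * (sin t.1 * sin t.2)) + k * cos t.1 * (k * cos t.1) =
  k ^+ 2 * (sin t.1 ^+ 2 * (cos t.2 ^+ 2 + sin t.2 ^+ 2) + cos t.1 ^+ 2) by ring.
by rewrite cos2Dsin2 mulr1 addrC cos2Dsin2 mulr1.
Qed.

(** Boundedness makes [g] integrable on the ball, so Fubini gives the iterated form, and integrable
    along every ray, so the area element [sin t.1] can be taken out of the radial integral as in
    [sphere_vint]. *)
Lemma spherical_ball (g : TR3 R -> R) (r C : R) : 0 < r -> measurable_fun setT g ->
  (forall x, `|g x| <= C) ->
  \int[leb2 R]_(t in SQ) (sin t.1 * \int[leb R]_(k in `]0%R, r[) (g (k *: sphere_param t) * k ^+ 2)) =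
  \int[leb3 R]_x (\1_(ball3 r) x * g x).
Proof.
move=> r0 mg gC; pose h x := \1_(ball3 r) x * g x.
have mI : measurable (`]0%R, r[%classic : set (TR R)) by exact: measurable_itv.
have mh : measurable_fun setT h.
  by apply: mf_mul => //; apply: mf_indic; exact: measurable_ball3.
have C0 : 0 <= C by exact: (le_trans (normr_ge0 _) (gC 0)).
have ih : (leb3 R).-integrable setT (fun x => (h x)%:E).
  have i1 := integrableZl_EFin C (integrable_cube r).
  apply: (le_integrable _ _ _ i1) => //; first exact: mf_EFin.
  move=> x _ /=; rewrite lee_fin /h normrM [leRHS]ger0_norm ?mulr_ge0 ?indicE//.
  have [xb|] := boolP (x \in ball3 r); last by rewrite normr0 mul0r mulr_ge0.
  have -> : x \in cube r by apply/mem_set/(ball3_cube (ltW r0)); exact/set_mem.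
  by rewrite normr1 mul1r mulr1.
have [i2 e2] := spherical_Rintegral ih.
have [_ e3] := @Rintegral_fubini1 _ _ (TR2 R) (TR R) R (leb2 R) (leb R) _ i2.
rewrite -e2 -e3 Rintegral_mkcond; apply: eq_Rintegral => t _; rewrite /patch.
case: ifPn => [tS|tS]; last first.
  rewrite /Rintegral integral0_eq// => k _.
  by rewrite /spherical_jacobian/= indicE (negbTE tS) mul0r !mulr0.
have st : 0 <= sin t.1.
  by move: tS => /set_mem[/=]; rewrite in_itv/= => ? _; exact: sin_ge0_pi.
have mgk : measurable_fun setT (fun k : TR R => g (k *: sphere_param t)).
  apply: (measurableT_comp mg).
  apply: (measurable_fun_pair (measurable_fun_pair _ _) _);
  by rewrite /GRing.scale/=; mmeas.
have ig : (leb R).-integrable `]0%R, r[ (fun k => (g (k *: sphere_param t) * k ^+ 2)%:E).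
  apply: (@measurable_bounded_integrable _ _ _ _ (fun k : TR R => g (k *: sphere_param t) * k ^+ 2)) => //.
  - by have := @lebesgue_measure_itv R `]0, r[; rewrite /= lte_fin r0 -EFinB => ->; exact: ltry.
  - by apply: measurable_funTS; apply: mf_mul => //; apply: mf_exprn; exact: mf_id.
  - exists (C * r ^+ 2); split; first exact: num_real.
    move=> M CM k; rewrite /= in_itv/= => /andP[k0 kr]; apply: le_trans (ltW CM).
    rewrite normrM ler_pM// ger0_norm ?sqr_ge0//.
    by apply: lerXn2r; rewrite ?nnegrE ltW.
rewrite -(RintegralZl _ mI ig) Rintegral_mkcond; apply: eq_Rintegral => k _; rewrite /patch.
rewrite /spherical_jacobian/= /h !indicE tS /spherical_point/= mul1r (ger0_norm st).
have [kp|kp] := boolP (k \in pos); last first.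
  rewrite mulr0 mulr0 ifN//; apply: contra kp => /set_mem/=; rewrite in_itv/= => /andP[k0 _].
  by rewrite mem_setE in_itv/= k0.
have k0 : 0 < k by move: kp => /set_mem/=; rewrite in_itv/= andbT.
have -> : (k \in (`]0%R, r[%classic : set (TR R))) = (k < r).
  apply/idP/idP => [/set_mem/=|kr]; first by rewrite in_itv/= => /andP[].
  by apply/mem_set; rewrite /= in_itv/= k0.
have -> : (k *: sphere_param t \in ball3 r) = (k < r).
  rewrite -(@ltr_pXn2r _ 2) ?nnegrE ?ltW//.
  by apply/idP/idP => [/set_mem|kr]; [|apply/mem_set]; rewrite /ball3/= dot_sphere_param.
by case: ifPn => _; rewrite ?mul0r// mul1r mulr1; ring.
Qed.

Lemma spherical_cint (F : TR3 R -> R[i]) (r C : R) : 0 < r -> cmeas F ->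
  (forall x, Normc.normc (F x) <= C) ->
  cint (leb2 R) SQ (fun t => (sin t.1)%:C *
    cint (leb R) `]0%R, r[ (fun k => F (k *: sphere_param t) * (k ^+ 2)%:C)) =
  cint (leb3 R) setT (fun x => (\1_(ball3 r) x)%:C * F x).
Proof.
move=> r0 [mF1 mF2] FC; apply: c_ext.
- have b x : `|complex.Re (F x)| <= C by exact: le_trans (ler_cnormRe _) (FC x).
  apply: (etrans _ (etrans (@spherical_ball (fun x => complex.Re (F x)) r C r0 mF1 b) _)).
    apply: eq_Rintegral => t _; rewrite cReZ; congr (_ * _).
    by apply: eq_Rintegral => k _; rewrite cReM/= mulr0 subr0.
  by apply: eq_Rintegral => x _; rewrite cReZ.
- have b x : `|complex.Im (F x)| <= C by exact: le_trans (ler_cnormIm _) (FC x).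
  apply: (etrans _ (etrans (@spherical_ball (fun x => complex.Im (F x)) r C r0 mF2 b) _)).
    apply: eq_Rintegral => t _; rewrite cImZ; congr (_ * _).
    by apply: eq_Rintegral => k _; rewrite cImM/= mulr0 add0r.
  by apply: eq_Rintegral => x _; rewrite cImZ.
Qed.

End spherical_ball.

(** * Cutoff functions and weak derivatives *)

Section flat_functions.
Variable R : realType.

(** For [k = 0] the classical function $e^{-1/x}$ extended by 0. The powers of $1/x$ make the
    family, up to linear combinations, stable under differentiation. *)
Definition flat (k : nat) (x : R) : R := if 0 < x then x^-1 ^+ k * expR (- x^-1) else 0.

Lemma flat_le0 k x : x <= 0 -> flat k x = 0.
Proof. by rewrite /flat ltNge => ->. Qed.

Lemma flat_ge0 k x : 0 <= flat k x.
Proof.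
rewrite /flat; case: ltP => // x0.
by rewrite mulr_ge0 ?expR_ge0// exprn_ge0// invr_ge0 ltW.
Qed.

(** A single term of the exponential series at $1/x$ gives $x^{-(k+2)}\le (k+2)!\,e^{1/x}$.
    Quadratic vanishing at 0 is what makes the derivative there equal to 0. *)
Lemma flat_quadratic k x : flat k x <= (k.+2)`!%:R * x ^+ 2.
Proof.
rewrite /flat; case: ltP => x0; last by rewrite mulr_ge0 ?sqr_ge0.
set f := (k.+2)`!%:R; have f0 : 0 < f by rewrite ltr0n fact_gt0.
have y0 : 0 < x^-1 by rewrite invr_gt0.
have h : x^-1 ^+ k.+2 <= f * expR x^-1.
  have := expR_ge1Dxn k.+1 (ltW y0); rewrite -/f => h.
  by rewrite mulrC -ler_pdivrMr//; apply: le_trans h; rewrite lerDr.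
rewrite expRN ler_pdivrMr ?expR_gt0// mulrAC.
have -> : x^-1 ^+ k = x^-1 ^+ k.+2 * x ^+ 2.
  by rewrite -addn2 exprD -mulrA -exprMn mulVf ?expr1n ?mulr1// lt0r_neq0.
by rewrite ler_wpM2r// sqr_ge0.
Qed.

Lemma is_derive_flat k (x : R) : is_derive x (1 : R) (flat k) (flat k.+2 x - k%:R * flat k.+1 x).
Proof.
have [x0|x0|->] := ltgtP x 0.
- rewrite !flat_le0 ?ltW// mulr0 subr0.
  apply: (@near_eq_is_derive _ _ _ (cst (0 : R))).
  by near=> y; rewrite flat_le0//; near: y; exact: (lt_le_nbhsl x0).
- have -> : flat k.+2 x - k%:R * flat k.+1 x =
      x^-1 ^+ k.+2 * expR (- x^-1) - k%:R * (x^-1 ^+ k.+1 * expR (- x^-1)).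
    by rewrite /flat x0.
  apply: (@near_eq_is_derive _ _ _ (fun y : R => y^-1 ^+ k * expR (- y^-1))).
    by near=> y; rewrite /flat ifT//; near: y; exact: lt_nbhsr.
  have xn := lt0r_neq0 x0.
  have dV : is_derive x 1 (fun y : R => y^-1) (- x^-1 ^+ 2).
    apply: is_derive_eq; first exact: (is_deriveV xn).
    by rewrite /GRing.scale/=; field.
  have dE : is_derive x 1 (fun y : R => expR (- y^-1)) (expR (- x^-1) * x^-1 ^+ 2).
    have dN : is_derive x 1 (fun y : R => - y^-1) (- - x^-1 ^+ 2) by exact: is_deriveN.
    apply: (is_derive_eq (@is_derive1_comp R expR (fun y => - y^-1) x _ _ _ dN)).
    by rewrite opprK.
  have dX := is_deriveX k dV; rewrite exprfctE in dX.
  apply: (is_derive_eq (is_deriveM dX dE)).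
  rewrite /GRing.scale/=; case: (k) => [|j]; first by rewrite expr0; ring.
  by rewrite /= !exprS -mulr_natl; ring.
- rewrite !flat_le0// mulr0 subr0.
  have c : h^-1 *: (flat k (h *: (1 : R) + 0) - flat k 0) @[h --> 0^'] --> (0 : R).
    apply/cvgrPdist_le => e e0; near=> h.
    have hn : h != 0 by near: h; exact: nbhs_dnbhs_neq.
    have C0 : 0 < (k.+2)`!%:R + 1 :> R by rewrite ltr_wpDl.
    have hs : `|h| <= e / ((k.+2)`!%:R + 1).
      near: h; apply: dnbhs0_le; by rewrite divr_gt0.
    rewrite sub0r normrN (flat_le0 k (lexx 0)) subr0 addr0 /GRing.scale/= mulr1.
    rewrite normrM normfV (ger0_norm (flat_ge0 _ _)) mulrC ler_pdivrMr ?normr_gt0//.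
    apply: le_trans (flat_quadratic _ _) _.
    rewrite -(@real_normK _ h) ?num_real// expr2 mulrA ler_wpM2r//.
    apply: (@le_trans _ _ (((k.+2)`!%:R + 1) * `|h|)).
      by rewrite ler_wpM2r// lerDl.
    by rewrite mulrC -ler_pdivlMr.
  by apply: DeriveDef; [apply/cvg_ex; exists 0; exact: c|exact: (cvg_lim _ c)].
Unshelve. all: by end_near. Qed.

End flat_functions.

Section smooth_algebra.
Variable R : realType.
Implicit Types (f g : space3 R -> R) (x v eta : space3 R).

Lemma dotDl x y eta : dot (x + y) eta = dot x eta + dot y eta.
Proof. by rewrite !dotE/=; ring. Qed.

Lemma dotZl (k : R) x eta : dot (k *: x) eta = k * dot x eta.
Proof. by rewrite !dotE/= /GRing.scale/=; ring. Qed.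

(** Along the line through [x] in direction [v] the function depends on one real variable, so the
    one-dimensional chain rule suffices. *)
Lemma is_derive_comp_dot (a a' : R -> R) eta (c : R) x v :
  (forall t : R, is_derive t (1 : R) a (a' t)) ->
  is_derive x v (fun y => a (dot y eta + c)) (dot v eta * a' (dot x eta + c)).
Proof.
move=> da; pose F (h : R) := a (h * dot v eta + (dot x eta + c)).
have dF : is_derive (0 : R) (1 : R) F (dot v eta * a' (dot x eta + c)).
  have dl : is_derive (0 : R) (1 : R) (fun h => h * dot v eta + (dot x eta + c)) (dot v eta).
    by apply: is_derive_eq; rewrite /GRing.scale/=; ring.
  have := @is_derive1_comp R a _ 0 _ _ (da _) dl.
  by rewrite mul0r add0r mulrC.
have E : (fun h : R => h^-1 *: (((fun y => a (dot y eta + c)) \o shift x) (h *: v) -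
           (fun y => a (dot y eta + c)) x)) =
         (fun h : R => h^-1 *: ((F \o shift 0) (h *: (1 : R)) - F 0)).
  apply/funext => h; rewrite /F/= dotDl dotZl mul0r add0r addr0 /GRing.scale/= mulr1.
  by rewrite addrA.
case: dF => d1 d2; apply: DeriveDef; first by rewrite /derivable E.
by rewrite -d2 /derive E.
Qed.

(* The generators are chosen so that this algebra is stable under partial
   derivatives. *)
Inductive smooth_alg : (space3 R -> R) -> Prop :=
| smooth_cst c : smooth_alg (fun=> c)
| smooth_flat k eta c : smooth_alg (fun x => flat k (dot x eta + c))
| smooth_cos eta c : smooth_alg (fun x => cos (dot x eta + c))
| smooth_sin eta c : smooth_alg (fun x => sin (dot x eta + c))
| smooth_add f g : smooth_alg f -> smooth_alg g -> smooth_alg (fun x => f x + g x)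
| smooth_mul f g : smooth_alg f -> smooth_alg g -> smooth_alg (fun x => f x * g x).

Lemma smooth_alg_derive f v : smooth_alg f ->
  exists2 g, smooth_alg g & forall x, is_derive x v f (g x).
Proof.
elim=> {f} [c|k eta c|eta c|eta c|f g sf [f' sf' df] sg [g' sg' dg]|f g sf [f' sf' df] sg [g' sg' dg]].
- by exists (fun=> 0); [exact: smooth_cst|move=> x; exact: is_derive_cst].
- exists (fun x => dot v eta * (flat k.+2 (dot x eta + c) + (- k%:R) * flat k.+1 (dot x eta + c))).
    apply: smooth_mul; first exact: smooth_cst.
    apply: smooth_add; first exact: smooth_flat.
    by apply: smooth_mul; [exact: smooth_cst|exact: smooth_flat].
  move=> x; rewrite mulNr.
  exact: (@is_derive_comp_dot _ (fun t => flat k.+2 t - k%:R * flat k.+1 t) _ _ _ _ (is_derive_flat k)).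
- exists (fun x => dot v eta * (-1 * sin (dot x eta + c))).
    apply: smooth_mul; first exact: smooth_cst.
    by apply: smooth_mul; [exact: smooth_cst|exact: smooth_sin].
  move=> x; rewrite mulN1r.
  exact: (@is_derive_comp_dot _ (fun t => - sin t) _ _ _ _ (@is_derive_cos R)).
- exists (fun x => dot v eta * cos (dot x eta + c)).
    by apply: smooth_mul; [exact: smooth_cst|exact: smooth_cos].
  move=> x; exact: (@is_derive_comp_dot _ (@cos R) _ _ _ _ (@is_derive_sin R)).
- exists (fun x => f' x + g' x); first exact: smooth_add.
  by move=> x; exact: is_deriveD.
- exists (fun x => f x * g' x + g x * f' x).
    by apply: smooth_add; apply: smooth_mul.
  by move=> x; exact: is_deriveM.
Qed.

Lemma continuous_dot eta (c : R) : continuous (fun x => dot x eta + c).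
Proof.
move=> x; rewrite (_ : (fun x => _) = fun x : space3 R => x.1.1 * eta.1.1 + x.1.2 * eta.1.2 + x.2 * eta.2 + c); last first.
  by apply/funext => y; rewrite dotE.
have c1 : x0.1 @[x0 --> x] --> x.1 by exact: cvg_fst.
have c2 : x0.2 @[x0 --> x] --> x.2 by exact: cvg_snd.
have c11 : x0.1.1 @[x0 --> x] --> x.1.1 by apply: cvg_comp c1 _; exact: cvg_fst.
have c12 : x0.1.2 @[x0 --> x] --> x.1.2 by apply: cvg_comp c1 _; exact: cvg_snd.
by apply: cvgD (cvg_cst _); apply: cvgD; [apply: cvgD|]; apply: cvgM => //; exact: cvg_cst.
Qed.

Lemma continuous_flat k : continuous (@flat R k).
Proof. exact: is_derive_continuous (is_derive_flat k). Qed.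

Lemma continuous_smooth_alg f : smooth_alg f -> continuous f.
Proof.
elim=> {f} [c|k eta c|eta c|eta c|f g _ cf _ cg|f g _ cf _ cg] x.
- exact: cvg_cst.
- have h := @continuous_comp _ _ _ (fun x : space3 R => dot x eta + c) (@flat R k) x
    (@continuous_dot eta c x) (@continuous_flat k _).
  exact: h.
- have h := @continuous_comp _ _ _ (fun x : space3 R => dot x eta + c) (@cos R) x
    (@continuous_dot eta c x) (@continuous_cos R _).
  exact: h.
- have h := @continuous_comp _ _ _ (fun x : space3 R => dot x eta + c) (@sin R) x
    (@continuous_dot eta c x) (@continuous_sin R _).
  exact: h.
- by apply: cvgD; [exact: cf|exact: cg].
- by apply: cvgM; [exact: cf|exact: cg].
Qed.

Lemma measurable_smooth_alg f : smooth_alg f -> measurable_fun (setT : set (TR3 R)) f.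
Proof.
have md eta (c : R) : measurable_fun (setT : set (TR3 R)) (fun x => dot x eta + c).
  apply: mf_add; last exact: mf_cst.
  by apply: measurable_dot; [exact: mf_id|exact: measurable_cst].
elim=> {f} [c|k eta c|eta c|eta c|f g _ mf _ mg|f g _ mf _ mg].
- exact: measurable_cst.
- apply: (measurableT_comp _ (md eta c)); apply: continuous_measurable_fun.
  exact: continuous_flat.
- exact: mf_cos.
- exact: mf_sin.
- exact: mf_add.
- exact: mf_mul.
Qed.

Lemma smooth_algP f : smooth_alg f -> smooth f.
Proof.
move=> sf; suff h (s : seq 'I_3) : smooth_alg (iter_partial s f).
  move=> s; split; first exact: continuous_smooth_alg.
  by move=> i x; have [g _ dg] := smooth_alg_derive (basis3 R i) (h s); have [] := dg x.
elim: s => //= i s h.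
have [g sg dg] := smooth_alg_derive (basis3 R i) h.
by rewrite (_ : 'D_(basis3 R i) _ = g)//; apply/funext => x; have [_] := dg x.
Qed.

End smooth_algebra.

Section dominated.
Context d (T : measurableType d) (R : realType) (m : {measure set T -> \bar R}).

Lemma dominated_Rintegral (u : nat -> T -> R) (v w : T -> R) (C : R) :
  (forall n, measurable_fun setT (u n)) -> measurable_fun setT v ->
  (forall n x, `|u n x| <= C) -> (forall x, u n x @[n --> \oo] --> v x) ->
  m.-integrable setT (fun x => (w x)%:E) ->
  \int[m]_x (u n x * w x) @[n --> \oo] --> \int[m]_x (v x * w x).
Proof.
move=> mu mv uC uv iw; have mw : measurable_fun setT w by apply/measurable_EFinP; exact: measurable_int iw.
have iC := integrableZl_EFin C (integrable_norm iw).
have ub n x : `|u n x * w x| <= C * `|w x| by rewrite normrM ler_wpM2r.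
have vb x : `|v x * w x| <= C * `|w x|.
  rewrite normrM ler_wpM2r//; apply: (cvgr_to_le (cvg_norm (uv x))).
  by apply: nearW => n; exact: uC.
have iv : m.-integrable setT (fun x => (v x * w x)%:E).
  apply: (le_integrable _ _ _ iC) => //; first by apply: mf_EFin; exact: mf_mul.
  by move=> x _ /=; rewrite lee_fin (le_trans (vb x))// ler_norm.
have [] := @dominated_convergence _ _ _ m setT measurableT (fun n x => (u n x * w x)%:E)
  (fun x => (v x * w x)%:E) (fun x => (C * `|w x|)%:E) _ _ _ iC _.
- by move=> n; apply: mf_EFin; exact: mf_mul.
- by apply: mf_EFin; exact: mf_mul.
- apply: aeW => x _; apply/fine_cvgP; split; first exact: nearW.
  by apply: cvgM; [exact: uv|exact: cvg_cst].
- by apply: aeW => x n _; rewrite /= lee_fin.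
move=> _ _ h; have : fine (\int[m]_x (u n x * w x)%:E)%E @[n --> \oo] --> fine (\int[m]_x (v x * w x)%:E)%E.
  apply: fine_cvg; rewrite fineK; last exact: integrable_fin_num.
  exact: h.
exact.
Qed.

Lemma dominated_cint (u : nat -> T -> R) (v : T -> R) (w : T -> R[i]) (C : R) :
  (forall n, measurable_fun setT (u n)) -> measurable_fun setT v ->
  (forall n x, `|u n x| <= C) -> (forall x, u n x @[n --> \oo] --> v x) ->
  cintegrable m w ->
  complex.Re (cint m setT (fun x => (u n x)%:C * w x)) @[n --> \oo] -->
    complex.Re (cint m setT (fun x => (v x)%:C * w x)) /\
  complex.Im (cint m setT (fun x => (u n x)%:C * w x)) @[n --> \oo] -->
    complex.Im (cint m setT (fun x => (v x)%:C * w x)).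
Proof.
move=> mu mv uC uv [w1 w2]; split; rewrite /cint/=.
- rewrite (_ : \int[m]_x _ = \int[m]_x (v x * complex.Re (w x))); last first.
    by apply: eq_Rintegral => x _; rewrite cReZ.
  rewrite (_ : (fun n => _) = fun n => \int[m]_x (u n x * complex.Re (w x))).
    exact: dominated_Rintegral uv w1.
  by apply/funext => n; apply: eq_Rintegral => x _; rewrite cReZ.
- rewrite (_ : \int[m]_x _ = \int[m]_x (v x * complex.Im (w x))); last first.
    by apply: eq_Rintegral => x _; rewrite cImZ.
  rewrite (_ : (fun n => _) = fun n => \int[m]_x (u n x * complex.Im (w x))).
    exact: dominated_Rintegral uv w2.
  by apply/funext => n; apply: eq_Rintegral => x _; rewrite cImZ.
Qed.

End dominated.

(** * Cutoffs with small derivative on a given cube *)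

Section flat_limits.
Variable R : realType.

Lemma flat0_le1 (t : R) : flat 0 t <= 1.
Proof.
rewrite /flat; case: ltP => // t0; rewrite expr0 mul1r -expR0 ler_expR.
by rewrite oppr_le0 invr_ge0 ltW.
Qed.

Lemma flat2_le (t : R) : flat 2 t <= t^-1 ^+ 2.
Proof.
rewrite /flat; case: ltP => [t0|_]; last exact: sqr_ge0.
rewrite ler_piMr ?sqr_ge0//.
by have := flat0_le1 t; rewrite /flat t0 expr0 mul1r.
Qed.

Lemma flat0_ge (t : R) : 0 < t -> 1 - t^-1 <= flat 0 t.
Proof. by move=> t0; rewrite /flat t0 expr0 mul1r expR_ge1Dx. Qed.

(** From $1-1/t\le e^{-1/t}\le 1$: an argument that grows at least linearly forces the limit 1. *)
Lemma flat0_cvg1 (y : nat -> R) (d : R) : 0 < d -> (forall n, n.+1%:R * d <= y n) ->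
  flat 0 (y n) @[n --> \oo] --> (1 : R).
Proof.
move=> d0 yd; have b n : `|1 - flat 0 (y n)| <= d^-1 * harmonic n.
  have n0 : 0 < n.+1%:R :> R by rewrite ltr0n.
  have y0 : 0 < y n by apply: lt_le_trans (yd n); rewrite mulr_gt0.
  rewrite ger0_norm ?subr_ge0 ?flat0_le1//.
  rewrite lerBlDr -lerBlDl; apply: le_trans (flat0_ge y0).
  by rewrite lerB// /= mulrC -invfM lef_pV2 ?posrE ?mulr_gt0.
have h : d^-1 * harmonic n @[n --> \oo] --> (0 : R).
  by rewrite -[X in _ --> X](mulr0 d^-1); apply: cvgMr; exact: cvg_harmonic.
apply/cvgrPdist_le => e e0; move/cvgr0Pnorm_le/(_ _ e0): h; apply: filterS => n hn.
by apply: le_trans (b n) _; apply: le_trans hn; exact: ler_norm.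
Qed.

End flat_limits.

Section cutoff.
Variables (R : realType) (N L : R).
Hypotheses (N0 : 0 <= N) (NL : N + 1 <= L).

(* The second factor is shifted by [n.+1] so that the limit is the indicator of
   the half-open interval also at its right end point. *)
Definition edge (n : nat) (t : R) : R :=
  flat 0 (n.+1%:R * t + n.+1%:R * L) *
  flat 0 (- n.+1%:R ^+ 2 * t + (n.+1%:R ^+ 2 * L + n.+1%:R)).

Lemma edge_cvg (t : R) : edge n t @[n --> \oo] --> (\1_(`]- L, L]%classic) t : R).
Proof.
rewrite indicE; have [tL|Lt] := leP t (- L).
  rewrite memNset; last by rewrite /= in_itv/= ltNge tL.
  apply: cvg_near_cst; apply: nearW => n; rewrite /edge flat_le0 ?mul0r//.
  by rewrite -mulrDr mulr_ge0_le0// -lerBrDr sub0r.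
have c1 : flat 0 (n.+1%:R * t + n.+1%:R * L) @[n --> \oo] --> (1 : R).
  apply: (@flat0_cvg1 _ _ (t + L)); first by rewrite -(opprK L) subr_gt0.
  by move=> n; rewrite mulrDr.
have [tL|tL] := leP t L.
  rewrite mem_set; last by rewrite /= in_itv/= Lt.
  rewrite -[X in _ --> X](mulr1 (1 : R)); apply: cvgM => //.
  apply: (@flat0_cvg1 _ _ 1) => // n; rewrite mulr1 addrA lerDr mulNr addrC.
  by rewrite -mulrBr mulr_ge0 ?sqr_ge0// subr_ge0.
rewrite memNset; last by rewrite /= in_itv/= Lt/= leNgt tL.
have [n nt] : exists n : nat, (t - L)^-1 < n%:R.
  by exists (Num.bound (t - L)^-1); rewrite archi_boundP// invr_ge0 subr_ge0 ltW.
have tL0 : 0 < t - L by rewrite subr_gt0.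
apply: cvg_near_cst; exists n => // k /= nk; rewrite /edge [X in _ * X]flat_le0 ?mulr0//.
have -> : - k.+1%:R ^+ 2 * t + (k.+1%:R ^+ 2 * L + k.+1%:R) =
   k.+1%:R * (1 - k.+1%:R * (t - L)) by ring.
rewrite mulr_ge0_le0// subr_le0.
have := ltW nt; rewrite -[X in X <= _]mul1r ler_pdivrMr// => /le_trans; apply.
by rewrite ler_wpM2r ?(ltW tL0)// ler_nat leqW.
Qed.

Definition cutoff (n : nat) (x : space3 R) : R :=
  edge n x.1.1 * edge n x.1.2 * edge n x.2.

Lemma cutoff_cvg (x : TR3 R) : cutoff n x @[n --> \oo] --> (\1_(cube L) x : R).
Proof.
have -> : \1_(cube L) x = \1_(`]- L, L]%classic) x.1.1 * \1_(`]- L, L]%classic) x.1.2 *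
   \1_(`]- L, L]%classic) x.2 :> R.
  transitivity (complex.Re (box (- L, - L, - L) (L, L, L) x)); first by rewrite box_cube.
  by rewrite /box /ind !cE/=; ring.
by apply: cvgM; [apply: cvgM|]; exact: edge_cvg.
Qed.

(** The derivative is bounded only on [cube N], where the function under test lives; near the faces
    of [cube L] it may be large. Values in $[0,1]$ make the bounds add up under products. *)
Definition tame (i : 'I_3) (u : space3 R -> R) (c : R) :=
  [/\ smooth_alg u, forall x, 0 <= u x <= 1 &
   exists2 u', smooth_alg u' & (forall x, is_derive x (basis3 R i) u (u' x)) /\
     forall x, cube N x -> `|u' x| <= c].

Lemma tameM i u v c d : tame i u c -> tame i v d -> tame i (fun x => u x * v x) (c + d).
Proof.
move=> [su u01 [u' su' [du bu]]] [sv v01 [v' sv' [dv bv]]]; split.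
- exact: smooth_mul.
- move=> x; have /andP[u0 u1] := u01 x; have /andP[v0 v1] := v01 x.
  by rewrite mulr_ge0//= mulr_ile1.
exists (fun x => u x * v' x + v x * u' x).
  by apply: smooth_add; exact: smooth_mul.
split; first by move=> x; exact: is_deriveM.
move=> x Nx; have /andP[u0 u1] := u01 x; have /andP[v0 v1] := v01 x.
rewrite (le_trans (ler_normD _ _))// addrC lerD// normrM ger0_norm//.
- by apply: le_trans (bu x Nx); rewrite ler_piMl.
- by apply: le_trans (bv x Nx); rewrite ler_piMl.
Qed.

Lemma tame_flat i (j : 'I_3) (s c e : R) :
  (forall x, cube N x -> `|s| * flat 2 (s * coord3 x j + c) <= e) ->
  tame i (fun x => flat 0 (s * coord3 x j + c)) e.
Proof.
move=> be; have dE x : dot x (s *: basis3 R j) = s * coord3 x j.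
  rewrite dotE /GRing.scale/= /GRing.scale/= /coord3.
  by case: j {be} => -[|[|[|//]]] hj /=; ring.
have E k : (fun x => flat k (s * coord3 x j + c)) = (fun x => flat k (dot x (s *: basis3 R j) + c)).
  by apply/funext => x; rewrite dE.
split.
- by rewrite E; exact: smooth_flat.
- by move=> x; rewrite flat_ge0 flat0_le1.
exists (fun x => s * coord3 (basis3 R i) j * flat 2 (dot x (s *: basis3 R j) + c)).
  by apply: smooth_mul; [exact: smooth_cst|exact: smooth_flat].
split.
  move=> x; rewrite E -dE.
  have d0 (t : R) : is_derive t (1 : R) (flat 0) (flat 2 t).
    by have := is_derive_flat 0 t; rewrite mul0r subr0.
  exact: is_derive_comp_dot.
move=> x Nx; rewrite dE normrM (ger0_norm (flat_ge0 _ _)).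
apply: le_trans (be x Nx); rewrite ler_wpM2r ?flat_ge0// normrM ler_piMr//.
rewrite /basis3 /coord3 /=.
by case: eqP => _; [|case: eqP => _]; case: eqP => _; rewrite ?normr0 ?normr1.
Qed.

(** With $m=n+1$, the margin $L-N\ge 1$ makes the two arguments at least $m$ and $m^2$ on [cube N].
    By $\mathrm{flat}_2(t)\le t^{-2}$ the slopes are at most $m\cdot m^{-2}$ and $m^2\cdot m^{-4}$,
    both below $1/m$. *)
Lemma tame_edge i (j : 'I_3) n : tame i (fun x => edge n (coord3 x j)) (2 * (n.+1%:R)^-1).
Proof.
have -> : 2 * n.+1%:R^-1 = n.+1%:R^-1 + n.+1%:R^-1 :> R by ring.
have m0 : 0 < n.+1%:R :> R by rewrite ltr0n.
have m1 : 1 <= n.+1%:R :> R by rewrite ler1n.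
set m : R := n.+1%:R in m0 m1 *.
have cx x : cube N x -> - N < coord3 x j /\ coord3 x j <= N.
  move=> [[/= h1 h2] h3]; rewrite !in_itv/= in h1 h2 h3; rewrite /coord3.
  by case: eqP => _; [|case: eqP => _]; apply/andP.
apply: tameM; apply: tame_flat => x Nx; have [x1 x2] := cx x Nx.
- set y := m * _ + _; have y0 : m <= y.
    rewrite /y -mulrDr ler_peMr ?(ltW m0)//; move: NL x1; lra.
  rewrite gtr0_norm//; apply: le_trans (ler_wpM2l (ltW m0) (flat2_le _)) _.
  have yp : 0 < y by exact: lt_le_trans y0.
  have h2 : y^-1 <= m^-1 by rewrite lef_pV2 ?posrE.
  apply: (@le_trans _ _ (m * m^-1 ^+ 2)).
    by rewrite (ler_wpM2l (ltW m0))// lerXn2r ?nnegrE ?invr_ge0 ?(ltW m0) ?(ltW yp).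
  by rewrite expr2 mulrA mulfV ?mul1r// lt0r_neq0.
- set y := _ * _ + _; have mm0 : 0 < m ^+ 2 by rewrite exprn_gt0.
  have y0 : m ^+ 2 <= y.
    have -> : y = m ^+ 2 * (L - coord3 x j) + m by rewrite /y; ring.
    apply: (@le_trans _ _ (m ^+ 2 * (L - coord3 x j))); last by rewrite lerDl ltW.
    by rewrite ler_peMr ?(ltW mm0)//; move: NL x2; lra.
  rewrite normrN gtr0_norm//; apply: le_trans (ler_wpM2l (ltW mm0) (flat2_le _)) _.
  have yp : 0 < y by exact: lt_le_trans y0.
  have h2 : y^-1 <= (m ^+ 2)^-1 by rewrite lef_pV2 ?posrE.
  apply: (@le_trans _ _ (m ^+ 2 * (m ^+ 2)^-1 ^+ 2)).
    by rewrite (ler_wpM2l (ltW mm0))// lerXn2r ?nnegrE ?invr_ge0 ?(ltW mm0) ?(ltW yp).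
  rewrite [in X in _ * X]expr2 mulrA mulfV ?mul1r ?lt0r_neq0// lef_pV2 ?posrE//.
  by rewrite expr2 ler_peMl// ltW.
Qed.

(** The constant 6 counts two edge factors for each of the three coordinates. *)
Lemma tame_cutoff i n : tame i (cutoff n) (6 * (n.+1%:R)^-1).
Proof.
have -> : 6 * n.+1%:R^-1 = 2 * n.+1%:R^-1 + 2 * n.+1%:R^-1 + 2 * n.+1%:R^-1 :> R by ring.
by apply: tameM; [apply: tameM|];
  [exact: (tame_edge i 0 n)|exact: (tame_edge i 1 n)|exact: (tame_edge i 2%:R n)].
Qed.

Lemma cutoff_out n x : ~ cube (L + 1) x -> cutoff n x = 0.
Proof.
have m1 : 1 <= n.+1%:R :> R by rewrite ler1n.
have e t : ~ (- (L + 1) < t <= L + 1) -> edge n t = 0.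
  move=> /negP; rewrite negb_and -ltNge -leNgt /edge => /orP[tL|tL].
    rewrite flat_le0 ?mul0r// -mulrDr mulr_ge0_le0//; move: tL; lra.
  rewrite [X in _ * X]flat_le0 ?mulr0//.
  have -> : - n.+1%:R ^+ 2 * t + (n.+1%:R ^+ 2 * L + n.+1%:R) =
    n.+1%:R * (1 - n.+1%:R * (t - L)) by ring.
  rewrite mulr_ge0_le0// subr_le0 mulr_ege1//; move: tL; lra.
move=> nx; rewrite /cutoff.
have [h1|/e ->] := pselect (- (L + 1) < x.1.1 <= L + 1); last by rewrite !mul0r.
have [h2|/e ->] := pselect (- (L + 1) < x.1.2 <= L + 1); last by rewrite mulr0 mul0r.
have [h3|/e ->] := pselect (- (L + 1) < x.2 <= L + 1); last by rewrite mulr0.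
by exfalso; apply: nx; split; [split|]; rewrite /= in_itv.
Qed.

Lemma test_function_cutoff n e : smooth_alg e -> test_function (fun x => cutoff n x * e x).
Proof.
move=> se; have [sc _ _] := tame_cutoff 0 n; split.
  by apply: smooth_algP; exact: smooth_mul.
exists (`[- (L + 1), L + 1] `*` `[- (L + 1), L + 1] `*` `[- (L + 1), L + 1]).
  by do 2? apply: compact_setX; exact: segment_compact.
move=> x nx; rewrite cutoff_out ?mul0r// => -[[/= h1 h2] h3]; apply: nx.
move: h1 h2 h3; rewrite !in_itv/= => /andP[/ltW h1 h1'] /andP[/ltW h2 h2'] /andP[/ltW h3 h3'].
by split; [split|]; rewrite /= in_itv/= ?h1 ?h2 ?h3.
Qed.

End cutoff.

Lemma cube_subset (R : realType) (N M : R) : N <= M -> cube N `<=` cube M.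
Proof.
move=> NM x [[/=]]; rewrite !in_itv/= => /andP[a1 a2] /andP[a3 a4] /andP[a5 a6].
have h t : - N < t -> t <= N -> - M < t <= M.
  by move=> t1 t2; rewrite (le_lt_trans _ t1) ?lerN2//= (le_trans t2).
by split; [split|]; rewrite /= in_itv/= h.
Qed.

(** * Transforms of weak derivatives *)

Section weak_fourier.
Variables (R : realType) (N L : R) (i : 'I_3) (f0 f g : TR3 R -> R[i]).
Hypotheses (N0 : 0 <= N) (NL : N + 1 <= L).
Hypotheses (lf : L2cube N f) (mg : cmeas g).
Hypothesis ig : (leb3 R).-integrable setT (fun x => (csq (g x))%:E).
Hypotheses (mf0 : cmeas f0) (f0f : {ae leb3 R, forall x, f0 x = f x}).
Hypothesis fg : is_weak_partial i f0 g.

Lemma L2cube_cut M : L2cube M (fun x => (\1_(cube M) x)%:C * g x).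
Proof.
split.
- by apply: cmeasM => //; apply/cmeasR/mf_indic; exact: measurable_cube.
- apply: (le_integrable _ _ _ ig) => //.
    apply/mf_EFin/measurable_csq/cmeasM => //.
    by apply/cmeasR/mf_indic; exact: measurable_cube.
  move=> x _ /=; rewrite lee_fin !ger0_norm ?csq_ge0// csqM csq_real ler_piMl ?csq_ge0//.
- by move=> x nx; rewrite indicE memNset// mul0r.
Qed.

(* The weak derivative is tested against [cutoff L n * e], where the derivative
   of the cutoff is O(1 / n) on the support of [f]. *)
Lemma weak_partial_smooth (e e' : space3 R -> R) (B : R) :
  smooth_alg e -> smooth_alg e' -> (forall x, is_derive x (basis3 R i) e (e' x)) ->
  (forall x, `|e x| <= 1) -> (forall x, `|e' x| <= B) ->
  cint (leb3 R) setT (fun x => (e' x)%:C * f x) =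
  - cint (leb3 R) setT (fun x => (e x)%:C * ((\1_(cube L) x)%:C * g x)).
Proof.
move=> se se' de e1 eB.
have tc n := tame_cutoff NL i n.
have /choice[c' hc'] : forall n, exists c', smooth_alg c' /\
    ((forall x, is_derive x (basis3 R i) (cutoff L n) (c' x)) /\
     forall x, cube N x -> `|c' x| <= 6 * n.+1%:R^-1).
  by move=> n; have [_ _ [c' sc' h]] := tc n; exists c'.
(* The derivative of the test function, with the term from the cutoff restricted to [cube N].
   Against [f] nothing changes, and [u n] becomes bounded uniformly in [n] and converges pointwise
   to [v]. *)
pose u n (x : TR3 R) : R := \1_(cube N) x * (e x * c' n x) + cutoff L n x * e' x.
pose v (x : TR3 R) : R := \1_(cube L) x * e' x.
pose p n (x : TR3 R) : R := cutoff L n x * e x.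
pose q (x : TR3 R) : R := \1_(cube L) x * e x.
have mcut n : measurable_fun (setT : set (TR3 R)) (cutoff L n).
  by have [sc _ _] := tc n; exact: measurable_smooth_alg.
have mc' n : measurable_fun (setT : set (TR3 R)) (c' n).
  by have [sc _] := hc' n; exact: measurable_smooth_alg.
have me := measurable_smooth_alg se; have me' := measurable_smooth_alg se'.
have mI M : measurable_fun (setT : set (TR3 R)) (\1_(cube M) : TR3 R -> R).
  by apply: mf_indic; exact: measurable_cube.
have cut01 n x : `|cutoff L n x| <= 1.
  by have [_ /(_ x)/andP[c0 c1] _] := tc n; rewrite ger0_norm.
have in1 (M : R) (x : TR3 R) : `|(\1_(cube M) x : R)| <= 1.
  by rewrite indicE; case: (_ \in _); rewrite ?normr1 ?normr0.
have m1 n : (0 : R) < (n.+1%:R^-1 : R) <= (1 : R).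
  by rewrite invr_gt0 ltr0n invf_le1 ?ltr0n// ler1n.
have c'1 n x : `|\1_(cube N) x * (e x * c' n x)| <= 6 * n.+1%:R^-1.
  have [_ [_ bc]] := hc' n; have /andP[n0 _] := m1 n.
  rewrite indicE; have [/set_mem Nx|_] := boolP (x \in cube N); last first.
    by rewrite mul0r normr0 mulr_ge0// ltW.
  by rewrite mul1r normrM; apply: le_trans (bc x Nx); rewrite ler_piMl.
have h1 n : cint (leb3 R) setT (fun x => (u n x)%:C * f x) =
    - cint (leb3 R) setT (fun x => (p n x)%:C * ((\1_(cube (L + 1)) x)%:C * g x)).
  have [_ [dc _]] := hc' n.
  have dp x : 'D_(basis3 R i) (p n) x = cutoff L n x * e' x + e x * c' n x.
    have dx := dc x; have dex := de x.
    have [_ ->] := @is_deriveM _ _ (cutoff L n) e _ _ _ _ dx dex.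
    by [].
  have mD : cmeas (fun x : TR3 R => ('D_(basis3 R i) (p n) x)%:C).
    apply: cmeasR; rewrite (funext dp); apply: mf_add; exact: mf_mul.
  have [mf _ _] := lf.
  transitivity (cint (leb3 R) setT (fun x => f0 x * ('D_(basis3 R i) (p n) x)%:C)); last first.
    rewrite (fg (test_function_cutoff NL n se)); congr (- _); congr cint; apply/funext => x.
    rewrite -/(p n x) indicE; have [_|xN] := boolP (x \in cube (L + 1)).
      by rewrite mul1r mulrC.
    rewrite mul0r mulr0 /p cutoff_out ?mul0r ?mulr0//.
    by move/negP: xN => + Nx; apply; exact: mem_set.
  transitivity (cint (leb3 R) setT (fun x => f x * ('D_(basis3 R i) (p n) x)%:C)); last first.
    apply: ae_eq_cint; [exact: cmeasM|exact: cmeasM|].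
    by apply: filterS f0f => x ->.
  congr cint; apply/funext => x; rewrite dp mulrC /u indicE.
  have [_ _ fout] := lf; have [xN|xN] := boolP (x \in cube N); last first.
    by rewrite fout ?mul0r ?mulr0//; move/negP: xN => + Nx; apply; exact: mem_set.
  by rewrite mul1r addrC.
have B0 : 0 <= B by exact: (le_trans (normr_ge0 _) (eB 0)).
have ub n x : `|u n x| <= 6 + B.
  rewrite (le_trans (ler_normD _ _))// lerD//.
    by apply: le_trans (c'1 n x) _; have /andP[_ n1] := m1 n; rewrite ler_piMr.
  by rewrite normrM -[leRHS]mul1r ler_pM.
have pb n x : `|p n x| <= 1 by rewrite normrM mulr_ile1.
have uv x : u n x @[n --> \oo] --> v x.
  rewrite -[v x]add0r; apply: cvgD; last first.
    by apply: cvgM; [exact: cutoff_cvg|exact: cvg_cst].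
  have h : 6 * harmonic n @[n --> \oo] --> (0 : R).
    by rewrite -[X in _ --> X](mulr0 (6 : R)); apply: cvgMr; exact: cvg_harmonic.
  apply/cvgr0Pnorm_le => d d0; move/cvgr0Pnorm_le/(_ _ d0): h; apply: filterS => n hn.
  by apply: le_trans (c'1 n x) _; apply: le_trans hn; exact: ler_norm.
have pq x : p n x @[n --> \oo] --> q x.
  by apply: cvgM; [exact: cutoff_cvg|exact: cvg_cst].
have mu n : measurable_fun (setT : set (TR3 R)) (u n).
  by apply: mf_add; apply: mf_mul => //; exact: mf_mul.
have mv : measurable_fun (setT : set (TR3 R)) v by exact: mf_mul.
have mp n : measurable_fun (setT : set (TR3 R)) (p n) by exact: mf_mul.
have mq : measurable_fun (setT : set (TR3 R)) q by exact: mf_mul.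
have [r1 r2] := dominated_cint mu mv ub uv (L2cube_integrable lf).
have [s1 s2] := dominated_cint mp mq pb pq (L2cube_integrable (L2cube_cut (L + 1))).
have uniq (a b : nat -> R) (l l' : R) : (forall n, a n = - b n) ->
    a n @[n --> \oo] --> l -> b n @[n --> \oo] --> l' -> l = - l'.
  move=> ab al bl; apply: (cvg_unique (@norm_hausdorff _ _) al).
  by rewrite (funext ab); exact: cvgN.
have LN : cube N `<=` cube L by apply: cube_subset; move: NL; lra.
have LL : cube L `<=` cube (L + 1) by apply: cube_subset; lra.
have -> : (fun x => (e' x)%:C * f x) = (fun x => (v x)%:C * f x).
  apply/funext => x; rewrite /v indicE; have [_ _ fout] := lf.
  have [xN|xN] := boolP (x \in cube L); first by rewrite mul1r.
  rewrite fout ?mulr0// => Nx; move/negP: xN; apply; apply/mem_set; exact: LN.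
have -> : (fun x => (e x)%:C * ((\1_(cube L) x)%:C * g x)) =
    (fun x => (q x)%:C * ((\1_(cube (L + 1)) x)%:C * g x)).
  apply/funext => x; rewrite /q !indicE.
  have [xN|xN] := boolP (x \in cube L); last by rewrite !mul0r mulr0.
  by rewrite (mem_set (LL _ (set_mem xN))) !mul1r.
apply: c_ext; rewrite cE; [apply: uniq r1 s1|apply: uniq r2 s2] => n;
  by rewrite h1 cE.
Qed.

Lemma cintegrable_comp_dot (b : R -> R) (h : TR3 R -> R[i]) xi : continuous b ->
  (forall t, `|b t| <= 1) -> cintegrable (leb3 R) h ->
  cintegrable (leb3 R) (fun x => (b (dot x xi))%:C * h x).
Proof.
move=> cb b1 ih; have md : measurable_fun (setT : set (TR3 R)) (fun x => dot x xi).
  by apply: measurable_dot; [exact: mf_id|exact: measurable_cst].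
have mb : measurable_fun (setT : set (TR3 R)) (fun x => b (dot x xi)).
  by apply: (measurableT_comp _ md); exact: continuous_measurable_fun.
apply: (le_cintegrable _ (cintegrable_norm ih)).
  by apply: cmeasM; [exact: (cmeasR mb)|exact: (cintegrable_meas ih)].
by move=> x; rewrite cnormM cnorm_real ler_piMl// cnorm_ge0.
Qed.

Lemma fourier_cos_sin (h : TR3 R -> R[i]) xi : cintegrable (leb3 R) h ->
  fourier h xi = cint (leb3 R) setT (fun x => (cos (dot x xi))%:C * h x) -
    'i * cint (leb3 R) setT (fun x => (sin (dot x xi))%:C * h x).
Proof.
move=> ih.
have ic := cintegrable_comp_dot xi (@continuous_cos R) (@cos_max R) ih.
have isn := cintegrable_comp_dot xi (@continuous_sin R) (@sin_max R) ih.
rewrite -(cintZ _ isn) -(cintB ic (cintegrableZ _ isn)).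
congr cint; apply/funext => x; apply: c_ext; rewrite !cE/= ?cosN ?sinN; ring.
Qed.

(** Testing against cosine and sine gives the two real identities that combine to multiplication by
    $i\xi_i$. As [g] is only square integrable on the whole space, it is cut to [cube L] to have a
    transform; the result does not depend on [L]. *)
Lemma fourier_weak_partial xi :
  fourier (fun x => (\1_(cube L) x)%:C * g x) xi = 'i * (coord3 xi i)%:C * fourier f xi.
Proof.
have ifn := L2cube_integrable lf; have ign := L2cube_integrable (L2cube_cut L).
have db : dot (basis3 R i) xi = coord3 xi i.
  by rewrite dotE /basis3 /coord3/=; case: (i) => -[|[|[|//]]] hi /=; ring.
have sN := @smooth_sin R xi 0; have cN := @smooth_cos R xi 0.
have cx c : smooth_alg (fun=> c : R) by exact: smooth_cst.
have dc x : is_derive x (basis3 R i) (fun y => cos (dot y xi + 0)) (coord3 xi i * - sin (dot x xi + 0)).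
  by rewrite -db; exact: (@is_derive_comp_dot _ _ (fun t => - sin t) _ _ _ _ (@is_derive_cos R)).
have ds x : is_derive x (basis3 R i) (fun y => sin (dot y xi + 0)) (coord3 xi i * cos (dot x xi + 0)).
  by rewrite -db; exact: (@is_derive_comp_dot _ _ (@cos R) _ _ _ _ (@is_derive_sin R)).
have s1 : smooth_alg (fun x => coord3 xi i * - sin (dot x xi + 0)).
  apply: smooth_mul => //; rewrite (_ : (fun x => _) = fun x => -1 * sin (dot x xi + 0)).
    exact: smooth_mul.
  by apply/funext => x; rewrite mulN1r.
have s2 : smooth_alg (fun x => coord3 xi i * cos (dot x xi + 0)) by exact: smooth_mul.
have e1 := @weak_partial_smooth _ _ `|coord3 xi i| cN s1 dc (fun x => cos_max _)
  (fun x => ltac:(rewrite normrM normrN ler_piMr//; exact: sin_max)).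
have e2 := @weak_partial_smooth _ _ `|coord3 xi i| sN s2 ds (fun x => sin_max _)
  (fun x => ltac:(rewrite normrM ler_piMr//; exact: cos_max)).
have ic := cintegrable_comp_dot xi (@continuous_cos R) (@cos_max R) ifn.
have isn := cintegrable_comp_dot xi (@continuous_sin R) (@sin_max R) ifn.
rewrite (fourier_cos_sin xi ifn) (fourier_cos_sin xi ign).
set k := coord3 xi i in e1 e2 *.
have E1 : (- k)%:C * cint (leb3 R) setT (fun x => (sin (dot x xi))%:C * f x) =
    - cint (leb3 R) setT (fun x => (cos (dot x xi))%:C * ((\1_(cube L) x)%:C * g x)).
  rewrite -(cintZ _ isn); move: e1; under [in X in _ = - X -> _]eq_fun do rewrite addr0.
  move=> <-; congr cint; apply/funext => x; rewrite addr0.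
  by apply: c_ext; rewrite !cE/=; ring.
have E2 : k%:C * cint (leb3 R) setT (fun x => (cos (dot x xi))%:C * f x) =
    - cint (leb3 R) setT (fun x => (sin (dot x xi))%:C * ((\1_(cube L) x)%:C * g x)).
  rewrite -(cintZ _ ic); move: e2; under [in X in _ = - X -> _]eq_fun do rewrite addr0.
  move=> <-; congr cint; apply/funext => x; rewrite addr0.
  by apply: c_ext; rewrite !cE/=; ring.
move: E1 E2; set A := cint _ _ _; set B := cint _ _ _; set C := cint _ _ _; set D := cint _ _ _.
move=> /(congr1 -%R); rewrite opprK => <- /(congr1 -%R); rewrite opprK => <-.
by apply: c_ext; rewrite !cE/=; ring.
Qed.

End weak_fourier.

(* The restrictions of [g] to the cubes of half-sides [N + 1] and [N + 1 + k]
   have the same Fourier transform, hence agree by Parseval's identity. *)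
Lemma weak_partial_ae (R : realType) (N : R) (i : 'I_3) (f0 f g : TR3 R -> R[i]) :
  0 <= N -> L2cube N f -> cmeas g -> (leb3 R).-integrable setT (fun x => (csq (g x))%:E) ->
  cmeas f0 -> {ae leb3 R, forall x, f0 x = f x} -> is_weak_partial i f0 g ->
  {ae leb3 R, forall x, g x = (\1_(cube (N + 1)) x)%:C * g x}.
Proof.
move=> N0 lf mg ig mf0 f0f fg; pose L k := N + 1 + k%:R.
have NL k : N + 1 <= L k by rewrite lerDl.
have L0 k : 0 <= L k by rewrite addr_ge0// addr_ge0.
pose G k x := (\1_(cube (L k)) x)%:C * g x.
have lG k : L2cube (L k) (G k) by exact: L2cube_cut.
have G0 k x : ~ cube (L k) x -> G 0%N x = 0.
  move=> nx; rewrite /G indicE memNset ?mul0r// => h; apply: nx.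
  by apply: cube_subset h; rewrite lerD2l.
have lG0 k : L2cube (L k) (G 0%N) by have [m j _] := lG 0%N; split => //; exact: G0.
have h k : {ae leb3 R, forall x, G k x = G 0%N x}.
  have lD := L2cubeB (lG k) (lG0 k); have [_ e] := parseval_L2cube (L0 k) lD.
  have F0 xi : fourier (fun x => G k x - G 0%N x) xi = 0.
    rewrite (_ : (fun x => _) = fun x => G k x + (-1) * G 0%N x); last first.
      by apply/funext => x; rewrite mulN1r.
    have i0 := L2cube_integrable (lG0 k).
    rewrite (fourierD _ (L2cube_integrable (lG k)) (cintegrableZ _ i0)) (fourierZ _ _ i0).
    rewrite /G (fourier_weak_partial (NL k) lf mg ig mf0 f0f fg).
    by rewrite (fourier_weak_partial (NL 0%N) lf mg ig mf0 f0f fg) mulN1r subrr.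
  have [mD iD _] := lD.
  have z : \int[leb3 R]_x csq (G k x - G 0%N x) = 0.
    apply: (@mulfI _ ((2 * pi) ^+ 3)).
      by rewrite lt0r_neq0// exprn_gt0// mulr_gt0// pi_gt0.
    rewrite -e mulr0 /Rintegral integral0_eq// => x _.
    by rewrite F0 /csq/= expr0n/= addr0.
  have z' : (\int[leb3 R]_x `|(csq (G k x - G 0%N x))%:E| = 0)%E.
    rewrite (eq_integral (fun x => (csq (G k x - G 0%N x))%:E)).
      by rewrite RintegralE// z.
    by move=> x _; rewrite gee0_abs// lee_fin csq_ge0.
  have mq : measurable_fun setT (fun x => (csq (G k x - G 0%N x))%:E).
    by apply/mf_EFin; exact: measurable_csq.
  have [+ _] := @ae_eq_integral_abs _ _ _ (leb3 R) _ measurableT _ mq.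
  move=> /(_ z'); apply: filterS => x /(_ I)/= [].
  rewrite /csq => /eqP; rewrite paddr_eq0 ?sqr_ge0// !sqrf_eq0 => /andP[/eqP h1 /eqP h2].
  by apply/eqP; rewrite -subr_eq0; apply/eqP/c_ext.
(* Countably many null sets are discarded at once; each remaining point lies in some cube of the
   sequence, where the cut function is [g] itself. *)
have := ae_foralln h; apply: filterS => x hx.
have [k xk] : exists k, cube (L k) x.
  pose M := Num.bound (`|x.1.1| + `|x.1.2| + `|x.2|); exists M.
  have hM : `|x.1.1| + `|x.1.2| + `|x.2| < M%:R.
    by rewrite /M; apply: archi_boundP; rewrite !addr_ge0.
  have b t : `|t| < M%:R -> - L M < t <= L M.
    rewrite ltr_norml => /andP[t1 t2]; rewrite /L; apply/andP; split; move: N0; lra.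
  have a1 := normr_ge0 x.1.1; have a2 := normr_ge0 x.1.2; have a3 := normr_ge0 x.2.
  by split; [split|]; rewrite /= in_itv/=; apply: b; lra.
have := hx k; rewrite /G [in X in X = _]indicE mem_set// mul1r => E.
by rewrite {1}E /L addr0.
Qed.

(** * Far field patterns *)

Section L2_functions.
Variable R : realType.
Implicit Types f g : TR3 R -> R[i].

Lemma Lnorm2E (h : TR3 R -> R) : (forall x, 0 <= h x) ->
  Lnorm (leb3 R) 2%:E (fun x => (h x)%:E) =
  ((\int[leb3 R]_x (h x ^+ 2)%:E) `^ 2^-1)%E.
Proof.
move=> h0; rewrite unlock; congr (_ `^ _)%E; apply: eq_integral => x _.
by rewrite gee0_abs ?lee_fin// poweR_EFin powR_mulrn.
Qed.

(** The half power of an infinite integral is infinite, so finiteness of [Lnorm] and of the integral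
    of squares are equivalent. *)
Lemma L2P f : L2 f <->
  cmeas f /\ (leb3 R).-integrable setT (fun x => (csq (f x))%:E).
Proof.
have e : Lnorm (leb3 R) 2%:E (fun x => (Normc.normc (f x))%:E) =
    ((\int[leb3 R]_x (csq (f x))%:E) `^ 2^-1)%E.
  rewrite Lnorm2E; last by move=> x; exact: cnorm_ge0.
  by congr (_ `^ _)%E; apply: eq_integral => x _; rewrite cnorm_sqr.
have ea : (\int[leb3 R]_x `|(csq (f x))%:E| = \int[leb3 R]_x (csq (f x))%:E)%E.
  by apply: eq_integral => x _; rewrite gee0_abs// lee_fin csq_ge0.
split=> [[m1 m2 fin]|[[m1 m2] /integrableP[_ fin]]].
  split=> //; apply/integrableP; split; first by apply/mf_EFin; exact: measurable_csq.
  rewrite ea; move: fin; rewrite e; apply: contraTT; rewrite -!leNgt !leye_eq => /eqP ->.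
  by rewrite poweRyr// invr_eq0 pnatr_eq0.
by split=> //; rewrite e; apply: poweR_lty; rewrite -ea.
Qed.

Lemma L2_ae N f g : cmeas f -> L2cube N g -> {ae leb3 R, forall x, f x = g x} -> L2 f.
Proof.
move=> mf [mg ig _] fg; apply/L2P; split=> //.
apply: (ae_le_integrable _ ig); first exact: measurable_csq.
by apply: filterS fg => x ->; rewrite ger0_norm ?csq_ge0.
Qed.

Lemma L2norm_cvg0 (D : R -> space3 R -> cvec3 R) :
  (forall r j, 0 < r -> (leb3 R).-integrable setT (fun z => (csq (D r z 0 j))%:E)) ->
  (forall e j, 0 < e -> exists M, forall r, M < r -> 0 < r ->
     (\int[leb3 R]_z (csq (D r z 0 j))%:E <= e%:E)%E) ->
  L2norm (D r) @[r --> +oo] --> 0%E.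
Proof.
move=> iD bD; pose q r j := \int[leb3 R]_z csq (D r z 0 j).
have nE r : 0 < r -> L2norm (D r) = (Num.sqrt (\sum_(j < 3) q r j))%:E.
  move=> r0; rewrite /L2norm Lnorm2E => [|x]; last exact: sqrtr_ge0.
  have S x : \sum_(j < 3) Normc.normc (D r x 0 j) ^+ 2 =
      csq (D r x 0 0) + csq (D r x 0 1) + csq (D r x 0 2%:R).
    rewrite !big_ord_recr big_ord0/= add0r !cnorm_sqr.
    by congr (_ + _ + _); congr (csq (D r x 0 _)); apply: val_inj.
  have i01 := integrableD_EFin (iD r 0 r0) (iD r 1 r0).
  have i012 := integrableD_EFin i01 (iD r 2%:R r0).
  have -> : (\int[leb3 R]_x (Num.sqrt (\sum_(j < 3) Normc.normc (D r x 0 j) ^+ 2) ^+ 2)%:E =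
      (\sum_(j < 3) q r j)%:E)%E.
    transitivity (\int[leb3 R]_x (csq (D r x 0 0) + csq (D r x 0 1) + csq (D r x 0 2%:R))%:E)%E.
      apply: eq_integral => x _; rewrite S sqr_sqrtr//.
      exact: (addr_ge0 (addr_ge0 (csq_ge0 _) (csq_ge0 _)) (csq_ge0 _)).
    rewrite (RintegralE i012) (RintegralD _ i01 (iD r 2%:R r0))//.
    rewrite (RintegralD _ (iD r 0 r0) (iD r 1 r0))//.
    rewrite !big_ord_recr big_ord0/= add0r /q; congr (_%:E).
    by congr (_ + _ + _); apply: eq_Rintegral => x _; congr (csq (D r x 0 _)); apply: val_inj.
  rewrite poweR_EFin powR12_sqrt// sumr_ge0// => j _.
  by apply: Rintegral_ge0 => x _; exact: csq_ge0.
have c : Num.sqrt (\sum_(j < 3) q r j) @[r --> +oo] --> (0 : R).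
  (* Each of the three components takes a third of the squared tolerance. *)
  apply/cvgr0Pnorm_le => e e0; have e3 : 0 < e ^+ 2 / 3 by rewrite divr_gt0// exprn_gt0.
  have [M0 h0] := bD _ 0 e3; have [M1 h1] := bD _ 1 e3; have [M2 h2] := bD _ 2%:R e3.
  near=> r; have r0 : 0 < r by near: r; exact: (nbhs_pinfty_gt (num_real _)).
  have b M j : M < r -> (forall r, M < r -> 0 < r ->
      (\int[leb3 R]_z (csq (D r z 0 j))%:E <= (e ^+ 2 / 3)%:E)%E) -> q r j <= e ^+ 2 / 3.
    by move=> Mr /(_ r Mr r0); rewrite (RintegralE (iD r j r0)) lee_fin.
  have b0 : q r 0 <= e ^+ 2 / 3 by apply: (b M0 _ _ h0); near: r; exact: (nbhs_pinfty_gt (num_real _)).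
  have b1 : q r 1 <= e ^+ 2 / 3 by apply: (b M1 _ _ h1); near: r; exact: (nbhs_pinfty_gt (num_real _)).
  have b2 : q r 2%:R <= e ^+ 2 / 3 by apply: (b M2 _ _ h2); near: r; exact: (nbhs_pinfty_gt (num_real _)).
  have S : \sum_(j < 3) q r j = q r 0 + q r 1 + q r 2%:R.
    rewrite !big_ord_recr big_ord0/= add0r.
    by congr (_ + _ + _); congr (q r _); apply: val_inj.
  rewrite ger0_norm ?sqrtr_ge0// -[leRHS]ger0_norm ?(ltW e0)// -sqrtr_sqr.
  by rewrite ler_wsqrtr// S; move: b0 b1 b2; lra.
have ce : (Num.sqrt (\sum_(j < 3) q r j))%:E @[r --> +oo] --> 0%E.
  by apply/fine_cvgP; split; [exact: nearW|exact: c].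
apply: cvg_trans ce; apply: near_eq_cvg; near=> r.
by rewrite nE//; near: r; exact: (nbhs_pinfty_gt (num_real _)).
Unshelve. all: by end_near. Qed.

End L2_functions.

(** * Vector algebra with cyclic indices *)

Section cyclic_indices.
Implicit Types j : 'I_3.

Lemma I3_add11 j : j + 1 + 1 = j + 2%:R.
Proof. by rewrite -addrA; congr (_ + _); apply: val_inj. Qed.

Lemma I3_add12 j : j + 1 + 2%:R = j.
Proof. by rewrite -addrA -[RHS]addr0; congr (_ + _); apply: val_inj. Qed.

Lemma I3_add21 j : j + 2%:R + 1 = j.
Proof. by rewrite -addrA -[RHS]addr0; congr (_ + _); apply: val_inj. Qed.

Lemma I3_add22 j : j + 2%:R + 2%:R = j + 1.
Proof. by rewrite -addrA; congr (_ + _); apply: val_inj. Qed.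

(** The sum may start at any index, so a cross product identity is checked for one generic component
    instead of three. *)
Lemma sum_I3 (V : nmodType) (F : 'I_3 -> V) j :
  \sum_(i < 3) F i = F j + F (j + 1) + F (j + 2%:R).
Proof.
rewrite !big_ord_recr big_ord0/= add0r.
have E a b c : F a + F b + F c = F b + F c + F a by rewrite -addrA addrC.
case: j => -[|[|[|//]]] hj; [|rewrite E|rewrite -E];
  by congr (_ + _ + _); congr F; apply: val_inj.
Qed.

End cyclic_indices.

Section cross_product.
Variable R : realType.
Implicit Types (x : space3 R) (a b : cvec3 R).

Lemma crossE a b j : cross a b 0 j = a 0 (j + 1) * b 0 (j + 2%:R) - a 0 (j + 2%:R) * b 0 (j + 1).
Proof. by rewrite mxE. Qed.

Lemma to_cvecE x j : to_cvec x 0 j = (coord3 x j)%:C.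
Proof. by rewrite mxE. Qed.

Lemma crossZr (k : R[i]) a b : cross a (k *: b) = k *: cross a b.
Proof. by apply/rowP => j; rewrite crossE !mxE; ring. Qed.

(** Bilinear, without conjugation: the first vector is real. *)
Definition cdot x a : R[i] := \sum_(i < 3) (coord3 x i)%:C * a 0 i.

(** The expansion of a double cross product; for a unit vector it is the projection onto the tangent
    plane. *)
Lemma cross_cross x a j : dot x x = 1 ->
  cross (to_cvec x) (cross a (to_cvec x)) 0 j = a 0 j - (coord3 x j)%:C * cdot x a.
Proof.
move=> x1; rewrite !crossE !to_cvecE I3_add11 I3_add12 I3_add21 I3_add22 /cdot (sum_I3 _ j).
have : (coord3 x j)%:C ^+ 2 + (coord3 x (j + 1))%:C ^+ 2 + (coord3 x (j + 2%:R))%:C ^+ 2 = 1 :> R[i].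
  transitivity (dot x x)%:C; last by rewrite x1.
  rewrite /dot (sum_I3 _ j).
  by apply: c_ext; rewrite !cE/=; ring.
set u := (coord3 x j)%:C; set v := (coord3 x (j + 1))%:C; set w := (coord3 x (j + 2%:R))%:C.
move=> e; rewrite -[X in _ = X - _]mulr1 -e; ring.
Qed.

(** The radial part that the projection removes is annihilated by the outer cross product anyway. *)
Lemma cross_cross_cross x a : dot x x = 1 ->
  cross (to_cvec x) (cross (to_cvec x) (cross a (to_cvec x))) = cross (to_cvec x) a.
Proof.
move=> x1; apply/rowP => j; rewrite crossE !cross_cross// [RHS]crossE !to_cvecE; ring.
Qed.

Lemma dot_sphere_param1 (t : TR2 R) : dot (sphere_param t) (sphere_param t) = 1.
Proof. by have := dot_sphere_param 1 t; rewrite scale1r expr1n. Qed.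

Lemma coord3Z (k : R) x j : coord3 (k *: x) j = k * coord3 x j.
Proof. by rewrite /coord3 /GRing.scale/=; case: ifP => //; case: ifP. Qed.

Lemma dotC (x y : space3 R) : dot x y = dot y x.
Proof. by rewrite !dotE; ring. Qed.

End cross_product.

Section components.
Variable R : realType.

Lemma compact_cube (K : set (space3 R)) : compact K -> exists2 N : R, 0 <= N & K `<=` cube N.
Proof.
move=> /compact_bounded/ex_strict_bound_gt0[M M0 KM]; exists M; first exact: ltW.
move=> x /KM/= xM; have n1 : `|x.1| <= `|x| by rewrite prod_normE/= le_max lexx.
have n2 : `|x.2| <= `|x| by rewrite prod_normE/= le_max lexx orbT.
have n11 : `|x.1.1| <= `|x.1| by rewrite prod_normE/= le_max lexx.
have n12 : `|x.1.2| <= `|x.1| by rewrite prod_normE/= le_max lexx orbT.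
have b t : `|t| < M -> - M < t <= M by rewrite ltr_norml => /andP[-> /ltW].
split; [split|]; rewrite /= in_itv/=; apply: b.
- exact: (le_lt_trans n11 (le_lt_trans n1 xM)).
- exact: (le_lt_trans n12 (le_lt_trans n1 xM)).
- exact: (le_lt_trans n2 xM).
Qed.

Lemma ae_eq_fourier (f g : TR3 R -> R[i]) xi : cmeas f -> cmeas g ->
  {ae leb3 R, forall x, f x = g x} -> fourier f xi = fourier g xi.
Proof.
move=> mf mg fg.
have mc : cmeas (fun x : TR3 R => cis (- dot x xi)).
  by apply/cmeas_cis/mf_opp/measurable_dot; [exact: mf_id|exact: measurable_cst].
apply: (ae_eq_cint (cmeasM mc mf) (cmeasM mc mg)).
by apply: filterS fg => x ->.
Qed.

Lemma eq_cint d (T : measurableType d) (m : {measure set T -> \bar R}) (D : set T)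
    (f g : T -> R[i]) : (forall x, D x -> f x = g x) -> cint m D f = cint m D g.
Proof.
move=> fg; rewrite [LHS]cint_mkcond [RHS]cint_mkcond; congr cint; apply/funext => x; rewrite indicE.
by have [/set_mem/fg ->|] := boolP (x \in D); rewrite ?mul0r.
Qed.

(** The scalar [k0] collects the constants of the field at hand, and $(2\pi)^3$ undoes the
    normalisation of [partial_inverse]. The transform is bounded because [G] is integrable, as
    [spherical_cint] requires. *)
Lemma spherical_partial_inverse (G : TR3 R -> R[i]) (M k0 r : R) (z : TR3 R) :
  0 <= M -> L2cube M G -> 0 < r ->
  cint (leb2 R) (`[0%R, pi] `*` `[0%R, (2 * pi)%R]) (fun t => (sin t.1)%:C *
    cint (leb R) `]0%R, r[ (fun k => k0%:C * (cis (dot (k *: sphere_param t) z) *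
      fourier G (k *: sphere_param t)) * (k ^+ 2)%:C)) =
  (k0 * (2 * pi) ^+ 3)%:C * partial_inverse G r z.
Proof.
move=> M0 lG r0; have iG := L2cube_integrable lG; have [mG _ _] := lG.
pose F (x : TR3 R) := k0%:C * (cis (dot x z) * fourier G x).
have mcis : cmeas (fun x : TR3 R => cis (dot x z)).
  by apply/cmeas_cis/measurable_dot; [exact: mf_id|exact: measurable_cst].
have mF : cmeas F.
  by apply: cmeasM; [exact: cmeas_cst|apply: cmeasM => //; exact: cmeas_fourier].
have bF x : Normc.normc (F x) <= `|k0| * (2 * \int[leb3 R]_x Normc.normc (G x)).
  rewrite !cnormM cnorm_real cnorm_cis mul1r ler_wpM2l//.
  apply: (le_trans (cnorm_cint_le (cintegrable_fourier x iG))).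
  rewrite ler_wpM2l// le_eqVlt; apply/orP; left; apply/eqP.
  by apply: eq_Rintegral => y _; rewrite cnormM cnorm_cis mul1r.
have := spherical_cint r0 mF bF; rewrite -/(leb2 R) => ->.
have icut : cintegrable (leb3 R) (fun x => cis (dot x z) * cut_fourier G r x).
  apply: (cintegrable_unimodular mcis); first by move=> x; exact: cnorm_cis.
  exact: (L2cube_integrable (L2cube_cut_fourier M0 lG (ltW r0))).
rewrite /partial_inverse mulrA.
have -> : (k0 * (2 * pi) ^+ 3)%:C * (((2 * pi) ^+ 3)^-1)%:C = k0%:C :> R[i].
  rewrite -rmorphM/= mulfK// lt0r_neq0// exprn_gt0// mulr_gt0//; exact: pi_gt0.
rewrite -(cintZ _ icut); congr cint; apply/funext => x.
by rewrite /F /cut_fourier; ring.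
Qed.

End components.

(** * Representatives supported in a common cube *)

Section reduction.
Variables (R : realType) (J : space3 R -> cvec3 R).

Lemma L2cube_mono (N M : R) (f : TR3 R -> R[i]) : N <= M -> L2cube N f -> L2cube M f.
Proof.
move=> NM [mf jf fout]; split=> // x nx; apply: fout => Nx; apply: nx.
exact: cube_subset Nx.
Qed.

Lemma weak_partial_spec j (f : space3 R -> R[i]) : H1 f ->
  L2 (weak_partial j f) /\ is_weak_partial j f (weak_partial j f).
Proof. by move=> [_ /(_ j) h]; exact: (@xgetPex _ (fun=> 0) _ h). Qed.

(** Components and weak derivatives of [J] get representatives in [L2cube]. The cube exceeds the one
    around the support by 1 because the cutoff needs that margin between the support and its
    edge. *)
Lemma H1vec_reduction : H1vec J -> compact_support J ->
  exists M (Jc : 'I_3 -> TR3 R -> R[i]) (W : 'I_3 -> 'I_3 -> TR3 R -> R[i]),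
  [/\ 0 <= M,
    forall l, [/\ cmeas (fun x : TR3 R => J x 0 l), L2cube M (Jc l) &
      {ae leb3 R, forall x : TR3 R, J x 0 l = Jc l x}] &
    forall j l, [/\ cmeas (weak_partial j (fun x => J x 0 l) : TR3 R -> R[i]), L2cube M (W j l),
      {ae leb3 R, forall x : TR3 R, weak_partial j (fun y => J y 0 l) x = W j l x} &
      forall xi, fourier (W j l) xi = 'i * (coord3 xi j)%:C * fourier (Jc l) xi]].
Proof.
move=> HJ [K cK JK]; have [N N0 KN] := compact_cube cK.
have mJ l : cmeas (fun x : TR3 R => J x 0 l) /\
    (leb3 R).-integrable setT (fun x => (csq (J x 0 l))%:E) by have [/L2P] := HJ l.
pose Jc l x := (\1_(cube N) x)%:C * J x 0 l.
have lJ l : L2cube N (Jc l) by have [m i] := mJ l; exact: L2cube_cut.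
have aJ l : {ae leb3 R, forall x : TR3 R, J x 0 l = Jc l x}.
  have JK' : {ae leb3 R, forall x : TR3 R, ~ K x -> J x = 0} := JK.
  apply: filterS JK' => x Jx; rewrite /Jc indicE.
  have [_|/negP xN] := boolP (x \in cube N); first by rewrite mul1r.
  by rewrite mul0r Jx ?mxE// => /KN Nx; apply: xN; exact: mem_set.
have NM : N <= N + 1 by rewrite lerDl.
pose W j l x := (\1_(cube (N + 1)) x)%:C * weak_partial j (fun y => J y 0 l) x.
exists (N + 1), Jc, W; split; first by rewrite addr_ge0.
  by move=> l; have [m _] := mJ l; split => //; exact: L2cube_mono (lJ l).
move=> j l; have [/L2P[mw iw] ww] := weak_partial_spec j (HJ l).
have [m _] := mJ l; split => //.
- exact: L2cube_cut.
- exact: (weak_partial_ae N0 (lJ l) mw iw m (aJ l) ww).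
- by move=> xi; exact: (fourier_weak_partial (lexx _) (lJ l) mw iw m (aJ l) ww).
Qed.

End reduction.

(** The truncated fields equal partial inverses at every point, whereas the limit agrees with its
    representative only almost everywhere; norms do not see the difference. *)
Lemma L2_converges_partial_inverse (R : realType) (F : R -> space3 R -> cvec3 R)
    (G : space3 R -> cvec3 R) (M : R) (Gc : 'I_3 -> TR3 R -> R[i]) : 0 <= M ->
  (forall j, L2cube M (Gc j)) -> (forall j, cmeas (fun x : TR3 R => G x 0 j)) ->
  (forall j, {ae leb3 R, forall x : TR3 R, G x 0 j = Gc j x}) ->
  (forall r z j, 0 < r -> F r z 0 j = partial_inverse (Gc j) r z) ->
  L2_converges F G.
Proof.
move=> M0 lG mG aG FE.
have mF r j : 0 < r -> cmeas (fun z : TR3 R => F r z 0 j).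
  move=> r0; rewrite (_ : (fun z => _) = partial_inverse (Gc j) r).
    by have [] := L2_partial_inverse M0 (lG j) (ltW r0).
  by apply/funext => z; exact: FE.
have aD r j : 0 < r -> {ae leb3 R, forall z : TR3 R, csq ((F r z - G z) 0 j) =
    csq (partial_inverse (Gc j) r z - Gc j z)}.
  by move=> r0; apply: filterS (aG j) => z e; rewrite !mxE e FE.
have mD r j : 0 < r -> measurable_fun (setT : set (TR3 R)) (fun z => csq ((F r z - G z) 0 j)).
  move=> r0; apply: measurable_csq.
  rewrite (_ : (fun z => _) = fun z => F r z 0 j - G z 0 j).
    by apply: cmeasB; [exact: mF|exact: mG].
  by apply/funext => z; rewrite !mxE.
have iD r j : 0 < r -> (leb3 R).-integrable setT (fun z => (csq ((F r z - G z) 0 j))%:E).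
  move=> r0; have [i _] := partial_inverse_dist M0 (lG j) (ltW r0).
  apply: (ae_le_integrable _ i); first exact: mD.
  by apply: filterS (aD r j r0) => z ->; rewrite ger0_norm ?csq_ge0.
split.
- move=> r r0 j; have [m i _] := L2_partial_inverse M0 (lG j) (ltW r0).
  apply/L2P; split; first exact: mF.
  by move: i; apply: eq_integrable => // z _; rewrite FE.
- by move=> j; apply: (L2_ae (mG j) (lG j)); exact: aG.
apply: (L2norm_cvg0 iD) => e j e0.
have [M' h] := partial_inverse_cvg M0 (lG j) e0; exists M' => r rM r0.
apply: le_trans (h r rM (ltW r0)); rewrite le_eqVlt; apply/orP; left; apply/eqP.
have [i _] := partial_inverse_dist M0 (lG j) (ltW r0).
apply: ae_eq_integral => //.
- by apply: mf_EFin; exact: mD.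
- exact: measurable_int i.
- by apply: filterS (aD r j r0) => z e' _; rewrite e'.
Qed.

(** * The two reconstruction formulas by components *)

Section far_field.
Variables (R : realType) (eps mu : R) (J : space3 R -> cvec3 R).
Hypotheses (heps : 0 < eps) (hmu : 0 < mu).

Definition hat (xi : space3 R) : cvec3 R := \row_l fourier (fun x => J x 0 l) xi.

Lemma vint_hat xh k :
  vint (leb3 R) setT (fun y => cis (- (k * dot xh y)) *: J y) = hat (k *: xh).
Proof.
apply/rowP => l; rewrite !mxE; congr cint; apply/funext => y.
by rewrite !mxE [dot y _]dotC dotZl.
Qed.

Lemma far_E_component xh k j : dot xh xh = 1 ->
  far_E eps J xh k 0 j = 'i * k%:C / (4 * pi * Num.sqrt eps)%:C *
    (hat (k *: xh) 0 j - (coord3 xh j)%:C * cdot xh (hat (k *: xh))).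
Proof. by move=> x1; rewrite /far_E mxE vint_hat cross_cross. Qed.

Lemma far_H_component xh k j : dot xh xh = 1 ->
  far_H eps mu J xh k 0 j = (Num.sqrt (eps / mu))%:C * ('i * k%:C / (4 * pi * Num.sqrt eps)%:C *
    cross (to_cvec xh) (hat (k *: xh)) 0 j).
Proof.
move=> x1; rewrite /far_H /far_E crossZr mxE; congr (_ * _).
by rewrite mxE vint_hat cross_cross_cross.
Qed.

Variables (M : R) (Jc : 'I_3 -> TR3 R -> R[i]) (W : 'I_3 -> 'I_3 -> TR3 R -> R[i]).
Hypothesis M0 : 0 <= M.
Hypothesis hJ : forall l, [/\ cmeas (fun x : TR3 R => J x 0 l), L2cube M (Jc l) &
      {ae leb3 R, forall x : TR3 R, J x 0 l = Jc l x}].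
Hypothesis hW : forall j l, [/\ cmeas (weak_partial j (fun x => J x 0 l) : TR3 R -> R[i]),
      L2cube M (W j l),
      {ae leb3 R, forall x : TR3 R, weak_partial j (fun y => J y 0 l) x = W j l x} &
      forall xi, fourier (W j l) xi = 'i * (coord3 xi j)%:C * fourier (Jc l) xi].

Lemma hatE xi l : hat xi 0 l = fourier (Jc l) xi.
Proof.
rewrite mxE; have [mJ [mc _ _] aJ] := hJ l.
exact: (ae_eq_fourier xi mJ mc aJ).
Qed.

Definition curl_cut (j : 'I_3) (x : TR3 R) : R[i] := W (j + 1) (j + 2%:R) x - W (j + 2%:R) (j + 1) x.

Lemma L2cube_curl_cut j : L2cube M (curl_cut j).
Proof.
by apply: L2cubeB; [have [] := hW (j + 1) (j + 2%:R)|have [] := hW (j + 2%:R) (j + 1)].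
Qed.

Lemma curlE x j : curl J x 0 j = weak_partial (j + 1) (fun y => J y 0 (j + 2%:R)) x
          - weak_partial (j + 2%:R) (fun y => J y 0 (j + 1)) x.
Proof. by rewrite mxE. Qed.

Lemma cmeas_curl j : cmeas (fun x : TR3 R => curl J x 0 j).
Proof.
rewrite (funext (fun x => curlE x j)).
by apply: cmeasB; [have [] := hW (j + 1) (j + 2%:R)|have [] := hW (j + 2%:R) (j + 1)].
Qed.

Lemma curl_ae j : {ae leb3 R, forall x : TR3 R, curl J x 0 j = curl_cut j x}.
Proof.
have [_ _ a1 _] := hW (j + 1) (j + 2%:R); have [_ _ a2 _] := hW (j + 2%:R) (j + 1).
by apply: filterS2 a1 a2 => x e1 e2; rewrite curlE e1 e2.
Qed.

Lemma fourier_curl_cut j xh k : fourier (curl_cut j) (k *: xh) =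
  'i * k%:C * cross (to_cvec xh) (hat (k *: xh)) 0 j.
Proof.
have [_ l1 _ e1] := hW (j + 1) (j + 2%:R); have [_ l2 _ e2] := hW (j + 2%:R) (j + 1).
rewrite (_ : curl_cut j = fun x => W (j + 1) (j + 2%:R) x + (-1) * W (j + 2%:R) (j + 1) x); last first.
  by apply/funext => x; rewrite mulN1r.
have i2 := L2cube_integrable l2.
rewrite (fourierD _ (L2cube_integrable l1) (cintegrableZ _ i2)) (fourierZ _ _ i2) e1 e2.
rewrite crossE !to_cvecE !hatE !coord3Z !rmorphM/=; ring.
Qed.

Lemma I_H_component r z j : 0 < r -> I_H eps mu J r z 0 j = partial_inverse (curl_cut j) r z.
Proof.
(* The constants of [far_H] and [far_E] together. With the prefactor $\sqrt\mu/(2\pi^2)$ and the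
   $(2\pi)^3$ of inversion they multiply to 1; the remaining factor $ik$ belongs to the transform of
   the curl. *)
move=> r0; pose k0 := Num.sqrt (eps / mu) / (4 * pi * Num.sqrt eps).
have p0 := pi_gt0 R; have se : 0 < Num.sqrt eps by rewrite sqrtr_gt0.
have sm : 0 < Num.sqrt mu by rewrite sqrtr_gt0.
have c0 : (Num.sqrt mu / (2 * pi ^+ 2)) * (k0 * (2 * pi) ^+ 3) = 1.
  have h (p a b : R) : p != 0 -> a != 0 -> b != 0 ->
      b / (2 * p ^+ 2) * (a / b / (4 * p * a) * (2 * p) ^+ 3) = 1.
    by move=> hp ha hb; field; rewrite ha hp hb.
  by rewrite /k0 sqrtrM ?(ltW heps)// sqrtrV ?(ltW hmu)//; apply: h; exact: lt0r_neq0.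
transitivity ((Num.sqrt mu / (2 * pi ^+ 2))%:C * ((k0 * (2 * pi) ^+ 3)%:C * partial_inverse (curl_cut j) r z)); last first.
  by rewrite mulrA -rmorphM/= c0 mul1r.
rewrite -(spherical_partial_inverse k0 z M0 (L2cube_curl_cut j) r0).
rewrite mxE; congr (_ * _); rewrite mxE; apply: eq_cint => t _.
rewrite mxE; congr (_ * _); rewrite mxE; apply: eq_cint => k _.
rewrite mxE (far_H_component _ _ (dot_sphere_param1 t)) fourier_curl_cut dotZl.
rewrite /k0 !rmorphM/= fmorphV/= !rmorphM/=; ring.
Qed.

Definition div_cut (x : TR3 R) : R[i] := W 0 0 x + W 1 1 x + W 2%:R 2%:R x.

Lemma L2cube_div_cut : L2cube M div_cut.
Proof.
apply: L2cubeD; [apply: L2cubeD|].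
- by have [] := hW 0 0.
- by have [] := hW 1 1.
- by have [] := hW 2%:R 2%:R.
Qed.

Lemma divE x : div J x = weak_partial 0 (fun y => J y 0 0) x +
  weak_partial 1 (fun y => J y 0 1) x + weak_partial 2%:R (fun y => J y 0 2%:R) x.
Proof. by rewrite /div (sum_I3 _ 0) !add0r. Qed.

Lemma cmeas_div : cmeas (div J : TR3 R -> R[i]).
Proof.
rewrite (funext divE); apply: cmeasD; [apply: cmeasD|].
- by have [] := hW 0 0.
- by have [] := hW 1 1.
- by have [] := hW 2%:R 2%:R.
Qed.

Lemma div_ae : {ae leb3 R, forall x : TR3 R, div J x = div_cut x}.
Proof.
have [_ _ a0 _] := hW 0 0; have [_ _ a1 _] := hW 1 1; have [_ _ a2 _] := hW 2%:R 2%:R.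
by apply: filterS3 a0 a1 a2 => x e0 e1 e2; rewrite divE e0 e1 e2.
Qed.

Lemma fourier_div_cut xh k : fourier div_cut (k *: xh) = 'i * k%:C * cdot xh (hat (k *: xh)).
Proof.
have [_ l0 _ e0] := hW 0 0; have [_ l1 _ e1] := hW 1 1; have [_ l2 _ e2] := hW 2%:R 2%:R.
have i0 := L2cube_integrable l0; have i1 := L2cube_integrable l1; have i2 := L2cube_integrable l2.
rewrite (fourierD _ (cintegrableD i0 i1) i2) (fourierD _ i0 i1) e0 e1 e2.
rewrite /cdot (sum_I3 _ 0) !add0r !hatE !coord3Z !rmorphM/=; ring.
Qed.

Lemma cmeas_charge_density k : cmeas (charge_density eps mu J k : TR3 R -> R[i]).
Proof. by apply: cmeasM; [exact: cmeas_cst|exact: cmeas_div]. Qed.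

Lemma charge_density_ae k : {ae leb3 R, forall x : TR3 R, charge_density eps mu J k x =
  ('i * (frequency eps mu k)%:C)^-1 * div_cut x}.
Proof. by apply: filterS div_ae => x e; rewrite /charge_density e. Qed.

Lemma L2_charge_density k : L2 (charge_density eps mu J k).
Proof.
exact: (L2_ae (cmeas_charge_density k) (L2cubeZ _ L2cube_div_cut) (charge_density_ae k)).
Qed.

Lemma fourier_charge_density xh k :
  fourier (charge_density eps mu J k) (k *: xh) =
  ('i * (frequency eps mu k)%:C)^-1 * ('i * k%:C * cdot xh (hat (k *: xh))).
Proof.
have lD := L2cube_div_cut; have [mZ _ _] := L2cubeZ (('i * (frequency eps mu k)%:C)^-1) lD.
rewrite (ae_eq_fourier _ (cmeas_charge_density k) mZ (charge_density_ae k)).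
by rewrite (fourierZ _ _ (L2cube_integrable lD)) fourier_div_cut.
Qed.

(** The charge term contributes $k\hat x(\hat x\cdot F)$ and the electric term $k(F-\hat x(\hat
    x\cdot F))$, where $F$ is the transform of [J] at $k\hat x$. Their sum is $kF$, and its factor
    $k$ completes the weight to $k^2$. *)
Lemma I_rho_component r z j : 0 < r -> I_rho eps mu J r z 0 j = partial_inverse (Jc j) r z.
Proof.
move=> r0; have [_ lJ _] := hJ j.
have p0 := pi_gt0 R; have se : 0 < Num.sqrt eps by rewrite sqrtr_gt0.
have c0 : (((2 * pi) ^+ 3)^-1) * (1 * (2 * pi) ^+ 3) = 1 :> R.
  by rewrite mul1r mulVf// lt0r_neq0// exprn_gt0// mulr_gt0.
transitivity ((((2 * pi) ^+ 3)^-1)%:C * ((1 * (2 * pi) ^+ 3)%:C * partial_inverse (Jc j) r z)); last first.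
  by rewrite mulrA -rmorphM/= c0 mul1r.
rewrite -(spherical_partial_inverse 1 z M0 lJ r0).
rewrite mxE; congr (_ * _); rewrite mxE; apply: eq_cint => t _.
rewrite mxE; congr (_ * _); rewrite mxE; apply: eq_cint => k /=; rewrite in_itv/= => /andP[k0 _].
(* The radial integral runs over [k > 0], so the frequency can be cancelled against the one in the
   denominator of the charge density. *)
have w0 : 0 < frequency eps mu k by rewrite divr_gt0// sqrtr_gt0 mulr_gt0.
have wn : (frequency eps mu k)%:C != 0 :> R[i].
  by rewrite (inj_eq (@complexI R)) lt0r_neq0.
have cn : (4 * pi * Num.sqrt eps)%:C != 0 :> R[i].
  by rewrite (inj_eq (@complexI R)) lt0r_neq0// !mulr_gt0.
have E (a b c : R[i]) (u v : cvec3 R) :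
  (a *: (b *: u - c *: v)) 0 j = a * (b * u 0 j - c * v 0 j) by rewrite !mxE.
rewrite E to_cvecE (far_E_component _ _ (dot_sphere_param1 t)) fourier_charge_density dotZl -hatE.
set w := (frequency eps mu k)%:C in wn *; set c := (4 * pi * Num.sqrt eps)%:C in cn *.
have ii : 'i * 'i = -1 :> R[i] by rewrite -expr2 sqr_i.
have i0 : 'i != 0 :> R[i].
  by apply/eqP => /(congr1 (@complex.Im R))/= /eqP; rewrite oner_eq0.
set s := cdot _ _; set h := hat _ 0 j; set x := (coord3 _ j)%:C.
have -> : w * (('i * w)^-1 * ('i * k%:C * s)) = k%:C * s by field; rewrite wn i0.
have -> : c * 'i * ('i * k%:C / c * (h - x * s)) = - (k%:C * (h - x * s)).
  have cancel_c (a b d u : R[i]) : a != 0 -> a * b * (b * d / a * u) = b * b * (d * u).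
    by move=> a0; field.
  rewrite (cancel_c _ _ _ _ cn).
  by rewrite ii mulN1r.
by rewrite expr2 rmorphM/=; ring.
Qed.

End far_field.

Theorem theorem3p2 (R : realType) (eps mu : R) (heps : 0 < eps) (hmu : 0 < mu)
    (J : space3 R -> cvec3 R) (HJ : H1vec J) (cJ : compact_support J) :
  L2_converges (I_H eps mu J) (curl J) /\
  ((forall k : R, 0 < k -> L2 (charge_density eps mu J k)) /\
   L2_converges (I_rho eps mu J) J).
Proof.
have [M [Jc [W [M0 hJ hW]]]] := H1vec_reduction HJ cJ; split; [|split].
- apply: (L2_converges_partial_inverse M0 (L2cube_curl_cut hW) (cmeas_curl hW) (curl_ae hW)).
  by move=> r z j; exact: (I_H_component heps hmu M0 hJ hW).
- by move=> k _; exact: (L2_charge_density eps mu hW).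
- apply: (@L2_converges_partial_inverse _ _ _ M Jc) => // [j|j|j|r z j].
  + by have [] := hJ j.
  + by have [] := hJ j.
  + by have [] := hJ j.
  + exact: (I_rho_component heps hmu M0 hJ hW).
Qed.
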